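(* Let $X$ be a geodesic metric space and let $\mathcal P$ be a collection of (nonempty) subsets of $X$. Then $X$ is asymptotically tree-graded with respect to $\mathcal P$ if and only if $\mathcal P$ is asymptotically transverse-free and there exists an almost-projection system for $\mathcal P$.
   Context: Notation: for $A\subseteq X$, $N_r(A)=\{x\in X: d(x,A)\le r\}$; $B_r(x)$ denotes the closed ball of radius $r$ around $x$. Tree-graded: a geodesic complete metric space $Y$ is tree-graded with respect to a collection of closed geodesic subsets (pieces) if ($T_1$) two different pieces intersect in at most one point, and ($T_2$) each simple geodesic triangle (three geodesics forming a simple closed curve; trivial one-point triangles are not counted) is contained in one piece. Asymptotically tree-graded: fix a non-principal ultrafilter on $\mathbb N$. $C(X,(p_n),(r_n))$ denotes the asymptotic cone of $X$ with basepoints $(p_n)$ and scaling factors $(r_n)$, $r_n\to\infty$ (the ultralimit of $(X,d/r_n,p_n)$). $X$ is asymptotically tree-graded with respect to $\mathcal P$ if all its asymptotic cones, with respect to the fixed ultrafilter, are tree-graded with respect to the collection of the (nonempty) ultralimits of sequences $(P_n)$ of elements of $\mathcal P$; here the collection of ultralimits is regarded as a family indexed by sequences $(P_n)$ up to equality almost everywhere with respect to the ultrafilter, so that ''different pieces'' in $(T_1)$ means pieces coming from sequences that differ almost everywhere. Almost-projection system: a family of maps $\{\pi_P:X\to P\}_{P\in\mathcal P}$ is an almost-projection system for $\mathcal P$ if there exists $C\ge0$ such that, for each $P\in\mathcal P$: (AP1) for each $x\in X$, $p\in P$, $d(x,p)\ge d(x,\pi_P(x))+d(\pi_P(x),p)-C$;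 (AP2) for each $x\in X$ with $d(x,P)=d$, $\mathrm{diam}(\pi_P(B_d(x)))\le C$; (AP3) for each $Q\in\mathcal P$ with $Q\ne P$, $\mathrm{diam}(\pi_P(Q))\le C$. Asymptotically transverse-free: a geodesic triangle $\Delta$ is $\mathcal P$-almost-transverse with constants $K,D$ if for each $P\in\mathcal P$ and each side $\gamma$ of $\Delta$, $\mathrm{diam}(N_K(P)\cap\gamma)\le D$. A triangle is $\delta$-thin if any point on one of its sides is at distance at most $\delta$ from the union of the other two sides. $\mathcal P$ is asymptotically transverse-free if there exist $\lambda,\sigma$ such that for each $D\ge1$, $K\ge\sigma$: if $\Delta$ is a geodesic triangle which is $\mathcal P$-almost-transverse with constants $K,D$, then $\Delta$ is $\lambda D$-thin. *)

(* Defs.v *)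
From HB Require Import structures.
From mathcomp Require Import all_boot all_order all_algebra.
From mathcomp Require Import generic_quotient.
From mathcomp Require Import all_classical all_reals all_analysis.

Set Implicit Arguments.
Unset Strict Implicit.
Unset Printing Implicit Defensive.

Import Order.TTheory GRing.Theory Num.Theory.
Import numFieldNormedType.Exports.

Local Open Scope classical_set_scope.
Local Open Scope ring_scope.

Section MetricNotions.
Context {R : realType} {X : metricType R}.
Implicit Types (A : set X) (x y : X).

Lemma edist_mdist x y : edist (x, y) = (mdist x y)%:E.
Proof.
apply/eqP; rewrite eq_le; apply/andP; split.
  apply/lee_addgt0Pr => e e0; rewrite -EFinD; apply: edist_fin.
    by rewrite (le_lt_trans (mdist_ge0 x y))// ltrDl.
  by rewrite /= ballEmdist /= ltrDl.
apply: le_ereal_inf_tmp => _ /= [r [_ xyr] <-].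
by move: xyr; rewrite ballEmdist lee_fin => /ltW.
Qed.

Definition neighborhood (r : R) A : set X :=
  [set x | (edist_inf A x <= r%:E)%E].

(* The diameter of the empty set is -oo here rather than 0. *)
Definition diam A : \bar R :=
  ereal_sup [set (mdist x y)%:E | x in A & y in A].

Definition geodesic (l : R) (g : R -> X) : Prop :=
  0 <= l /\
  forall s t, s \in `[0, l] -> t \in `[0, l] -> mdist (g s) (g t) = `|s - t|.

Definition geodesic_subset A : Prop := forall x y, A x -> A y ->
  exists (l : R) (g : R -> X),
    [/\ geodesic l g, g 0 = x, g l = y & g @` `[0, l] `<=` A].

(* The sides form a cycle: [ordS] is the successor modulo 3. *)
Record geodesic_triangle := GeodesicTriangle {
  side_length : 'I_3 -> R ;
  side_path : 'I_3 -> R -> X ;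
  side_geodesic : forall i, geodesic (side_length i) (side_path i) ;
  side_adjacent : forall i, side_path i (side_length i) = side_path (ordS i) 0
}.

Definition side (T : geodesic_triangle) (i : 'I_3) : set X :=
  side_path T i @` `[0, side_length T i].

Definition perimeter (T : geodesic_triangle) : R := \sum_i side_length T i.

Definition triangle_loop (T : geodesic_triangle) (t : R) : X :=
  let i0 : 'I_3 := ord0 in let i1 := ordS i0 in let i2 := ordS i1 in
  let a := side_length T i0 in let b := a + side_length T i1 in
  if t <= a then side_path T i0 t
  else if t <= b then side_path T i1 (t - a)
  else side_path T i2 (t - b).

(* The loop is automatically continuous and closed, so only injectivity on  *)
(* the half-open interval has to be required; a positive perimeter excludes *)
(* the one-point triangles.                                                 *)
Definition simple_triangle (T : geodesic_triangle) : Prop :=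
  0 < perimeter T /\
  forall s t, s \in `[0, perimeter T[ -> t \in `[0, perimeter T[ ->
    triangle_loop T s = triangle_loop T t -> s = t.

Definition thin_triangle (delta : R) (T : geodesic_triangle) : Prop :=
  forall i, side T i `<=`
    neighborhood delta (\bigcup_(j in [set j | j != i]) side T j).

(* A family indexed by [D : set I]: two pieces count as different as soon as *)
(* their indices are, even when they are equal as sets.                      *)
Record tree_graded (I : Type) (D : set I) (F : I -> set X) : Prop := {
  tree_graded_complete : forall u : nat -> X,
    cauchy (u @ \oo) -> exists l : X, u @ \oo --> l ;
  tree_graded_geodesic : geodesic_subset [set: X] ;
  tree_graded_piece_closed : forall i, D i -> closed (F i) ;
  tree_graded_piece_geodesic : forall i, D i -> geodesic_subset (F i) ;
  tree_graded_T1 : forall i j, D i -> D j -> i <> j ->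
    is_subset1 (F i `&` F j) ;
  tree_graded_T2 : forall T : geodesic_triangle, simple_triangle T ->
    exists2 i, D i & \bigcup_j side T j `<=` F i
}.

(* [pi P] is the projection to [P]; its values for [P] outside the collection *)
(* are irrelevant. The balls in (AP2) are [set y | d(x, y) <= d(x, P)], which *)
(* may differ from the topological closure of the open ball.                  *)
Definition almost_projection_system (PP : set (set X))
    (pi : set X -> X -> X) : Prop :=
  (forall P, PP P -> forall x, P (pi P x)) /\
  exists2 C : R, 0 <= C & forall P, PP P ->
    [/\ forall x p, P p ->
          mdist x p >= mdist x (pi P x) + mdist (pi P x) p - C,
        forall x,
          (diam (pi P @` [set y | (mdist x y)%:E <= edist_inf P x]%E)
             <= C%:E)%E
      & forall Q, PP Q -> Q <> P -> (diam (pi P @` Q) <= C%:E)%E].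

Definition almost_transverse (PP : set (set X)) (K D : R)
    (T : geodesic_triangle) : Prop :=
  forall P i, PP P -> (diam (neighborhood K P `&` side T i) <= D%:E)%E.

Definition asymptotically_transverse_free (PP : set (set X)) : Prop :=
  exists lambda sigma : R, forall D K : R, 1 <= D -> sigma <= K ->
    forall T : geodesic_triangle,
      almost_transverse PP K D T -> thin_triangle (lambda * D) T.

End MetricNotions.
Arguments geodesic_triangle {R} X.

Definition geodesic_space {R : realType} (X : metricType R) : Prop :=
  geodesic_subset [set: X].

Definition nonprincipal {T : Type} (F : set_system T) : Prop :=
  forall t, F <> principal_filter t.

(* Metric structures need the hypothesis that U is an ultrafilter, so the *)
(* proof [UU] is a parameter of the cone.                                 *)
Section AsymptoticCone.
Context {R : realType} {X : metricType R}.
Context (U : set_system nat) (UU : UltraFilter U).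
Context (p : nat -> X) (r : nat -> {posnum R}).

Definition scaled_dist (x y : nat -> X) (n : nat) : R :=
  mdist (x n) (y n) / (r n)%:num.

Definition ultradist (x y : nat -> X) : R := lim (scaled_dist x y @ U).

Definition admissible : set (nat -> X) :=
  [set x | exists M : R, \forall n \near U, scaled_dist p x n <= M].

Definition admissible_seq := set_type admissible.
Definition seq_of (x : admissible_seq) : nat -> X := val x.
HB.instance Definition _ := Choice.on admissible_seq.

Let scaled_sym x y : scaled_dist x y = scaled_dist y x.
Proof. by apply/funext => n; rewrite /scaled_dist metric_sym. Qed.

Let scaled_ge0 x y n : 0 <= scaled_dist x y n.
Proof. by rewrite /scaled_dist divr_ge0// mdist_ge0. Qed.

Let scaled_triangle x y z n :
  scaled_dist x z n <= scaled_dist x y n + scaled_dist y z n.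
Proof. by rewrite /scaled_dist -mulrDl ler_pM2r// metric_triangle. Qed.

Lemma ultradist_cvg (x y : admissible_seq) :
  scaled_dist (seq_of x) (seq_of y) @ U --> ultradist (seq_of x) (seq_of y).
Proof.
have [M xM] : admissible (seq_of x) by exact: set_mem (valP x).
have [N yN] : admissible (seq_of y) by exact: set_mem (valP y).
move: {x y}(seq_of x) (seq_of y) xM yN => x y xM yN.
have FU : UltraFilter (scaled_dist x y @ U).
  split; first exact: fmap_proper_filter.
  move=> G GP sFG; apply/seteqP; split => // A GA.
  have [//|UA] := in_ultra_setVsetC (scaled_dist x y @^-1` A) UU.
  have GCA : G (~` A) by apply: sFG.
  by have [? []] := filter_ex (filterI GA GCA).
have := @segment_compact R 0 (M + N); rewrite compact_ultra => cpt.
have [|l [_ Fl]] := cpt _ FU; last first.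
  by rewrite /ultradist (cvg_lim (@Rhausdorff R) Fl).
rewrite /fmap /=; near=> n; rewrite /= in_itv /=; apply/andP; split; first exact: scaled_ge0.
rewrite (le_trans (scaled_triangle x p y n))// scaled_sym.
by apply: lerD; near: n.
Unshelve. all: by end_near. Qed.

Lemma ultradistxx x : ultradist x x = 0.
Proof.
rewrite /ultradist (_ : scaled_dist x x = cst 0).
  exact: (cvg_lim (@Rhausdorff R) (cvg_cst _)).
by apply/funext => n; rewrite /scaled_dist mdistxx mul0r.
Qed.

Lemma ultradist_sym x y : ultradist x y = ultradist y x.
Proof. by rewrite /ultradist scaled_sym. Qed.

Lemma ultradist_ge0 (x y : admissible_seq) :
  0 <= ultradist (seq_of x) (seq_of y).
Proof.
apply: (cvgr_to_ge (@ultradist_cvg x y)).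
by apply: nearW => n; exact: scaled_ge0.
Qed.

Lemma ultradist_triangle (y x z : admissible_seq) :
  ultradist (seq_of x) (seq_of z) <=
  ultradist (seq_of x) (seq_of y) + ultradist (seq_of y) (seq_of z).
Proof.
rewrite -subr_ge0.
have xyz : (fun n => scaled_dist (seq_of x) (seq_of y) n
    + scaled_dist (seq_of y) (seq_of z) n
    - scaled_dist (seq_of x) (seq_of z) n) @ U -->
    ultradist (seq_of x) (seq_of y) + ultradist (seq_of y) (seq_of z)
    - ultradist (seq_of x) (seq_of z).
  by apply: cvgB; [apply: cvgD|]; exact: ultradist_cvg.
apply: (cvgr_to_ge xyz).
by apply: nearW => n /=; rewrite subr_ge0; exact: scaled_triangle.
Qed.

Definition cone_rel (x y : admissible_seq) : bool :=
  ultradist (seq_of x) (seq_of y) == 0.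

Lemma cone_rel_equiv : equiv_class_of cone_rel.
Proof.
split=> [x|x y|y x z]; rewrite /cone_rel.
- by rewrite ultradistxx.
- by rewrite ultradist_sym.
- move=> /eqP xy /eqP yz; rewrite eq_le ultradist_ge0 andbT.
  by rewrite (le_trans (ultradist_triangle y x z))// xy yz addr0.
Qed.

Canonical cone_equiv := EquivRelPack cone_rel_equiv.

Definition asymptotic_cone := {eq_quot cone_equiv}%qT.
HB.instance Definition _ := Choice.on asymptotic_cone.

Definition cone_pi (x : admissible_seq) : asymptotic_cone :=
  (\pi_asymptotic_cone x)%qT.

Lemma cone_piP x y :
  cone_pi x = cone_pi y <-> ultradist (seq_of x) (seq_of y) = 0.
Proof. by split=> [/eqmodP/eqP|/eqP xy]//; apply/eqmodP. Qed.

Definition cone_dist (a b : asymptotic_cone) : R :=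
  ultradist (seq_of (repr a)) (seq_of (repr b)).

Let ultradist_eq (x x' y : admissible_seq) : cone_pi x = cone_pi x' ->
  ultradist (seq_of x) (seq_of y) = ultradist (seq_of x') (seq_of y).
Proof.
move=> /cone_piP xx'; apply/eqP; rewrite eq_le.
rewrite (le_trans (ultradist_triangle x' x y)) ?xx' ?add0r//=.
by rewrite (le_trans (ultradist_triangle x x' y))// ultradist_sym xx' add0r.
Qed.

Lemma cone_distE (x y : admissible_seq) :
  cone_dist (cone_pi x) (cone_pi y) = ultradist (seq_of x) (seq_of y).
Proof.
have reprE w : cone_pi (repr (cone_pi w)) = cone_pi w by exact: reprK.
rewrite /cone_dist (ultradist_eq _ (reprE x)) ultradist_sym.
by rewrite (ultradist_eq _ (reprE y)) ultradist_sym.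
Qed.

Let cone_distxx a : cone_dist a a = 0.
Proof. exact: ultradistxx. Qed.

Let cone_dist_eq0 a b : cone_dist a b = 0 -> a = b.
Proof.
move=> ab; rewrite -[a]reprK -[b]reprK.
exact/cone_piP.
Qed.

Let cone_dist_sym a b : cone_dist a b = cone_dist b a.
Proof. exact: ultradist_sym. Qed.

Let cone_dist_triangle b a c : cone_dist a c <= cone_dist a b + cone_dist b c.
Proof. exact: ultradist_triangle. Qed.

HB.instance Definition _ := @isMetric.Build R asymptotic_cone
  cone_dist cone_distxx cone_dist_eq0 cone_dist_sym cone_dist_triangle.

Definition ultralimit (A : nat -> set X) : set asymptotic_cone :=
  [set a | exists2 x : admissible_seq, cone_pi x = a &
             \forall n \near U, A n (seq_of x n)].

End AsymptoticCone.
Arguments ultralimit {R X U} UU p r A _.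

Section Ultrapower.
Context {R : realType} {X : metricType R} (PP : set (set X)).
Context (U : set_system nat) (UU : UltraFilter U).

Definition piece_seq := nat -> set_type PP.
HB.instance Definition _ := Choice.on piece_seq.

Definition sets_of (P : piece_seq) : nat -> set X := fun n => val (P n).

Definition ae_eq_rel (P Q : piece_seq) : bool :=
  `[< \forall n \near U, P n = Q n >].

Lemma ae_eq_rel_equiv : equiv_class_of ae_eq_rel.
Proof.
split=> [P|P Q|Q P S].
- by apply/asboolP; exact: nearW.
- by apply/asbool_equiv_eq; split; apply: filterS => n ->.
- move=> /asboolP PQ /asboolP QS; apply/asboolP.
  by apply: filterS2 PQ QS => n -> ->.
Qed.

Canonical ae_eq_equiv := EquivRelPack ae_eq_rel_equiv.

Definition piece_index := {eq_quot ae_eq_equiv}%qT.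
HB.instance Definition _ := Choice.on piece_index.

Definition index_pi (P : piece_seq) : piece_index := (\pi_piece_index P)%qT.

Lemma index_piP P Q :
  index_pi P = index_pi Q <-> \forall n \near U, P n = Q n.
Proof.
split=> [/eqmodP/asboolP//|PQ].
by apply/eqmodP/asboolP.
Qed.

Definition cone_piece (p : nat -> X) (r : nat -> {posnum R})
    (q : piece_index) : set (asymptotic_cone UU p r) :=
  ultralimit UU p r (sets_of (repr q)).

Arguments cone_piece p r q _ : clear implicits.

Lemma cone_pieceE p r (P : piece_seq) :
  cone_piece p r (index_pi P) = ultralimit UU p r (sets_of P).
Proof.
have /index_piP PQ : index_pi (repr (index_pi P)) = index_pi P by exact: reprK.
apply/seteqP; split=> a [x xa xP]; exists x => //.
  by apply: filterS2 PQ xP => n; rewrite /sets_of => ->.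
by apply: filterS2 PQ xP => n; rewrite /sets_of => ->.
Qed.

Definition asymptotically_tree_graded : Prop :=
  forall (p : nat -> X) (r : nat -> {posnum R}),
    (r n)%:num @[n --> \oo] --> +oo ->
    tree_graded [set q | cone_piece p r q !=set0] (cone_piece p r).

End Ultrapower.
Arguments cone_piece {R X PP U} UU p r q _.

(* Main.v *)
(**
A gate of x in a set A is a point e of A with d(x, e) + d(e, p) <= d(x, p) for
all p in A; pieces of tree-graded spaces have gates, and a geodesic whose ends
have different gates passes through both of them.

From projections to cones: limits of the projections are gates in the cone. A
simple triangle with two points of a side in a piece lies in the piece, because
the gates of its vertices are vertices. If instead the triangle is transverse to
all pieces, then all its points have the same gates, the approximating triangles
in X are almost transverse, hence thin, and the triangle cannot be simple.

From cones to projections: nearest points are gates in the cones. If two points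
close to each other, compared with their distance to P, had distant projections
to P, then take such a configuration with nearly minimal distance to P. A first
cone shows that a geodesic from P and the path joining its end to the other
projection meet a second piece Q, and this contradicts (T1) in a cone whose scale
is given by the distances to Q.

From cones to transverse-freeness: in the cone at a point of a side, with scale
the distance d to the other two sides, a transverse side may be added to the
pieces, so that the point separates the ends of the side; but the rest of the
triangle joins them, far from the point.
*)

Require Import Defs.
From mathcomp Require Import all_boot all_order all_algebra.
From mathcomp Require Import generic_quotient.
From mathcomp Require Import all_classical all_reals all_analysis.
From mathcomp Require Import ring lra zify.

Set Implicit Arguments.
Unset Strict Implicit.
Unset Printing Implicit Defensive.

Import Order.TTheory GRing.Theory Num.Theory.
Import numFieldNormedType.Exports.

Local Open Scope classical_set_scope.
Local Open Scope ring_scope.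

(** Geodesics of a cone need not be limits of geodesics of $X$. For (T2) thinness itself repairs
    this: a point $z$ of a transverse side from $a$ to $b$ is a limit of points on geodesics from
    $a_n$ to $b_n$, because the triangles $a_n z_n b_n$ are almost transverse too. For the
    projections one cone is not enough: the first, of scale $L$, produces $Q$, but the distances to
    $Q$ may be negligible against $L$. The second scale is the largest of the lengths of the paths
    cut at $Q$ and of the distance between the two projections; the contradiction is that each of
    these turns out to be smaller than the scale. For transverse-freeness the other two sides may
    leave the cone, as nothing bounds their lengths in terms of $d$. The point is therefore chosen
    nearly as fat as possible, so that every point of every side is within $2d$ of another side;
    shortcuts between the sides then give a path around it made of at most 7 geodesics with ends
    within $200d$ of it. The pieces are arbitrary nonempty sets, so nearest points and first
    entrances exist only up to an error, taken to be 1 and lost in every cone. *)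

Section Reals.
Context {R : realType}.
Implicit Types (S : set R) (a b : R).

Lemma closed_max S a b : S !=set0 -> (forall t, S t -> a <= t <= b) ->
  (forall t, a <= t <= b -> (forall e, 0 < e -> exists2 s, S s & `|s - t| < e) ->
    S t) ->
  exists2 m, S m & forall t, S t -> t <= m.
Proof.
move=> [s0 Ss0] Sab Scl.
have supS : has_sup S by split; [exists s0|exists b => t /Sab /andP[]].
have ub t : S t -> t <= sup S by move=> St; exact: sup_upper_bound.
exists (sup S) => //; apply: Scl => [|e e0].
  apply/andP; split; first by have := ub _ Ss0; have := Sab _ Ss0; lra.
  by apply: ge_sup => [|t /Sab /andP[]//]; exists s0.
have [s Ss ls] := sup_adherent e0 supS.
by exists s => //; have := ub _ Ss; rewrite ltr_norml; lra.
Qed.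

Lemma closed_min S a b : S !=set0 -> (forall t, S t -> a <= t <= b) ->
  (forall t, a <= t <= b -> (forall e, 0 < e -> exists2 s, S s & `|s - t| < e) ->
    S t) ->
  exists2 m, S m & forall t, S t -> m <= t.
Proof.
move=> [s0 Ss0] Sab Scl.
have [||t tab H|m Sm mS] := @closed_max [set t | S (- t)] (- b) (- a).
- by exists (- s0); rewrite /= opprK.
- by move=> t /Sab; lra.
- apply: Scl => [|e e0]; first lra.
  have [s Ss se] := H _ e0; exists (- s) => //.
  by rewrite -opprD normrN.
exists (- m) => // t St; have : S (- - t) by rewrite opprK.
by move=> /mS; lra.
Qed.

(** The parameters at which a geodesic is within [M] of an arbitrary set need not form a closed set,
    so extrema up to 1 replace attained ones. *)
Lemma near_max S b : S !=set0 -> (forall t, S t -> t <= b) ->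
  exists2 u, S u & forall t, S t -> t < u + 1.
Proof.
move=> S0 Sb; have supS : has_sup S by split => //; exists b => t /Sb.
have [u Su ub] := sup_adherent ltr01 supS; exists u => // t St.
by have := sup_upper_bound supS St; lra.
Qed.

Lemma near_min S b : S !=set0 -> (forall t, S t -> b <= t) ->
  exists2 u, S u & forall t, S t -> u - 1 < t.
Proof.
move=> S0 Sb; have infS : has_inf S by split => //; exists b => t /Sb.
have [u Su ub] := inf_adherent ltr01 infS; exists u => // t St.
by have := ge_inf infS.2 St; lra.
Qed.

(* At the infimum 0 there is no minimiser up to a factor 2, hence the second *)
(* alternative.                                                              *)
Lemma near_halving S : S !=set0 -> (forall t, S t -> 0 <= t) ->
  exists2 u, S u & u <= 1 \/ forall t, S t -> u / 2 < t.
Proof.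
move=> S0 Sb; have infS : has_inf S by split => //; exists 0 => t /Sb.
have i0 : 0 <= inf S by apply: lb_le_inf => // t /Sb.
have [i1|i1] := leP (inf S) 0.
  have [u Su ub] := inf_adherent ltr01 infS; exists u => //; left; lra.
have [u Su ub] := inf_adherent i1 infS; exists u => //; right=> t St.
by have := ge_inf infS.2 St; lra.
Qed.

End Reals.

(** * Subpaths of geodesics, their first hits and last common points *)

Section Geodesics.
Context {R : realType} {Y : metricType R}.
Implicit Types (l s t : R) (g : R -> Y) (x y z : Y) (A : set Y).

Lemma geodesic_ge0 l g : geodesic l g -> 0 <= l.
Proof. by case. Qed.

Lemma geodesic_mdist l g s t : geodesic l g -> 0 <= s -> s <= t -> t <= l ->
  mdist (g s) (g t) = t - s.
Proof.
move=> [l0 H] s0 st tl; rewrite H ?in_itv/=; [|lra..].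
by rewrite distrC ger0_norm//; lra.
Qed.

Lemma geodesic_length l g : geodesic l g -> mdist (g 0) (g l) = l.
Proof.
move=> H; have l0 := geodesic_ge0 H.
by rewrite (geodesic_mdist H) ?subr0.
Qed.

Lemma geodesic_inj l g s t : geodesic l g -> 0 <= s <= l -> 0 <= t <= l ->
  g s = g t -> s = t.
Proof.
move=> [l0 H] sl tl st; have := H s t; rewrite !in_itv/= => /(_ sl tl).
by rewrite st mdistxx => /esym/eqP; rewrite normr_eq0 subr_eq0 => /eqP.
Qed.

Lemma geodesic_part l g a b : geodesic l g -> 0 <= a -> a <= b -> b <= l ->
  geodesic (b - a) (fun s => g (a + s)).
Proof.
move=> [l0 H] a0 ab bl; split=> [|s t]; first lra.
rewrite !in_itv/= => sb tb; rewrite H ?in_itv/=; [|lra..].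
by congr (`|_|); ring.
Qed.

Lemma geodesic_rev l g : geodesic l g -> geodesic l (fun s => g (l - s)).
Proof.
move=> [l0 H]; split=> // s t; rewrite !in_itv/= => sb tb.
rewrite H ?in_itv/=; [|lra..].
by rewrite distrC; congr (`|_|); ring.
Qed.

Lemma geodesic_cst x : geodesic 0 (fun=> x).
Proof.
split=> // s t; rewrite !in_itv/= => sb tb; rewrite mdistxx.
have -> : s - t = 0 by lra.
by rewrite normr0.
Qed.

(** Either order of [s] and [t] is allowed, the path being reversed when [t < s]. The last clause
    recovers the parameter on [g], so that later arguments need no case distinction on the
    orientation. *)
Lemma geodesic_sub l g s t : geodesic l g -> 0 <= s <= l -> 0 <= t <= l ->
  exists h, [/\ geodesic `|t - s| h, h 0 = g s, h `|t - s| = g t &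
    forall v, 0 <= v <= `|t - s| ->
      exists w, [/\ 0 <= w <= l, Num.min s t <= w <= Num.max s t & h v = g w]].
Proof.
move=> gg sl tl; have [st|ts] := leP s t.
  exists (fun v => g (s + v)); split.
  - by rewrite ger0_norm; [apply: (geodesic_part gg); lra|lra].
  - by rewrite addr0.
  - by rewrite ger0_norm; [congr (g _); ring|lra].
  - rewrite ger0_norm => [v vl|]; last lra.
    by exists (s + v); split => //; lra.
exists (fun v => g (s - v)); split.
- rewrite ltr0_norm; last lra.
  have := geodesic_rev (@geodesic_part l g t s gg _ _ _).
  rewrite opprB; have -> : (fun v => g (s - v)) = (fun v => g (t + (s - t - v))).
    by apply/funext => v; congr (g _); ring.
  by apply; lra.
- by rewrite subr0.
- by rewrite ltr0_norm; [congr (g _); ring|lra].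
- rewrite ltr0_norm => [v vl|]; last lra.
  by exists (s - v); split => //; lra.
Qed.

Lemma mdist0 x y : mdist x y <= 0 -> x = y.
Proof.
by move=> H; apply: mdist_positivity; have := mdist_ge0 x y; lra.
Qed.

Lemma mdist_small x y : (forall e : R, 0 < e -> mdist x y <= e) -> x = y.
Proof.
move=> H; apply: mdist0; apply/ler_addgt0Pr => e e0.
by rewrite add0r; exact: H.
Qed.

Lemma closed_mdist A : closed A <->
  (forall x, (forall e : R, 0 < e -> exists2 a, A a & mdist x a < e) -> A x).
Proof.
split=> [cA x H|H].
  apply: cA => B; rewrite -nbhs_ballE => -[e /= e0 eB].
  have [a Aa xa] := H _ e0; exists a; split => //; apply: eB.
  by rewrite ballEmdist.
move=> x /= cx; apply: H => e e0.
have [a [Aa]] := cx _ (nbhsx_ballx x e e0).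
by rewrite ballEmdist /= => xa; exists a.
Qed.

(** The limit parameter is known in advance: on a geodesic the distance to [g a] determines the
    parameter, which must be [a + mdist (g a) x]. *)
Lemma geodesic_adherent l g a b x : geodesic l g -> 0 <= a -> a <= b -> b <= l ->
  (forall e : R, 0 < e -> exists2 t, a <= t <= b & mdist x (g t) < e) ->
  exists2 t, a <= t <= b & x = g t.
Proof.
move=> gg a0 ab bl H; pose t := a + mdist (g a) x.
have tb : t <= b.
  apply/ler_addgt0Pr => e e0; have [s sab xs] := H _ e0.
  have := metric_triangle (g a) (g s) x; rewrite (geodesic_mdist gg); [|lra..].
  by rewrite metric_sym in xs; rewrite /t; lra.
have t0 := mdist_ge0 (g a) x.
exists t; first by rewrite /t in tb *; lra.
apply: mdist_small => e e0; have e20 : 0 < e / 2 by lra.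
have [s sab xs] := H _ e20.
have h1 := metric_triangle (g a) (g s) x.
have h2 := metric_triangle (g a) x (g s).
rewrite (geodesic_mdist gg) in h1 h2; [|lra..].
have h3 := metric_triangle x (g s) (g t); move: h3.
rewrite (metric_sym (g s) x) in h1.
have [st|ts] := leP s t.
  by rewrite (geodesic_mdist gg) ?/t; rewrite /t in tb st *; lra.
by rewrite (metric_sym (g s)) (geodesic_mdist gg) ?/t; rewrite /t in tb ts *; lra.
Qed.

Lemma geodesic_gap l g s t : geodesic l g -> 0 <= s <= l -> 0 <= t <= l ->
  mdist (g s) (g t) = `|s - t|.
Proof. by move=> [l0 H] sl tl; rewrite H // in_itv. Qed.

Lemma first_hit l g A t1 : closed A -> geodesic l g -> 0 <= t1 <= l ->
  A (g t1) -> exists t0, [/\ 0 <= t0 <= t1, A (g t0) &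
    forall t, 0 <= t <= l -> A (g t) -> t0 <= t].
Proof.
move=> cA gg t1l At1.
have [||t tl H|m [ml Am] mmin] := @closed_min R [set t | 0 <= t <= l /\ A (g t)] 0 l.
- by exists t1.
- by move=> t [].
- split=> //; apply: (closed_mdist A).1 => // e e0.
  have [s [sl As] se] := H _ e0; exists (g s) => //.
  by rewrite (geodesic_gap gg) // distrC.
exists m; split=> //; last by move=> t tl At; exact: mmin.
by rewrite (mmin t1)//; lra.
Qed.

Lemma last_common l g l' g' m : geodesic l g -> geodesic l' g' -> g 0 = g' 0 ->
  0 <= m -> m <= l -> m <= l' ->
  exists u, [/\ 0 <= u <= m, g u = g' u &
    forall t, 0 <= t <= m -> g t = g' t -> t <= u].
Proof.
move=> gg gg' g0 m0 ml ml'.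
have [||t tl H|u [um gu] umax] := @closed_max R [set t | 0 <= t <= m /\ g t = g' t] 0 m.
- by exists 0; split; [lra|].
- by move=> t [].
- split=> //; apply: mdist_small => e e0; have e20 : 0 < e / 2 by lra.
  have [s [sl gs] se] := H _ e20.
  apply: (le_trans (metric_triangle _ (g s) _)); rewrite {2}gs.
  rewrite (geodesic_gap gg) ?(geodesic_gap gg'); [|lra..].
  by rewrite distrC in se; rewrite distrC; move: se; rewrite (distrC t s); lra.
by exists u; split=> // t tm gt; exact: umax.
Qed.

End Geodesics.

(** * Geodesic triangles and their simple loops *)

Section Triangles.
Context {R : realType} {Y : metricType R}.
Implicit Types (T : geodesic_triangle Y).

Let i0 : 'I_3 := ord0.
Let i1 : 'I_3 := ordS i0.
Let i2 : 'I_3 := ordS i1.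

Lemma ordS3 (i : 'I_3) : ordS (ordS (ordS i)) = i.
Proof. by apply/val_inj; case: i => -[|[|[|]]]. Qed.

Lemma I3_cases (i j : 'I_3) : [\/ j = i, j = ordS i | j = ordS (ordS i)].
Proof.
case: i j => -[|[|[|//]]] ? [[|[|[|//]]] ?];
  by [apply: Or31; apply/val_inj|apply: Or32; apply/val_inj|apply: Or33; apply/val_inj].
Qed.

Lemma ordS_neq (i : 'I_3) : ordS i != i /\ ordS (ordS i) != i.
Proof. by case: i => -[|[|[|]]]. Qed.

Lemma perimeterE T :
  perimeter T = side_length T i0 + side_length T i1 + side_length T i2.
Proof.
rewrite /perimeter !big_ord_recr big_ord0 /= add0r.
by congr (_ + _ + _); congr (side_length T _); apply/val_inj.
Qed.

Lemma triangle_of_geodesics l1 g1 l2 g2 l3 g3 :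
  geodesic l1 g1 -> geodesic l2 g2 -> geodesic l3 g3 ->
  g1 l1 = g2 0 -> g2 l2 = g3 0 -> g3 l3 = g1 0 ->
  exists T : geodesic_triangle Y,
    [/\ side_length T i0 = l1 /\ side_path T i0 = g1,
        side_length T i1 = l2 /\ side_path T i1 = g2 &
        side_length T i2 = l3 /\ side_path T i2 = g3].
Proof.
move=> G1 G2 G3 E1 E2 E3.
pose L (i : 'I_3) := if i == i0 then l1 else if i == i1 then l2 else l3.
pose P (i : 'I_3) := if i == i0 then g1 else if i == i1 then g2 else g3.
have PG i : geodesic (L i) (P i) by rewrite /L /P; case: ifP => // _; case: ifP.
have PE i : P i (L i) = P (ordS i) 0.
  by case: i => -[|[|[|//]]] ?; rewrite /L /P.
by exists (GeodesicTriangle PG PE).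
Qed.

(** Injectivity of the loop may be tested for [s <= t], so each hypothesis restricts only the
    parameter on the later of two sides. The value [t = l3] is the end of the loop, which the
    half-open interval excludes. *)
Lemma simple_triangle_of T l1 g1 l2 g2 l3 g3 :
  side_length T i0 = l1 /\ side_path T i0 = g1 ->
  side_length T i1 = l2 /\ side_path T i1 = g2 ->
  side_length T i2 = l3 /\ side_path T i2 = g3 -> 0 < l1 ->
  (forall s t, 0 <= s <= l1 -> 0 <= t <= l2 -> g1 s = g2 t -> t = 0) ->
  (forall s t, 0 <= s <= l2 -> 0 <= t <= l3 -> g2 s = g3 t -> t = 0) ->
  (forall s t, 0 <= s <= l1 -> 0 <= t <= l3 -> g1 s = g3 t -> t = l3) ->
  simple_triangle T.
Proof.
move=> [L1 P1] [L2 P2] [L3 P3] l1_gt0 H12 H23 H13.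
have G1 := side_geodesic T i0; have G2 := side_geodesic T i1.
have G3 := side_geodesic T i2.
rewrite ?L1 ?L2 ?L3 ?P1 ?P2 ?P3 in G1 G2 G3.
have l2_ge0 := geodesic_ge0 G2; have l3_ge0 := geodesic_ge0 G3.
split; first by rewrite perimeterE L1 L2 L3; lra.
suff H s t : 0 <= s -> s <= t -> t < l1 + l2 + l3 ->
    triangle_loop T s = triangle_loop T t -> s = t.
  move=> s t; rewrite perimeterE L1 L2 L3 !in_itv/= => sp tp st.
  by have [le_st|lt_ts] := leP s t; [apply: H|apply/esym/H] => //; lra.
rewrite /triangle_loop -/i0 -/i1 -/i2 L1 L2 P1 P2 P3.
move=> s_ge0 st tp.
have [s1|s1] := leP s l1; have [t1|t1] := leP t l1; try lra.
- by apply: (geodesic_inj G1); lra.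
- have [t2|t2] := leP t (l1 + l2).
    by move=> /H12; lra.
  by move=> /H13; lra.
- have [s2|s2] := leP s (l1 + l2); have [t2|t2] := leP t (l1 + l2); try lra.
  + by move=> /(geodesic_inj G2); lra.
  + by move=> /H23; lra.
  + by move=> /(geodesic_inj G3); lra.
Qed.

(* The second alternative is the bigon, where the side between the other two *)
(* vertices has length 0.                                                    *)
Lemma simple_triangle_meet T (i : 'I_3) s t : simple_triangle T ->
  0 <= s <= side_length T i -> 0 <= t <= side_length T (ordS i) ->
  side_path T i s = side_path T (ordS i) t ->
  (s = side_length T i /\ t = 0) \/
  (side_length T (ordS (ordS i)) = 0 /\ s = 0 /\ t = side_length T (ordS i)).
Proof.
have G1 := side_geodesic T i0; have G2 := side_geodesic T i1.
have G3 := side_geodesic T i2.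
have E1 : side_path T i0 (side_length T i0) = side_path T i1 0.
  exact: side_adjacent.
have E2 : side_path T i1 (side_length T i1) = side_path T i2 0.
  exact: side_adjacent.
have E3 : side_path T i2 (side_length T i2) = side_path T i0 0.
  by rewrite side_adjacent ordS3.
have h1 := geodesic_ge0 G1; have h2 := geodesic_ge0 G2.
have h3 := geodesic_ge0 G3.
set l1 := side_length T i0 in E1 G1 h1 *; set l2 := side_length T i1 in E2 G2 h2 *.
set l3 := side_length T i2 in E3 G3 h3 *.
set g1 := side_path T i0 in E1 E3 G1 *; set g2 := side_path T i1 in E1 E2 G2 *.
set g3 := side_path T i2 in E2 E3 G3 *.
case; rewrite perimeterE -/l1 -/l2 -/l3 => p0 inj.
have loop1 u : 0 <= u <= l1 -> triangle_loop T u = g1 u.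
  by move=> ul; rewrite /triangle_loop ifT//; case/andP: ul.
have loop2 u : 0 <= u <= l2 -> triangle_loop T (l1 + u) = g2 u.
  move=> ul; rewrite /triangle_loop -/i0 -/i1 -/i2 -/l1 -/l2 -/g1 -/g2.
  case: ifP => ul1; first by have -> : u = 0 by [lra]; rewrite addr0.
  by rewrite ifT; [congr (g2 _); ring|lra].
have loop3 u : 0 <= u <= l3 -> triangle_loop T (l1 + l2 + u) = g3 u.
  move=> ul; rewrite /triangle_loop -/i0 -/i1 -/i2 -/l1 -/l2 -/g1 -/g2 -/g3.
  case: ifP => ul1.
    have -> : u = 0 by lra.
    have l20 : l2 = 0 by lra.
    by rewrite addr0 l20 addr0 E1 -E2 l20.
  case: ifP => ul2; first by have -> : u = 0 by [lra]; rewrite addr0 addrC addKr.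
  by congr (g3 _); ring.
have loopinj u v : 0 <= u < l1 + l2 + l3 -> 0 <= v < l1 + l2 + l3 ->
    triangle_loop T u = triangle_loop T v -> u = v.
  by move=> ub vb; apply: inj; rewrite in_itv.
have [e|e|e] := I3_cases i0 i; subst i; rewrite ?ordS3 -/i0 -/i1 -/i2
  -/l1 -/l2 -/l3 -/g1 -/g2 -/g3 => sl tl.
- have [sp|sp] := ltP s (l1 + l2 + l3); last first.
    by move=> _; left; lra.
  have [tp|tp] := ltP (l1 + t) (l1 + l2 + l3); last first.
    have tl2 : t = l2 by lra.
    have l30 : l3 = 0 by lra.
    rewrite tl2 E2 -{1}l30 E3 => /(geodesic_inj G1) s0.
    by right; rewrite s0//; lra.
  rewrite -loop1// -loop2// => /loopinj; lra.
- have [sp|sp] := ltP (l1 + s) (l1 + l2 + l3); last first.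
    move=> _; have sl2 : s = l2 by lra.
    by left; lra.
  have [tp|tp] := ltP (l1 + l2 + t) (l1 + l2 + l3); last first.
    have tl3 : t = l3 by lra.
    rewrite tl3 E3 -loop1 ?lexx// -(loop2 s)// => /loopinj; lra.
  rewrite -loop3// -loop2// => /loopinj; lra.
- have [tp|tp] := ltP t (l1 + l2 + l3); last first.
    by move=> _; have tl1 : t = l1; [lra|]; right; lra.
  have [sp|sp] := ltP (l1 + l2 + s) (l1 + l2 + l3); last first.
    have sl3 : s = l3 by lra.
    rewrite sl3 E3 -loop1 ?lexx// -(loop1 t)// => /loopinj; lra.
  rewrite -loop3// -loop1// => /loopinj; lra.
Qed.

End Triangles.

(** * Gates and tree-graded spaces *)

Section Gates.
Context {R : realType} {Y : metricType R}.
Implicit Types (A : set Y) (x y e : Y) (l : R) (g : R -> Y).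

Definition gate A x e :=
  A e /\ forall p, A p -> mdist x e + mdist e p <= mdist x p.

(** Only the gate of the start is asked to lie on the geodesic. Reversing the geodesic gives the
    other gate, and the gate inequality gives their order. *)
Definition gated A := (forall x, exists e, gate A x e) /\
  forall l g e e', geodesic l g -> gate A (g 0) e -> gate A (g l) e' ->
    e <> e' -> exists2 t, 0 <= t <= l & g t = e.

Lemma gate_unique A x e e' : gate A x e -> gate A x e' -> e = e'.
Proof.
move=> [Ae H] [Ae' H']; apply: mdist0.
have := H _ Ae'; have := H' _ Ae; rewrite (metric_sym e' e).
by lra.
Qed.

Lemma gate_id A x : A x -> gate A x x.
Proof. by move=> Ax; split=> // p Ap; rewrite mdistxx add0r. Qed.

Lemma gate_of_mem A x e : A x -> gate A x e -> e = x.
Proof. by move=> Ax /gate_unique; apply; exact: gate_id. Qed.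

(** The gate [e'] lies between [x] and every point of [A]; if it differed from a nearest point [e],
    it would be strictly nearer. *)
Lemma gate_nearest A x e : A e -> (exists e', gate A x e') ->
  (forall p, A p -> mdist x e <= mdist x p) -> gate A x e.
Proof.
move=> Ae [e' ge'] H; suff -> : e = e' by [].
have := H _ ge'.1; have := ge'.2 _ Ae; have := mdist_ge0 e' e => h1 h2 h3.
by apply/esym/mdist0; lra.
Qed.

Lemma gate_between A x z e : gate A x e ->
  mdist x z + mdist z e <= mdist x e -> gate A z e.
Proof.
move=> [Ae H] xze; split=> // p Ap; have := H _ Ap.
by have := metric_triangle x z p; lra.
Qed.

(** Adding the gate inequalities of [g t] towards both ends gives 2 d(g t, e) + d(g a, e) + d(e, g
    b) <= d(g a, g b), which forces the gate e of [g t] to be [g t] itself. *)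
Lemma gated_convex A l g a b t : (forall x, exists e, gate A x e) ->
  geodesic l g -> 0 <= a -> a <= t -> t <= b -> b <= l ->
  A (g a) -> A (g b) -> A (g t).
Proof.
move=> gA gg a0 at_ tb bl Aa Ab; have [e [Ae H]] := gA (g t).
suff -> : g t = e by [].
apply: mdist0; have := H _ Aa; have := H _ Ab.
have := metric_triangle (g a) e (g b).
rewrite (metric_sym (g a) e) (metric_sym (g t) (g a)) !(geodesic_mdist gg); [|lra..].
by lra.
Qed.

Lemma gated_geodesic A l g x y e e' : gated A -> geodesic l g -> g 0 = x ->
  g l = y -> gate A x e -> gate A y e' -> e <> e' ->
  exists s t, [/\ 0 <= s, s < t, t <= l, g s = e & g t = e'].
Proof.
move=> [gA H] gg <- <- ge ge' ee'.
have [s sl gs] := H _ _ _ _ gg ge ge' ee'.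
have [|||t tl gt] := H _ _ e' e (geodesic_rev gg) _ _ _.
- by rewrite subr0.
- by rewrite subrr.
- by apply: nesym.
exists s, (l - t); split => //; try lra.
rewrite ltNge; apply/negP => ts; apply: ee'.
have := ge.2 _ ge'.1; rewrite -gs -gt.
have := mdist_ge0 (g s) (g (l - t)).
rewrite (metric_sym (g s)) !(geodesic_mdist gg); [|lra..] => h1 h2.
by have -> : s = l - t by lra.
Qed.

Lemma gated_same A l g e e' x y : gated A -> geodesic l g -> g 0 = x ->
  g l = y -> gate A x e ->
  gate A y e' -> (forall s t, 0 <= s -> s < t -> t <= l -> A (g s) -> A (g t) -> False) ->
  e = e'.
Proof.
move=> gA gg gx gy ge ge' H; apply: contrapT => ee'.
have [s [t [s0 st tl gs gt]]] := gated_geodesic gA gg gx gy ge ge' ee'.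
by apply: (H s t) => //; rewrite ?gs ?gt; [exact: ge.1|exact: ge'.1].
Qed.

End Gates.

(** * Pieces of a tree-graded space are gated *)

Section TreeGraded.
Context {R : realType} {Y : metricType R} {J : Type} {D : set J} {F : J -> set Y}.
Hypothesis tg : tree_graded D F.
Implicit Types (x y e : Y) (l : R) (g : R -> Y).

Lemma tree_graded_triangle l1 g1 l2 g2 l3 g3 :
  geodesic l1 g1 -> geodesic l2 g2 -> geodesic l3 g3 ->
  g1 l1 = g2 0 -> g2 l2 = g3 0 -> g3 l3 = g1 0 -> 0 < l1 ->
  (forall s t, 0 <= s <= l1 -> 0 <= t <= l2 -> g1 s = g2 t -> t = 0) ->
  (forall s t, 0 <= s <= l2 -> 0 <= t <= l3 -> g2 s = g3 t -> t = 0) ->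
  (forall s t, 0 <= s <= l1 -> 0 <= t <= l3 -> g1 s = g3 t -> t = l3) ->
  exists2 j, D j & (forall t, 0 <= t <= l1 -> F j (g1 t)) /\
                   (forall t, 0 <= t <= l2 -> F j (g2 t)).
Proof.
move=> G1 G2 G3 E1 E2 E3 l10 H12 H23 H13.
have [T [T1 T2 T3]] := triangle_of_geodesics G1 G2 G3 E1 E2 E3.
have sT := simple_triangle_of T1 T2 T3 l10 H12 H23 H13.
have [j Dj TF] := tree_graded_T2 tg sT; exists j => //.
have {}TF i t : 0 <= t <= side_length T i -> F j (side_path T i t).
  by move=> tl; apply: TF; exists i => //; exists t; rewrite //= in_itv.
by move: T1 T2 => [<- <-] [<- <-]; split=> t; exact: TF.
Qed.

(** A geodesic from [g 0] to p has a first hit of its own. If this is not [g l], the two geodesics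
    after their last common point and a geodesic of the piece between the two hits form a simple
    triangle. By (T2) and (T1) it lies in [F i], so that g would meet [F i] before [l]. *)
Lemma tree_graded_first_hit i l g : D i -> geodesic l g -> F i (g l) ->
  (forall t, 0 <= t <= l -> F i (g t) -> l <= t) -> gate (F i) (g 0) (g l).
Proof.
move=> Di gg Fl hit; split=> // p Fp; have l0 := geodesic_ge0 gg.
have [lh0 [h0 [gh0 h00 h0l _]]] := tree_graded_geodesic tg (I : setT (g 0)) (I : setT p).
have lh00 := geodesic_ge0 gh0.
have cF := tree_graded_piece_closed tg Di.
have [||l' [l'h Fl' hit']] := first_hit (t1 := lh0) cF gh0.
- lra.
- by rewrite h0l.
have [el|nel] := pselect (g l = h0 l').
  rewrite (geodesic_length gg) el -h0l (geodesic_mdist gh0)//; try lra.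
  have := geodesic_length gh0; have := geodesic_length gg.
  rewrite el -h00 (geodesic_mdist gh0); lra.
have h'h : geodesic l' h0 by have := geodesic_part gh0 (lexx 0) (b := l');
  rewrite subr0 (_ : (fun s => h0 (0 + s)) = h0) ?h00; [apply; lra|apply/funext => s; rewrite add0r].
have [m [ml ml' m0 mP]] : exists m, [/\ m <= l, m <= l', 0 <= m &
    forall t, t <= l -> t <= l' -> t <= m].
  by exists (Num.min l l'); split=> [||| t]; case: (leP l l'); clear - tg l0 l'h; lra.
have [u [um gu umax]] := last_common gg h'h (esym h00) m0 ml ml'.
have ul : u < l.
  rewrite ltNge; apply/negP => lu; have ulE : u = l by lra.
  have Fu : F i (h0 u) by rewrite -gu ulE.
  have := hit' u _ Fu => ul'; apply: nel.
  by have -> : l' = u; [lra|rewrite -gu ulE].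
have ul' : u < l'.
  rewrite ltNge; apply/negP => lu; have ulE : u = l' by lra.
  have Fu : F i (g u) by rewrite gu ulE.
  by have := hit u _ Fu; lra.
have [lk [k [gk k0 kl kF]]] := tree_graded_piece_geodesic tg Di Fl Fl'.
have {}kF t : 0 <= t <= lk -> F i (k t).
  by move=> tl; apply: kF; exists t; rewrite //= in_itv.
have gu1 : geodesic (l - u) (fun s => g (u + s)) by apply: (geodesic_part gg); lra.
have hu1 : geodesic (l' - u) (fun s => h0 (u + (l' - u - s))).
  by apply: (@geodesic_rev _ _ _ (fun s => h0 (u + s))); apply: (geodesic_part h'h); lra.
have [||||s t sl tl|s t sl tl|s t sl tl|j Dj [j1 j2]] :=
  tree_graded_triangle gu1 gk hu1.
- by rewrite addrC subrK k0.
- by rewrite subr0 addrC subrK kl.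
- by rewrite subrr !addr0 gu.
- by lra.
- move=> gk'; have Fs : F i (g (u + s)) by rewrite gk'; apply: kF; lra.
  have := hit _ _ Fs; have sE : u + s = l -> t = 0.
    by move=> sE; apply: (geodesic_inj gk); rewrite -?gk' ?sE ?k0//; have := geodesic_ge0 gk; lra.
  by move=> H; apply: sE; have lus : 0 <= u + s <= l; [|have := H lus]; clear - tg sl um; lra.
- move=> kh; have Fs : F i (h0 (u + (l' - u - t))) by rewrite -kh; exact: kF.
  have := hit' _ _ Fs; lra.
(* Both geodesics start at [g 0], so a common point has the same parameter on both. *)
- move=> gh; have sE : u + s = u + (l' - u - t).
    have e1 : mdist (g 0) (g (u + s)) = u + s.
      by rewrite (geodesic_mdist gg); clear - tg sl um; lra.
    by rewrite -e1 gh -h00 (geodesic_mdist h'h); clear - tg tl um; lra.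
  have : u + s <= u; last lra.
  apply: umax; last by rewrite gh -sE.
  by apply/andP; split; [|apply: mP]; clear - tg sl tl um sE; lra.
have ij : i = j.
  apply: contrapT => ij; apply: nel; apply: (tree_graded_T1 tg Di Dj ij).
    split=> //; have := j1 (l - u); rewrite (addrC u) subrK; apply; lra.
  by split=> //; rewrite -kl; apply: j2; have := geodesic_ge0 gk; lra.
have : F i (g u) by rewrite ij; have := j1 0; rewrite addr0; apply; lra.
by move=> /hit; lra.
Qed.

Lemma tree_graded_gate_first_hit i l g t0 : D i -> geodesic l g ->
  0 <= t0 <= l -> F i (g t0) ->
  (forall t, 0 <= t <= l -> F i (g t) -> t0 <= t) -> gate (F i) (g 0) (g t0).
Proof.
move=> Di gg t0l Ft0 hit.
have g0g : geodesic t0 g.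
  have := @geodesic_part _ _ l g 0 t0 gg.
  rewrite subr0 (_ : (fun s => g (0 + s)) = g); first by apply; lra.
  by apply/funext => s; rewrite add0r.
by apply: tree_graded_first_hit => // t tl; apply: hit; lra.
Qed.

Lemma tree_graded_gate i x : D i -> F i !=set0 -> exists e, gate (F i) x e.
Proof.
move=> Di [p Fp].
have [l [g [gg gx gp _]]] := tree_graded_geodesic tg (Logic.I : setT x) (Logic.I : setT p).
have l0 := geodesic_ge0 gg.
have [||t [tl Ft tmin]] := first_hit (t1 := l) (tree_graded_piece_closed tg Di) gg.
- by lra.
- by rewrite gp.
by exists (g t); rewrite -gx; apply: (tree_graded_gate_first_hit Di gg).
Qed.

(** If [e] and [e'] differed, take h from [g 0] to [e'] and z from [e'] to [g l]. Points of h off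
    the piece have gate [e] and points of z have gate [e'], so h and z meet only at [e']. Trimmed
    along g they give a simple triangle. Its piece contains [e] and [e'], hence is [F i] by (T1);
    but the vertex [h u] is on g, which misses [F i]. *)
Lemma tree_graded_miss i l g e e' : D i -> F i !=set0 -> geodesic l g ->
  gate (F i) (g 0) e -> gate (F i) (g l) e' ->
  (forall t, 0 <= t <= l -> ~ F i (g t)) -> e = e'.
Proof.
move=> Di F0 gg ge ge' miss; apply: contrapT => ee'.
have l0 := geodesic_ge0 gg; have Fc := tree_graded_piece_closed tg Di.
have Fg x := tree_graded_gate x Di F0.
have [n [h [gh h0 hn _]]] := tree_graded_geodesic tg (Logic.I : setT (g 0)) (Logic.I : setT e').
have [k [z [gz z0 zk _]]] := tree_graded_geodesic tg (Logic.I : setT e') (Logic.I : setT (g l)).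
have n0 := geodesic_ge0 gh; have k0 := geodesic_ge0 gz.
have [||te [ten Fte temin]] := first_hit (t1 := n) Fc gh.
- by lra.
- by rewrite hn; exact: ge'.1.
(* The first hit of a geodesic from [g 0] is the gate of [g 0], so h passes through [e] on its way
   to [e']. *)
have hte : h te = e.
  apply: gate_unique ge; rewrite -h0.
  exact: (tree_graded_gate_first_hit Di gh).
have ten' : te < n.
  rewrite ltNge; apply/negP => nte; apply: ee'.
  by rewrite -hte -hn; congr (h _); lra.
have [m [ml mn m0 mP]] : exists m, [/\ m <= l, m <= n, 0 <= m &
    forall t, t <= l -> t <= n -> t <= m].
  by exists (Num.min l n); split=> [||| t]; case: (leP l n); clear - tg l0 n0; lra.
have [u [um gu umax]] := last_common gg gh (esym h0) m0 ml mn.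
have nFu : ~ F i (h u) by rewrite -gu; apply: miss; lra.
have ute : u < te.
  rewrite ltNge; apply/negP => teu; apply: nFu.
  by apply: (gated_convex Fg gh (a := te) (b := n)) => //; rewrite ?hn; [lra|lra|exact: ge'.1].
have gate_h t : 0 <= t <= n -> ~ F i (h t) -> gate (F i) (h t) e.
  move=> tn nF; have tte : t < te.
    rewrite ltNge; apply/negP => tet; apply: nF.
    by apply: (gated_convex Fg gh (a := te) (b := n)) => //; rewrite ?hn; [lra|lra|exact: ge'.1].
  apply: gate_between ge _.
  by rewrite -h0 -hte !(geodesic_mdist gh); clear - tg tn tte ten; lra.
have gate_z t : 0 <= t <= k -> gate (F i) (z t) e'.
  move=> tk; apply: gate_between ge' _.
  rewrite -zk -z0 (metric_sym (z k)) (metric_sym (z t) (z 0)) (metric_sym (z k)).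
  by rewrite !(geodesic_mdist gz); clear - tg tk; lra.
have hz s t : 0 <= s <= n -> 0 <= t <= k -> h s = z t -> F i (h s).
  move=> sn tk hzE; apply: contrapT => nF; apply: ee'.
  by apply: gate_unique (gate_h s _ nF) _; rewrite // hzE; exact: gate_z.
have zF t : 0 <= t <= k -> F i (z t) -> t = 0.
  move=> tk Ft; have := gate_of_mem Ft (gate_z _ tk); rewrite -z0 => /esym.
  by apply: (geodesic_inj gz); clear - tg tk; lra.
(* z and g end at the same point, so a common point is equally far from the end on both. This
   explains the parameter [l - (k - t)] below; w is the first such meeting along z. *)
have zg s t : 0 <= s <= l -> 0 <= t <= k -> z t = g s -> l - s = k - t.
  move=> sl tk zgE; have : mdist (z t) (z k) = mdist (g s) (g l) by rewrite zgE zk.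
  by rewrite (geodesic_mdist gz) ?(geodesic_mdist gg); clear - tg sl tk; lra.
have [||t tk H|w [wk wl wg] wmin] := @closed_min R
  [set t | [/\ 0 <= t <= k, 0 <= l - (k - t) <= l & z t = g (l - (k - t))]] 0 k.
- by exists k; rewrite /= subrr subr0 zk; split => //; clear - tg l0 k0; lra.
- by move=> t [].
- have lt : 0 <= l - (k - t) <= l.
    apply/andP; split; last by clear - tg tk; lra.
    apply/ler_addgt0Pr => e1 e10; have [s [sk sl sg] st] := H _ e10.
    by rewrite ltr_norml in st; clear - tg sl st; lra.
  split=> //; apply: mdist_small => e1 e10; have e20 : 0 < e1 / 2 by clear - tg e10; lra.
  have [s [sk sl sg] st] := H _ e20.
  apply: (le_trans (metric_triangle _ (z s) _)); rewrite {2}sg.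
  rewrite (geodesic_gap gz) ?(geodesic_gap gg)//.
  rewrite distrC; have -> : l - (k - s) - (l - (k - t)) = s - t by ring.
  by clear - tg st; lra.
have w0 : 0 < w.
  rewrite lt_neqAle; apply/andP; split; last by clear - tg wk; lra.
  apply/eqP => w0; apply: (miss _ wl); rewrite -wg -w0 z0; exact: ge'.1.
(* The third side runs along g from the meeting with z to the last common point with h, whichever of
   the two comes first on g. *)
have [v [gv v0 vE vP]] := geodesic_sub gg wl (t := u)
  ltac:(clear - tg um ml; lra).
set q := l - (k - w) in wl wg gv v0 vE vP.
have gh1 : geodesic (n - u) (fun s => h (u + s)) 
  by apply: (geodesic_part gh); clear - tg um mn; lra.
have gz1 : geodesic w z.
  have := @geodesic_part _ _ k z 0 w gz.
  rewrite subr0 (_ : (fun s => z (0 + s)) = z).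
    by apply; clear - tg w0 wk; lra.
  by apply/funext => s; rewrite add0r.
have [||||s t sl tl|s t sl tl|s t sl tl|j Dj [j1 j2]] :=
  tree_graded_triangle gh1 gz1 gv.
- by rewrite addrC subrK hn z0.
- by rewrite wg v0.
- by rewrite vE addr0.
- by clear - tg um mn ute ten'; lra.
- have tk : 0 <= t <= k by clear - tg tl wk; lra.
  move=> hzE; apply: zF => //; rewrite -hzE; apply: (hz _ t) => //.
  by clear - tg sl um; lra.
- have [x [xl xuq vx]] := vP _ tl; rewrite vx => zgE.
  have [sw xq] : s = w /\ x = q.
    have sk : 0 <= s <= k by clear - tg sl wk; lra.
    have e1 := zg x s xl sk zgE.
    have xE : l - (k - s) = x by clear - tg e1; lra.
    have e2 : w <= s by apply: wmin; split; rewrite ?xE.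
    by rewrite /q; split; clear - tg e1 e2 sl; lra.
  by apply: (geodesic_inj gv) => //; [rewrite lexx normr_ge0|rewrite vx xq v0].
- have [x [xl xuq vx]] := vP _ tl; rewrite vx => hg.
  have xE : u + s = x.
    case/andP: xl => x0 xl; have := geodesic_mdist gg (lexx 0) x0 xl.
    by rewrite -hg -h0 (geodesic_mdist gh); clear - tg sl um; lra.
  have xu : x <= u.
    apply: umax; last by rewrite -hg xE.
    by apply/andP; split; [|apply: mP]; clear - tg xl xE sl; lra.
  apply: (geodesic_inj gv) => //; first by rewrite lexx normr_ge0.
  by rewrite vx vE; congr (g _); clear - tg xE xu sl; lra.
have ij : i = j.
  apply: contrapT => ij; apply: ee'; apply: (tree_graded_T1 tg Di Dj ij).
    split; first exact: ge.1.
    rewrite -hte; have := j1 (te - u); rewrite (addrC u) subrK; apply.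
    by clear - tg ute ten; lra.
  by split; [exact: ge'.1|rewrite -z0; apply: j2; clear - tg w0; lra].
by apply: nFu; rewrite ij; have := j1 0; rewrite addr0; apply; clear - tg um mn; lra.
Qed.

Lemma tree_graded_gated i : D i -> F i !=set0 -> gated (F i).
Proof.
move=> Di F0; split=> [x|l g e e' gg ge ge' ee']; first exact: tree_graded_gate.
have [[t1 t1l Ft1]|miss] := pselect (exists2 t, 0 <= t <= l & F i (g t)).
  have [t [tl Ft tmin]] := first_hit (tree_graded_piece_closed tg Di) gg t1l Ft1.
  exists t; first lra.
  apply: gate_unique ge.
  by apply: (tree_graded_gate_first_hit Di gg) => //; lra.
exfalso; apply: ee'; apply: (tree_graded_miss Di F0 gg ge ge') => t tl Ft.
by apply: miss; exists t.
Qed.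

End TreeGraded.

(** * Separation by a point of a transverse segment *)

Section Separation.
Context {R : realType} {Y : metricType R} {J : Type} {D : set J} {F : J -> set Y}.
Hypothesis tg : tree_graded D F.

(** Only (T1) for the new index [None] is at stake: transversality excludes two points shared with
    an old piece. The gain is that the segment becomes gated by [tree_graded_gated]. *)
Lemma tree_graded_add_segment l t1 t2 g : geodesic l g ->
  0 <= t1 -> t1 <= t2 -> t2 <= l ->
  (forall i s t, D i -> t1 <= s -> s < t -> t <= t2 ->
    F i (g s) -> F i (g t) -> False) ->
  tree_graded [set o | if o is Some i then D i else True]
    (fun o => if o is Some i then F i else [set g s | s in [set s | t1 <= s <= t2]]).
Proof.
move=> gg h1 h12 h2 transverse; set G := [set g s | s in _].
split.
- exact: tree_graded_complete tg.
- exact: tree_graded_geodesic tg.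
- move=> [i|] /= Di; first exact (tree_graded_piece_closed tg Di).
  clear Di.
  apply/closed_mdist => x H.
  have [e e0|t tt ->] := geodesic_adherent gg h1 h12 h2 (x := x); last by exists t.
    by have [_ [t tt <-] xt] := H _ e0; exists t.
- move=> [i|] Di; first exact (tree_graded_piece_geodesic tg Di).
  clear Di.
  move=> _ _ [s /= sb <-] [t /= tb <-].
  have [v [gv v0 vE vP]] := geodesic_sub gg (s := s) (t := t) ltac:(lra) ltac:(lra).
  exists `|t - s|, v; split=> // _ [w wl <-].
  have [x [_ xb ->]] : exists x, [/\ 0 <= x <= l, Num.min s t <= x <= Num.max s t & v w = g x].
    by apply: vP; move: wl; rewrite /= in_itv.
  by exists x => //=; move: xb; case: (leP s t); lra.
- have aux i x y : D i -> (F i `&` G) x -> (F i `&` G) y -> x = y.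
    move=> Di [Fx [s /= sb gs]] [Fy [t /= tb gt]]; subst x y.
    have [//|st|ts] : [\/ g s = g t, s < t | t < s].
      by have [st|ts|->] := ltgtP s t; [apply: Or32|apply: Or33|apply: Or31].
    + by exfalso; apply: (transverse i s t Di) => //; lra.
    + by exfalso; apply: (transverse i t s Di) => //; lra.
  move=> [i|] [j|] //= Di Dj ij.
  + by apply: (tree_graded_T1 tg Di Dj) => ij'; apply: ij; rewrite ij'.
  + by move=> x y; exact: aux.
  + by move=> x y; rewrite setIC; exact: aux.
- by move=> T /(tree_graded_T2 tg)[i Di TF]; exists (Some i).
Qed.

(* Take the points whose gate in [g @` `[t1, t2]] comes before [g t0]. *)
Lemma tree_graded_separation l t1 t0 t2 g : geodesic l g ->
  0 <= t1 -> t1 < t0 -> t0 < t2 -> t2 <= l ->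
  (forall i s t, D i -> t1 <= s -> s < t -> t <= t2 ->
    F i (g s) -> F i (g t) -> False) ->
  exists L : set Y,
  [/\ forall t, 0 <= t < t0 -> L (g t), forall t, t0 < t <= l -> ~ L (g t) &
      forall n h, geodesic n h -> (forall t, 0 <= t <= n -> h t <> g t0) ->
        L (h 0) <-> L (h n)].
Proof.
move=> gg h1 h10 h02 h2 transverse; pose G := [set g s | s in [set s | t1 <= s <= t2]].
have h12 : t1 <= t2 by lra.
have gatedG : gated G.
  apply: (@tree_graded_gated _ _ _ _ _
    (tree_graded_add_segment gg h1 h12 h2 transverse) None) => //.
  by exists (g t1), t1 => //=; lra.
pose L := [set x | exists2 s, t1 <= s < t0 & gate G x (g s)].
have Lstep n h : geodesic n h -> (forall t, 0 <= t <= n -> h t <> g t0) ->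
    L (h 0) -> L (h n).
  move=> gh miss [s sb gs]; have [e ge] := gatedG.1 (h n).
  have [se|se] := pselect (g s = e); first by exists s; rewrite // se.
  have [v [w [v0 vw wn hv hw]]] := gated_geodesic gatedG gh erefl erefl gs ge se.
  have [t tb gt] := ge.1; exists t; rewrite ?gt// ltNge.
  rewrite (_ : (t1 <= t)); last by case/andP: tb.
  apply/negP => t0t.
  (* Between v and w the path h is a geodesic from [g s] to [g t], and by convexity it stays in the
     segment. Its point at distance [t0 - s] from [g s] can only be [g t0], which h avoids. *)
  pose x := v + (t0 - s).
  have wE : w - v = t - s.
    rewrite -(geodesic_mdist gh v0 (ltW vw) wn) hv hw -gt.
    by move: tb; rewrite /= => tb; rewrite (geodesic_mdist gg); clear - tg h1 h2 sb tb t0t; lra.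
  have xn : v <= x <= w by rewrite /x; lra.
  have [y yb gy] : G (h x).
    apply: (gated_convex gatedG.1 gh (a := v) (b := w)) => //; try by clear - tg xn v0 vw wn; lra.
    - by rewrite hv; exists s => //=; lra.
    - by rewrite hw; exact: ge.1.
  have d1 : mdist (h v) (h x) = x - v by rewrite (geodesic_mdist gh); clear - tg v0 xn wn; lra.
  have d2 : mdist (h x) (h w) = w - x by rewrite (geodesic_mdist gh); clear - tg v0 xn wn; lra.
  move: yb tb => /= yb tb.
  rewrite hv -gy (geodesic_gap gg) in d1; [|clear - tg h1 h2 sb yb h02; lra..].
  rewrite hw -gt -gy (geodesic_gap gg) in d2; [|clear - tg h1 h2 tb yb; lra..].
  apply: (miss x); first by clear - tg v0 xn wn; lra.
  rewrite -gy; congr (g _).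
  have : `|s - y| <= t0 - s by rewrite d1 /x; clear - tg; lra.
  have : `|y - t| <= t - t0 by rewrite d2 /x; clear - tg wE; lra.
  by rewrite !ler_norml; clear - tg; lra.
exists L; split.
- have Lt1 : L (g t1).
    by exists t1; [lra|apply: gate_id; exists t1 => //=; lra].
  move=> t tt0; have [v [gv v0 vE vP]] := geodesic_sub gg (s := t1) (t := t) ltac:(lra) ltac:(lra).
  rewrite -vE; apply: Lstep => [//|w wl|]; last by rewrite v0.
  have [x [xl xb ->]] := vP _ wl; move/(geodesic_inj gg).
  by move: xb; case: (leP t1 t); clear - tg h1 h10 h02 h2 tt0 xl; lra.
- have Lt2 : ~ L (g t2).
    have Gt2 : G (g t2) by exists t2 => //=; lra.
    by move=> [s sb /(gate_of_mem Gt2) /(geodesic_inj gg)]; lra.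
  move=> t tt0 Lt; apply: Lt2.
  have [v [gv v0 vE vP]] := geodesic_sub gg (s := t) (t := t2) ltac:(lra) ltac:(lra).
  rewrite -vE; apply: Lstep => [//|w wl|]; last by rewrite v0.
  have [x [xl xb ->]] := vP _ wl; move/(geodesic_inj gg).
  by move: xb; case: (leP t t2); clear - tg h1 h10 h02 h2 tt0 xl; lra.
- move=> n h gh miss; split; first exact: Lstep.
  move=> Lh; have := Lstep _ _ (geodesic_rev gh); rewrite subr0 subrr; apply => //.
  by move=> t tn; apply: miss; lra.
Qed.

End Separation.

(** * Ultrafilters and asymptotic cones *)

Section Ultrafilters.
Context {U : set_system nat} (UU : UltraFilter U).

Lemma ultra_or (P Q : nat -> Prop) :
  (\forall n \near U, P n \/ Q n) ->
  (\forall n \near U, P n) \/ (\forall n \near U, Q n).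
Proof.
move=> PQ; have [|UA] := in_ultra_setVsetC [set n | P n] UU; first by left.
by right; apply: filterS2 PQ UA => n [].
Qed.

Lemma ultra_not (P : nat -> Prop) :
  ~ (\forall n \near U, P n) -> \forall n \near U, ~ P n.
Proof.
by move=> nP; have [/nP//|UA] := in_ultra_setVsetC [set n | P n] UU.
Qed.

Lemma ultra_choice (T : Type) (f0 : nat -> T) (Q : nat -> T -> Prop) :
  (\forall n \near U, exists y, Q n y) ->
  exists f, \forall n \near U, Q n (f n).
Proof.
move=> H; have /choice[f fQ] n : exists y, (exists y, Q n y) -> Q n y.
  have [[y Qy]|nQ] := pselect (exists y, Q n y); first by exists y.
  by exists (f0 n).
by exists f; apply: filterS H => n; exact: fQ.
Qed.

Hypothesis nU : nonprincipal U.

Lemma ultra_setC1 m : \forall n \near U, n <> m.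
Proof.
apply: (@ultra_not (fun n => n = m)) => Um; case: (nU (t := m)).
apply/esym; apply: (@max_filter _ _ UU).
  exact: (@ultra_proper _ _ (principal_filter_ultra m)).
move=> A UA x /= ->.
by have [n [-> ]] := filter_ex (filterI Um UA).
Qed.

Lemma ultra_ge N : \forall n \near U, (N <= n)%N.
Proof.
elim: N => [|N IH]; first by apply: nearW => n.
by apply: filterS2 IH (ultra_setC1 N) => n; lia.
Qed.

Lemma ultra_oo (F : nat -> Prop) : (\forall n \near \oo, F n) -> \forall n \near U, F n.
Proof. by case=> N _ H; apply: filterS (ultra_ge N) => n; exact: H. Qed.

(** Diagonal choice: at n take a y for the largest K <= n such that the conditions up to K can be
    satisfied together. For fixed k, almost every n is at least k and admits the conditions up to k,
    so [f n] satisfies the k-th one. *)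
Lemma ultra_saturation (T : Type) (f0 : nat -> T) (Q : nat -> nat -> T -> Prop) :
  (forall K, \forall n \near U, exists y, forall k, (k <= K)%N -> Q k n y) ->
  exists f, forall k, \forall n \near U, Q k n (f n).
Proof.
move=> H.
have /choice[f fQ] n : exists y, forall K, (K <= n)%N ->
    (exists y, forall k, (k <= K)%N -> Q k n y) -> forall k, (k <= K)%N -> Q k n y.
  pose S K := `[< exists y, forall k, (k <= K)%N -> Q k n y >].
  have [|nS] := pselect (exists K, (K <= n)%N && S K); last first.
    exists (f0 n) => K Kn SK; exfalso; apply: nS; exists K.
    by rewrite Kn; apply/asboolP.
  move=> eS; have [K|K /andP[Kn /asboolP[y Qy]] maxK] := ex_maxnP eS (m := n).
    by case/andP.
  exists y => K' K'n SK' k kK'; apply: Qy; apply: (leq_trans kK').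
  by apply: maxK; rewrite K'n; apply/asboolP.
exists f => k; apply: filterS2 (ultra_ge k) (H k) => n kn Qn.
exact: (fQ n k kn Qn).
Qed.

End Ultrafilters.

(** * Points, distances and geodesics of a cone through visible sequences *)

Section Cone.
Context {R : realType} {X : metricType R}.
Context {U : set_system nat} (UU : UltraFilter U).
Context {p : nat -> X} {r : nat -> {posnum R}}.
Implicit Types (x y z : nat -> X) (P : nat -> set X).

Notation cone := (asymptotic_cone UU p r).
Notation rr n := (r n)%:num.

Definition visible x := admissible U p r x.

Lemma scale_gt0 n : 0 < rr n. Proof. by []. Qed.

Lemma visibleP x :
  visible x <-> exists M, \forall n \near U, mdist (p n) (x n) <= M * rr n.
Proof.
by split=> -[M H]; exists M; apply: filterS H => n;
  rewrite /scaled_dist ler_pdivrMr.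
Qed.

Lemma visible_base : visible p.
Proof. by apply/visibleP; exists 0; apply: nearW => n; rewrite mdistxx mul0r. Qed.

Lemma visible_near x y c : visible x ->
  (\forall n \near U, mdist (x n) (y n) <= c * rr n) -> visible y.
Proof.
move=> /visibleP[M H] xy; apply/visibleP; exists (M + c).
apply: filterS2 H xy => n h1 h2; have := metric_triangle (p n) (x n) (y n).
by lra.
Qed.

(** Total on sequences: one that is not visible is sent to the base point, so that no proof of
    admissibility has to be carried along. *)
Definition cone_pt x : cone := cone_pi UU
  (if pselect (visible x) is left vx then SigSub (mem_set vx)
   else SigSub (mem_set visible_base)).

Lemma cone_pt_surj (a : cone) : exists2 x, visible x & a = cone_pt x.
Proof.
have [xa xaE] : exists xa, a = cone_pi UU xa by exists (repr a); rewrite /cone_pi reprK.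
have vx : visible (seq_of xa) by exact: set_mem (valP xa).
exists (seq_of xa) => //; rewrite /cone_pt; case: pselect => // vx'.
by rewrite xaE; congr (cone_pi _ _); apply/val_inj.
Qed.

Lemma cone_pt_cvg x y : visible x -> visible y ->
  scaled_dist r x y @ U --> mdist (cone_pt x) (cone_pt y).
Proof.
move=> vx vy; rewrite /cone_pt; case: pselect => // vx'; case: pselect => // vy'.
set xa := SigSub _; set ya := SigSub _.
have -> : mdist (cone_pi UU xa) (cone_pi UU ya) = ultradist U r (seq_of xa) (seq_of ya).
  exact: cone_distE.
exact: (@ultradist_cvg _ _ _ UU p r xa ya).
Qed.

Lemma cone_lt x y c : visible x -> visible y ->
  mdist (cone_pt x) (cone_pt y) < c ->
  \forall n \near U, mdist (x n) (y n) < c * rr n.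
Proof.
move=> vx vy /(cvgr_lt _ (cone_pt_cvg vx vy)); apply: filterS => n.
by rewrite /scaled_dist ltr_pdivrMr.
Qed.

Lemma cone_gt x y c : visible x -> visible y ->
  c < mdist (cone_pt x) (cone_pt y) ->
  \forall n \near U, c * rr n < mdist (x n) (y n).
Proof.
move=> vx vy /(cvgr_gt _ (cone_pt_cvg vx vy)); apply: filterS => n.
by rewrite /scaled_dist ltr_pdivlMr.
Qed.

Lemma cone_le x y c : visible x -> visible y ->
  (\forall n \near U, mdist (x n) (y n) <= c * rr n) ->
  mdist (cone_pt x) (cone_pt y) <= c.
Proof.
move=> vx vy H; rewrite leNgt; apply/negP => /(cone_gt vx vy) H'.
by have [n [h1 h2]] := filter_ex (filterI H H'); lra.
Qed.

Lemma cone_ge x y c : visible x -> visible y ->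
  (\forall n \near U, c * rr n <= mdist (x n) (y n)) ->
  c <= mdist (cone_pt x) (cone_pt y).
Proof.
move=> vx vy H; rewrite leNgt; apply/negP => /(cone_lt vx vy) H'.
by have [n [h1 h2]] := filter_ex (filterI H H'); lra.
Qed.

Lemma cone_eq x y : visible x ->
  (forall e, 0 < e -> \forall n \near U, mdist (x n) (y n) <= e * rr n) ->
  visible y /\ cone_pt x = cone_pt y.
Proof.
move=> vx H; have vy : visible y by apply: (visible_near vx (H 1 _)).
by split=> //; apply: mdist_small => e e0; apply: cone_le => //; exact: H.
Qed.

Lemma cone_eq_ae x y : visible x -> (\forall n \near U, x n = y n) ->
  visible y /\ cone_pt x = cone_pt y.
Proof.
move=> vx H; apply: cone_eq => // e e0; apply: filterS H => n ->.
by rewrite mdistxx mulr_ge0// ltW.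
Qed.

Lemma ultralimit_pt P x : visible x -> (\forall n \near U, P n (x n)) ->
  ultralimit UU p r P (cone_pt x).
Proof.
move=> vx H; rewrite /cone_pt; case: pselect => // vx'.
by eexists; [reflexivity|].
Qed.

Lemma ultralimitP P a : ultralimit UU p r P a ->
  exists x, [/\ visible x, a = cone_pt x & \forall n \near U, P n (x n)].
Proof.
move=> [xa <- H]; have vx : visible (seq_of xa) by exact: set_mem (valP xa).
exists (seq_of xa); split=> //; rewrite /cone_pt; case: pselect => // vx'.
by congr (cone_pi _ _); apply/val_inj.
Qed.

Lemma ultralimit_near P x e : visible x -> ultralimit UU p r P (cone_pt x) ->
  0 < e -> \forall n \near U, exists2 q, P n q & mdist (x n) q <= e * rr n.
Proof.
move=> vx /ultralimitP[y [vy xy Py]] e0.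
have : mdist (cone_pt x) (cone_pt y) < e by rewrite xy mdistxx.
by move=> /(cone_lt vx vy); apply: filterS2 Py => n Py xyn; exists (y n) => //; lra.
Qed.

Hypothesis scale_oo : forall M : R, \forall n \near U, M <= rr n.

Lemma scale_small (c e : R) : 0 < e -> \forall n \near U, c <= e * rr n.
Proof.
move=> e0; apply: filterS (scale_oo (c / e)) => n.
by rewrite ler_pdivrMr// mulrC.
Qed.

Lemma cone_eq_bounded x y c : visible x ->
  (\forall n \near U, mdist (x n) (y n) <= c) ->
  visible y /\ cone_pt x = cone_pt y.
Proof.
move=> vx H; apply: cone_eq => // e e0.
by apply: filterS2 H (scale_small c e0) => n; exact: le_trans.
Qed.

Lemma ultralimit_bounded P x c : visible x ->
  (\forall n \near U, exists2 q, P n q & mdist (x n) q <= c) ->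
  ultralimit UU p r P (cone_pt x).
Proof.
move=> vx H; have [y Hy] : exists y, \forall n \near U, P n (y n) /\ mdist (x n) (y n) <= c.
  apply: (@ultra_choice _ UU _ p (fun n q => P n q /\ mdist (x n) q <= c)). by apply: filterS H => n [q]; exists q.
have [|vy ->] := @cone_eq_bounded x y c vx.
  by apply: filterS Hy => n [].
by apply: ultralimit_pt => //; apply: filterS Hy => n [].
Qed.

Lemma cone_le_add x1 y1 x2 y2 x3 y3 c :
  visible x1 -> visible y1 -> visible x2 -> visible y2 -> visible x3 -> visible y3 ->
  (\forall n \near U, mdist (x1 n) (y1 n) + mdist (x2 n) (y2 n) <=
                      mdist (x3 n) (y3 n) + c) ->
  mdist (cone_pt x1) (cone_pt y1) + mdist (cone_pt x2) (cone_pt y2) <=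
  mdist (cone_pt x3) (cone_pt y3).
Proof.
move=> v1 w1 v2 w2 v3 w3 H; rewrite leNgt; apply/negP => lt.
set D1 := mdist (cone_pt x1) _ in lt; set D2 := mdist (cone_pt x2) _ in lt.
(* The three distances and the constant c account for four errors e, less than the gap of 5 e. *)
set D3 := mdist (cone_pt x3) _ in lt; pose e := (D1 + D2 - D3) / 5.
have e0 : 0 < e by rewrite /e; lra.
have H1 : D1 - e < D1 by lra. have H2 : D2 - e < D2 by lra.
have H3 : D3 < D3 + e by lra.
have [n [h [h1 [h2 [h3 h4]]]]] := filter_ex (filterI H (filterI
  (cone_gt v1 w1 H1) (filterI (cone_gt v2 w2 H2) (filterI (cone_lt v3 w3 H3)
  (scale_small c e0))))).
have : e * rr n > 0 by rewrite mulr_gt0.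
have : (D1 + D2 - D3 - 5 * e) * rr n = 0 by rewrite /e mulrC; field.
by lra.
Qed.

(* Not every geodesic of the cone is of this form. *)
Lemma limit_geodesic (l : nat -> R) (g : nat -> R -> X) :
  (\forall n \near U, geodesic (l n) (g n)) ->
  visible (fun n => g n 0) -> visible (fun n => g n (l n)) ->
  let x := cone_pt (fun n => g n 0) in let y := cone_pt (fun n => g n (l n)) in
  exists G : R -> cone, [/\ geodesic (mdist x y) G, G 0 = x, G (mdist x y) = y &
    forall t, 0 <= t <= mdist x y ->
      visible (fun n => g n (Num.min (t * rr n) (l n))) /\
      G t = cone_pt (fun n => g n (Num.min (t * rr n) (l n)))].
Proof.
move=> gg v0 v1 x y; set L := mdist x y.
(* The parameter is capped because [l n] is only asymptotically L times the scale and may fall short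
   of [t * rr n]. *)
pose s t n := g n (Num.min (t * rr n) (l n)).
have L0 : 0 <= L by exact: mdist_ge0.
have ln : forall e, 0 < e -> \forall n \near U, (L - e) * rr n <= l n <= (L + e) * rr n.
  move=> e e0; have h1 : L < L + e by lra. have h2 : L - e < L by lra.
  apply: filterS2 gg (filterI (cone_lt v0 v1 h1) (cone_gt v0 v1 h2)) => n gn [].
  by rewrite (geodesic_length gn) => *; apply/andP; split; apply/ltW.
have smono t u n : geodesic (l n) (g n) -> 0 <= t -> t <= u ->
    mdist (s t n) (s u n) = Num.min (u * rr n) (l n) - Num.min (t * rr n) (l n).
  move=> gn t0 tu; have l0 := geodesic_ge0 gn; have rn := scale_gt0 n.
  have tr : 0 <= t * rr n by rewrite mulr_ge0// ltW.
  have ur : t * rr n <= u * rr n by rewrite ler_pM2r.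
  rewrite (geodesic_mdist gn) //.
  - by case: (leP (t * rr n) (l n)); clear - UU v0 tr l0; lra.
  - by case: (leP (t * rr n) (l n)); case: (leP (u * rr n) (l n)); clear - UU v0 ur; lra.
  - by case: (leP (u * rr n) (l n)); clear - UU v0; lra.
have s0 n : geodesic (l n) (g n) -> s 0 n = g n 0.
  by move=> /geodesic_ge0 l0; rewrite /s mul0r min_l.
have vs t : 0 <= t -> visible (s t).
  move=> t0; apply: (visible_near v0 (c := t)); apply: filterS gg => n gn.
  rewrite -(s0 _ gn) smono// mul0r; have := geodesic_ge0 gn.
  by case: (leP (t * rr n) (l n)); case: (leP 0 (l n)); clear - UU v0; lra.
have sL : cone_pt (s L) = y.
  have [|//] := @cone_eq (s L) (fun n => g n (l n)) (vs _ L0).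
  move=> e e0; apply: filterS2 gg (ln e e0) => n gn lnE.
  have l0 := geodesic_ge0 gn; have rn := scale_gt0 n.
  have tr : 0 <= L * rr n by rewrite mulr_ge0// ltW.
  have er : 0 < e * rr n by rewrite mulr_gt0.
  by rewrite /s (geodesic_mdist gn); case: (leP (L * rr n) (l n)); clear - UU v0 lnE tr er l0; lra.
exists (fun t => cone_pt (s t)); split=> //.
- suff H t u : 0 <= t -> t <= u -> u <= L ->
      mdist (cone_pt (s t)) (cone_pt (s u)) = u - t.
    split=> // t u; rewrite !in_itv/= => tL uL.
    have [tu|ut] := leP t u.
      by rewrite H; [rewrite distrC ger0_norm//|..]; clear - UU v0 tL uL tu; lra.
    by rewrite metric_sym H; [rewrite ger0_norm//|..]; clear - UU v0 tL uL ut; lra.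
  move=> t0 tu uL; apply/eqP; rewrite eq_le; apply/andP; split.
    apply: cone_le; [exact: vs|apply: vs; lra|].
    apply: filterS gg => n gn; rewrite smono//; have rn := scale_gt0 n.
    have ur : t * rr n <= u * rr n by rewrite ler_pM2r.
    by case: (leP (t * rr n) (l n)); case: (leP (u * rr n) (l n)); clear - UU v0 ur; lra.
  apply/ler_addgt0Pr => e e0; rewrite -lerBlDr.
  apply: cone_ge; [exact: vs|apply: vs; lra|].
  apply: filterS2 gg (ln e e0) => n gn lnE; rewrite smono//; have rn := scale_gt0 n.
  have ur : t * rr n <= u * rr n by rewrite ler_pM2r.
  have Lr : u * rr n <= L * rr n by rewrite ler_pM2r.
  have er : 0 < e * rr n by rewrite mulr_gt0.
  case: (leP (t * rr n) (l n)); case: (leP (u * rr n) (l n)).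
  - by clear - UU v0 er; lra.
  - by clear - UU v0 lnE ur Lr er; lra.
  - by clear - UU v0 ur; lra.
  - by clear - UU v0 lnE ur Lr er; lra.
- have [|_ //] := @cone_eq_ae (s 0) (fun n => g n 0) (vs _ (lexx _)).
  by apply: filterS gg => n; exact: s0.
- by move=> t /andP[t0 _]; split; [exact: vs|].
Qed.

End Cone.

(** * A local criterion for gated sets, and simple triangles that meet them *)

Section MoreGates.
Context {R : realType} {Y : metricType R}.
Implicit Types (A : set Y) (x y e : Y) (l : R) (g : R -> Y).

(** Follow the geodesic as long as its points have gate e, up to a supremum T. If [g T] were off A,
    local constancy would carry the gate e past T or up to the end; so [g T] is in A and, as a limit
    of points with gate e, equals e. The local hypothesis is the form that (AP2) takes in a cone. *)
Lemma gated_of_locally_constant A : (forall x, exists e, gate A x e) ->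
  (forall x y e, gate A x e -> mdist x y < mdist x e -> gate A y e) -> gated A.
Proof.
move=> gA loc; split=> // l g e e' gg ge ge' ee'.
have l0 := geodesic_ge0 gg.
pose S := [set t | 0 <= t <= l /\ forall s, 0 <= s <= t -> gate A (g s) e].
have S0 : S 0.
  by split=> [|s s0]; [lra|have -> : s = 0 by lra].
have supS : has_sup S by split; [exists 0|exists l => t [] /andP[]].
set T := sup S.
have T0 : 0 <= T by exact: sup_upper_bound.
have Tl : T <= l by apply: ge_sup => [|t [/andP[]]//]; exists 0.
have adh d : 0 < d -> exists2 s, S s & T - d < s <= T.
  move=> d0; have [s Ss sT] := sup_adherent d0 supS; exists s => //.
  by rewrite sT /=; exact: sup_upper_bound.
have [f gf] := gA (g T).
have [d0|d0] := leP (mdist (g T) f) 0.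
  have AT : A (g T) by rewrite (mdist0 d0); exact: gf.1.
  exists T; first lra.
  apply: mdist_small => d dpos; have [s [sl Ss] sT] := adh _ dpos.
  have s0 : 0 <= s <= s by lra.
  have := (Ss _ s0).2 _ AT; rewrite (geodesic_mdist gg) ?(metric_sym e); [|lra..].
  by have := mdist_ge0 (g s) e; lra.
have ef : e = f.
  have [s [sl Ss] sT] := adh _ d0; have s0 : 0 <= s <= s by lra.
  apply: gate_unique (Ss _ s0) _; apply: loc gf _.
  by rewrite (geodesic_gap gg) ?ger0_norm; lra.
subst f.
have near_T t : 0 <= t <= l -> `|T - t| < mdist (g T) e -> gate A (g t) e.
  by move=> tl tT; apply: loc gf _; rewrite (geodesic_gap gg); lra.
have [t [tl tT tt]] : exists t, [/\ T <= t <= l, `|T - t| < mdist (g T) e &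
    T < t \/ t = l].
  have [h|h] := leP l (T + mdist (g T) e / 2).
    exists l; split; [lra| |by right].
    by rewrite ler0_norm; lra.
  exists (T + mdist (g T) e / 2); split; [lra| |by left; lra].
  by rewrite ler0_norm; lra.
have St : S t.
  split=> [|s st]; first lra.
  have [sT|sT] := ltP s T.
    have Ts : 0 < T - s by lra.
    have [u [ul Su] uT] := adh _ Ts.
    by apply: Su; lra.
  apply: near_T; first lra.
  by move: tT; rewrite !ler0_norm; lra.
exfalso; have tT' : t <= T by exact: sup_upper_bound.
apply: ee'; apply: gate_unique ge'.
by have [|tE] := tt; [lra|apply: St.2; lra].
Qed.

(* The gates of the vertices lie on two sides each, hence are vertices. *)
Lemma simple_triangle_in_gated A (T : geodesic_triangle Y) (k : 'I_3) s t :
  gated A -> simple_triangle T -> 0 <= s -> s < t -> t <= side_length T k ->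
  A (side_path T k s) -> A (side_path T k t) -> \bigcup_j side T j `<=` A.
Proof.
move=> gA sT s0 st tl As At; have gg i := side_geodesic T i.
pose v i := side_path T i 0.
have vl i : side_path T i (side_length T i) = v (ordS i) by exact: side_adjacent.
have l0 i : 0 <= side_length T i by exact: geodesic_ge0 (gg i).
have /choice[G GP] i := gA.1 (v i).
have GA i : A (v i) -> G i = v i by move=> Avi; exact: gate_of_mem Avi (GP i).
suff vA : forall i, A (v i).
  move=> _ [i _ [w /= wl <-]]; rewrite in_itv/= in wl.
  apply: (gated_convex gA.1 (gg i) (a := 0) (b := side_length T i)) => //; try lra.
  - exact: vA.
  - by rewrite vl; exact: vA.
have on_side i : G i <> G (ordS i) -> exists a b, [/\ 0 <= a, a < b,
    b <= side_length T i, side_path T i a = G i & side_path T i b = G (ordS i)].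
  by move=> ne; exact: (gated_geodesic gA (gg i) erefl (vl i) (GP _) (GP _) ne).
(* A gate different from both neighbouring ones lies on the two sides at its vertex. These meet only
   at the vertex, apart from the bigon, where the strict order of the gates on a side rules this
   out. *)
have lone j : G (ordS j) <> G j -> G (ordS j) <> G (ordS (ordS j)) -> A (v (ordS j)).
  move=> /nesym/on_side[a [b [a0 ab bl ga gb]]] /on_side[c [d [c0 cd dl gc gd]]].
  have [|||[bE cE]|[l20 [b0 _]]] := simple_triangle_meet (i := j) (s := b) (t := c) sT.
  - by lra.
  - by lra.
  - by rewrite gb gc.
  - by rewrite -vl -bE gb; exact: (GP _).1.
  - lra.
(* Both sides at the vertex [ordS i] pass through the common gate of the other two vertices, before
   resp. after the gate of [ordS i]. This is possible only in a bigon, whose double vertex is that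
   gate. *)
have two i : G (ordS i) <> G i -> G (ordS (ordS i)) = G i -> forall j, A (v j).
  move=> ne eq; have Av1 : A (v (ordS i)) by apply: lone; rewrite ?eq.
  have [a [b [a0 ab bl ga gb]]] := on_side i (nesym ne).
  have ne' : G (ordS i) <> G (ordS (ordS i)) by rewrite eq.
  have [c [d [c0 cd dl gc gd]]] := on_side _ ne'.
  have [|||[aE dE]|[l20 [aE _]]] := simple_triangle_meet (i := i) (s := a) (t := d) sT.
  - by lra.
  - by lra.
  - by rewrite ga gd.
  - lra.
  have Avi : A (v i) by rewrite /v -aE ga; exact: (GP _).1.
  move=> j; have [->//|->//|->] := I3_cases i j.
  have := vl (ordS (ordS i)); rewrite l20 ordS3.
  by rewrite -/(v (ordS (ordS i))) => ->.
(* If both ends of side k had the same gate, the gate inequalities would leave room for only one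
   point of A on this side. *)
have nek : G k <> G (ordS k).
  move=> eq; have := (GP k).2 _ As; have := (GP k).2 _ At.
  have := (GP (ordS k)).2 _ As; have := (GP (ordS k)).2 _ At.
  have := metric_triangle (v k) (G k) (v (ordS k)).
  rewrite (metric_sym (G k) (v (ordS k))) -!eq -vl /v.
  rewrite !(metric_sym (side_path T k (side_length T k)) (side_path T k _)).
  rewrite !(geodesic_mdist (gg k)); [|lra..].
  have := metric_triangle (side_path T k s) (G k) (side_path T k t).
  rewrite (metric_sym (side_path T k s) (G k)) !(geodesic_mdist (gg k)); [|lra..].
  lra.
have [e|n1] := pselect (G (ordS (ordS k)) = G k).
  by apply: (two k) => //; exact: nesym.
have [e|n2] := pselect (G (ordS (ordS k)) = G (ordS k)).
  apply: (two (ordS (ordS k))); rewrite ordS3 ?e//.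
move=> j; have [->|->|->] := I3_cases k j.
- by rewrite -(ordS3 k); apply: lone; rewrite ?ordS3 => //; exact: nesym.
- by apply: lone => //; exact: nesym.
- by apply: lone; rewrite ?ordS3.
Qed.

End MoreGates.

(** * Completeness and geodesics of asymptotic cones *)

Section DistanceToSet.
Context {R : realType} {X : metricType R}.
Implicit Types (A P : set X) (x y : X) (c : R).

Lemma diam_le A c :
  (diam A <= c%:E)%E <-> forall x y, A x -> A y -> mdist x y <= c.
Proof.
split=> [H x y Ax Ay|H].
  rewrite -lee_fin; apply: le_trans H; apply: ereal_sup_ubound.
  by exists x => //; exists y.
by apply: ge_ereal_sup => _ [x Ax [y Ay <-]]; rewrite lee_fin; exact: H.
Qed.

Lemma edist_inf_ge P x c :
  (c%:E <= edist_inf P x)%E <-> forall q, P q -> c <= mdist x q.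
Proof.
split=> [H q Pq|H].
  rewrite -lee_fin -edist_mdist; apply: (le_trans H).
  by apply: ereal_inf_lbound; exists q.
by apply: le_ereal_inf_tmp => _ [q Pq <-]; rewrite edist_mdist lee_fin; exact: H.
Qed.

(** A version of [neighborhood] with a witness in P. As the infimum need not be attained,
    [neighborhood] yields it only for larger radii. *)
Definition within_dist c P x := exists2 q, P q & mdist x q <= c.

Lemma within_dist_neighborhood c P x :
  within_dist c P x -> neighborhood c P x.
Proof.
move=> [q Pq xq]; apply: (@le_trans _ _ (edist (x, q))).
  by apply: ereal_inf_lbound; exists q.
by rewrite edist_mdist lee_fin.
Qed.

Lemma neighborhood_within_dist c c' P x : c < c' ->
  neighborhood c P x -> within_dist c' P x.
Proof.
move=> cc' H; apply: contrapT => nw.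
have : (c'%:E <= edist_inf P x)%E.
  apply/edist_inf_ge => q Pq; rewrite leNgt; apply/negP => xq.
  by apply: nw; exists q => //; exact: ltW.
by move/le_trans => /(_ _ H); rewrite lee_fin; lra.
Qed.

End DistanceToSet.

Section FromProjections.
Context {R : realType} {X : metricType R}.
Context {U : set_system nat} (UU : UltraFilter U).
Context {p : nat -> X} {r : nat -> {posnum R}}.
Implicit Types (x y z : nat -> X) (P Q : nat -> set X).

Notation cone := (asymptotic_cone UU p r).
Notation rr n := (r n)%:num.
Notation vis := (visible (U := U) (p := p) (r := r)).
Notation pt := (cone_pt UU (p := p) (r := r)).
Notation lim P := (ultralimit UU p r P).

Hypothesis nU : nonprincipal U.
Hypothesis scale_oo : forall M : R, \forall n \near U, M <= rr n.

(** Saturation produces the limit: finitely many of the conditions that y be within [e k] of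
    [x (N k)] are met by a single late term [x M], hence one sequence y meets all of them. *)
Lemma cone_complete (u : nat -> cone) :
  cauchy (u @ \oo) -> exists l : cone, u @ \oo --> l.
Proof.
move=> /cauchy_ballP cu.
have cu' (e : R) : 0 < e -> exists N, forall i j, (N <= i)%N -> (N <= j)%N ->
    mdist (u i) (u j) < e.
  move=> e0; have [[A B] [/= [a _ Aa] [b _ Bb]] AB] := cu _ e0.
  exists (maxn a b) => i j; rewrite !geq_max => /andP[ai bi] /andP[aj bj].
  have := AB (u i, u j) _; rewrite /= ballEmdist /=; apply.
  by split => /=; [exact: Aa|exact: Bb].
pose e k : R := k.+1%:R^-1.
have e0 k : 0 < e k by rewrite invr_gt0.
have /choice[N NP] k := cu' (e k) (e0 k).
have /choice[x xP] k : exists x, vis x /\ u k = pt x.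
  by have [x vx ux] := cone_pt_surj (u k); exists x.
have [|y yP] := @ultra_saturation _ UU nU _ p
  (fun k n (w : X) => mdist (x (N k) n) w <= e k * rr n).
  move=> K; pose M := \max_(k < K.+1) N k.
  have H : forall k, (k <= K)%N -> \forall n \near U, mdist (x (N k) n) (x M n) <= e k * rr n.
    move=> k kK; have kM : (N k <= M)%N by exact: (leq_bigmax (Ordinal (kK : (k < K.+1)%N))).
    have := NP k (N k) M (leqnn _) kM.
    rewrite (xP (N k)).2 (xP M).2 => /(cone_lt (xP (N k)).1 (xP M).1).
    by apply: filterS => n /ltW.
  suff HK : \forall n \near U, forall k, (k <= K)%N -> mdist (x (N k) n) (x M n) <= e k * rr n.
    by apply: filterS HK => n Hn; exists (x M n).
  move: M H; elim: K => [|K IH] M H.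
    by apply: filterS (H 0 (leqnn _)) => n Hn k; rewrite leqn0 => /eqP->.
  have HK : forall k, (k <= K)%N -> \forall n \near U, mdist (x (N k) n) (x M n) <= e k * rr n.
    by move=> k kK; apply: H; exact: leqW.
  apply: filterS2 (IH M HK) (H K.+1 (leqnn _)) => n h1 h2 k.
  by rewrite leq_eqVlt => /orP[/eqP->//|]; rewrite ltnS; exact: h1.
have vy : vis y by exact: visible_near (xP (N 0)).1 (yP 0).
exists (pt y); apply/metricType_numDomainType.cvgrPdist_lt => d d0.
have [k kd] : exists k, e k < d / 2.
  exists (Num.truncn (d / 2)^-1).+1; rewrite /e -[ltRHS]invrK ltf_pV2 ?posrE ?invr_gt0 ?divr_gt0//.
  apply: (lt_trans (truncnS_gt _)); by rewrite ltr_nat.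
exists (N k) => // j /= Nj.
have h1 : mdist (u (N k)) (pt y) <= e k.
  by rewrite (xP (N k)).2; apply: cone_le (yP k) => //; exact: (xP _).1.
have h2 := NP k (N k) j (leqnn _) Nj.
have := metric_triangle (pt y) (u (N k)) (u j).
by rewrite (metric_sym (pt y) (u (N k))); rewrite -/(e k) in h2; lra.
Qed.

Lemma ultralimit_closed P : closed (lim P).
Proof.
apply/closed_mdist => a; have [x vx ->] := cone_pt_surj a => H.
pose e k : R := k.+1%:R^-1.
have e0 k : 0 < e k by rewrite invr_gt0.
have He d : 0 < d -> \forall n \near U, exists2 q, P n q & mdist (x n) q <= d * rr n.
  move=> d0; have [_ /ultralimitP[y [vy -> yP]] xy] := H _ d0.
  apply: filterS2 yP (cone_lt vx vy xy) => n Py xyn.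
  by exists (y n) => //; exact: ltW.
have [K|y yP] := @ultra_saturation _ UU nU _ p
  (fun k n (w : X) => P n w /\ mdist (x n) w <= e k * rr n).
  apply: filterS (He _ (e0 K)) => n [w Pw xw]; exists w => k kK; split=> //.
  apply: (le_trans xw); rewrite ler_pM2r// /e lef_pV2 ?posrE// ler_nat ltnS.
  exact: kK.
have [|vy ->] := @cone_eq _ _ _ UU p r x y vx; last first.
  by apply: ultralimit_pt => //; apply: filterS (yP 0%N) => n [].
move=> d d0; have [k kd] : exists k, e k < d.
  exists (Num.truncn d^-1).+1; rewrite /e -[ltRHS]invrK ltf_pV2 ?posrE ?invr_gt0//.
  by apply: (lt_trans (truncnS_gt _)); rewrite ltr_nat.
apply: filterS (yP k) => n [_ /le_trans]; apply.
by rewrite ler_pM2r//; exact: ltW.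
Qed.

Hypothesis geoX : geodesic_space X.

Lemma geodesic_choice (x y : nat -> X) : exists l g, forall n,
  [/\ geodesic (l n) (g n), g n 0 = x n & g n (l n) = y n].
Proof.
have /choice[lg H] n : exists lg : R * (R -> X),
    [/\ geodesic lg.1 lg.2, lg.2 0 = x n & lg.2 lg.1 = y n].
  have [l [g [gg g0 gl _]]] := geoX (Logic.I : setT (x n)) (Logic.I : setT (y n)).
  by exists (l, g).
by exists (fun n => (lg n).1), (fun n => (lg n).2).
Qed.

Lemma cone_geodesic_space : geodesic_subset [set: cone].
Proof.
move=> a b _ _; have [x vx ->] := cone_pt_surj a.
have [y vy ->] := cone_pt_surj b.
have [l [g gP]] := geodesic_choice x y.
have xE : (fun n => g n 0) = x by apply/funext => n; case: (gP n).
have yE : (fun n => g n (l n)) = y by apply/funext => n; case: (gP n).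
have gg : \forall n \near U, geodesic (l n) (g n).
  by apply: nearW => n; case: (gP n).
have [] := limit_geodesic UU gg (p := p) (r := r); rewrite ?xE ?yE// => G [GG G0 GL _].
by exists (mdist (pt x) (pt y)), G.
Qed.

End FromProjections.

(** * From projections to tree-graded cones *)

Lemma min_bounds (R : realType) (a b d : R) : 0 <= a -> 0 <= b -> a - d <= b ->
  0 <= d -> [/\ 0 <= Num.min a b, Num.min a b <= b, Num.min a b <= a &
    a - d <= Num.min a b].
Proof. by case: (leP a b) => h *; split; lra. Qed.

Section ProjectionsInCone.
Context {R : realType} {X : metricType R} {PP : set (set X)}.
Context {U : set_system nat} (UU : UltraFilter U).
Context {p : nat -> X} {r : nat -> {posnum R}}.

Notation cone := (asymptotic_cone UU p r).
Notation rr n := (r n)%:num.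
Notation vis := (visible (U := U) (p := p) (r := r)).
Notation pt := (cone_pt UU (p := p) (r := r)).
Notation lim P := (ultralimit UU p r P).

Hypothesis scale_oo : forall M : R, \forall n \near U, M <= rr n.
Hypothesis geoX : geodesic_space X.

Context {prj : set X -> X -> X} {C : R}.
Hypothesis prjP : forall P, PP P -> forall x, P (prj P x).
Hypothesis ap1 : forall P, PP P -> forall x q, P q ->
  mdist x (prj P x) + mdist (prj P x) q <= mdist x q + C.
Hypothesis ap2 : forall P, PP P -> forall x y,
  (forall q, P q -> mdist x y <= mdist x q) -> mdist (prj P x) (prj P y) <= C.
Hypothesis ap3 : forall P Q, PP P -> PP Q -> Q <> P ->
  forall x y, Q x -> Q y -> mdist (prj P x) (prj P y) <= C.

Notation proj P x := (fun n => prj (P n) (x n)).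

(** The constant of (AP1) disappears in the cone. A point in the limit of P keeps the projections
    visible. *)
Lemma projection_gate (P : nat -> set X) (x : nat -> X) : (\forall n \near U, PP (P n)) -> lim P !=set0 ->
  vis x -> vis (proj P x) /\ gate (lim P) (pt x) (pt (proj P x)).
Proof.
move=> PPP [_ /ultralimitP[z [vz _ Pz]]] vx.
have vpi : vis (proj P x).
  pose c := mdist (pt x) (pt z) + 2.
  apply: (visible_near UU vx (c := c)).
  have h : mdist (pt x) (pt z) < mdist (pt x) (pt z) + 1 by lra.
  apply: filterS2 (filterI PPP Pz) (filterI (cone_lt vx vz h) (scale_oo C)).
  move=> n [PPn Pzn] [xz Cr]; have := ap1 PPn (x n) Pzn.
  by have := mdist_ge0 (prj (P n) (x n)) (z n); rewrite /c; lra.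
split=> //; split.
  by apply: ultralimit_pt => //; apply: filterS PPP => n PPn; exact: prjP.
move=> _ /ultralimitP[y [vy -> Py]]; apply: (cone_le_add (c := C) UU scale_oo) => //.
by apply: filterS2 PPP Py => n PPn Pyn; exact: ap1.
Qed.

Lemma ultralimit_gated (P : nat -> set X) : (\forall n \near U, PP (P n)) -> lim P !=set0 ->
  gated (lim P).
Proof.
move=> PPP P0; apply: gated_of_locally_constant => [a|a b e ga ab].
  have [x vx ->] := cone_pt_surj a.
  by exists (pt (proj P x)); exact: (projection_gate PPP P0 vx).2.
move: ga ab; have [x vx ->] := cone_pt_surj a; have [y vy ->] := cone_pt_surj b.
have [vpx gx] := projection_gate PPP P0 vx.
have [vpy gy] := projection_gate PPP P0 vy.
move=> /(gate_unique gx) <- xy; set D := mdist (pt x) (pt y) in xy.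
(* c separates d(x, y) from the distance of x to P with a margin d that absorbs C; hence [y n] lies
   in the ball to which (AP2) applies. *)
pose c := (D + mdist (pt x) (pt (proj P x))) / 2.
pose d := (mdist (pt x) (pt (proj P x)) - D) / 4.
have h1 : D < c by rewrite /c; lra.
have h2 : c + d < mdist (pt x) (pt (proj P x)) by rewrite /c /d; lra.
have d0 : 0 < d by rewrite /d; lra.
have [|_ ->] := @cone_eq_bounded _ _ _ UU p r scale_oo (proj P x) (proj P y) C vpx; last by [].
apply: filterS2 PPP (filterI (cone_lt vx vy h1) (filterI (cone_gt vx vpx h2)
  (scale_small UU scale_oo C d0))) => n PPn [xyn [xpn Cn]].
apply: ap2 => // q Pq; have := ap1 PPn (x n) Pq.
by have := mdist_ge0 (prj (P n) (x n)) q; lra.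
Qed.

Lemma ultralimit_T1 (P Q : nat -> set X) : (\forall n \near U, PP (P n)) ->
  (\forall n \near U, PP (Q n)) -> (\forall n \near U, P n <> Q n) ->
  is_subset1 (lim P `&` lim Q).
Proof.
move=> PPP PPQ PQ a b [Pa Qa] [Pb Qb].
have P0 : lim P !=set0 by exists a.
have [x [vx ax Qx]] := ultralimitP Qa; have [y [vy by_ Qy]] := ultralimitP Qb.
have [vpx gx] := projection_gate PPP P0 vx.
have [vpy gy] := projection_gate PPP P0 vy.
rewrite ax by_ in Pa Pb *; rewrite -(gate_of_mem Pa gx) -(gate_of_mem Pb gy).
have [|_ //] := @cone_eq_bounded _ _ _ UU p r scale_oo (proj P x) (proj P y) C vpx.
apply: filterS2 (filterI PPP PPQ) (filterI PQ (filterI Qx Qy)) => n [PPn PQn] [PnQ [Qxn Qyn]].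
by apply: (ap3 PPn PQn) => //; exact: nesym.
Qed.

(** A condition on points only: it constrains all geodesics of X between representatives, whichever
    geodesic of the cone joins a and b. *)
Definition same_gates (a b : cone) := forall P : nat -> set X, (\forall n \near U, PP (P n)) ->
  forall e, gate (lim P) a e -> gate (lim P) b e.

Lemma same_gates_sym a b : same_gates a b -> same_gates b a.
Proof.
move=> ab P PPP e ge; have [x vx aE] := cone_pt_surj a.
have P0 : lim P !=set0 by exists e; exact: ge.1.
have := (projection_gate PPP P0 vx).2; rewrite -aE => ga.
by have := ab _ PPP _ ga; move=> /(gate_unique ge) ->.
Qed.

Lemma same_gates_geodesic (l : R) (g : R -> cone) s t :
  geodesic l g -> 0 <= s <= l -> 0 <= t <= l ->
  (forall (P : nat -> set X) u v, (\forall n \near U, PP (P n)) -> 0 <= u -> u < v -> v <= l ->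
    lim P (g u) -> lim P (g v) -> False) -> same_gates (g s) (g t).
Proof.
move=> gg sl tl H P PPP e ge; have P0 : lim P !=set0 by exists e; exact: ge.1.
have gP := ultralimit_gated PPP P0; have [e' ge'] := gP.1 (g t).
suff -> : e = e' by [].
have [h [gh h0 hE hP]] := geodesic_sub gg sl tl.
apply: (gated_same gP gh h0 hE ge ge') => u v u0 uv vl hu hv.
have [a [al _ ha]] := hP u ltac:(lra); have [b [bl _ hb]] := hP v ltac:(lra).
have uE : mdist (h u) (h v) = `|a - b| by rewrite ha hb (geodesic_gap gg).
rewrite (geodesic_mdist gh) in uE; [|clear - UU scale_oo geoX ap1 ge u0 uv vl; lra..].
have [ab|ba|ab] := ltgtP a b.
- by apply: (H P a b) => //; rewrite -?ha -?hb//; lra.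
- by apply: (H P b a) => //; rewrite -?ha -?hb//; lra.
- by rewrite ab subrr normr0 in uE; lra.
Qed.

(** Points of the geodesics close to P converge to points of the limit of P lying between a and b.
    Adding the inequalities of the common gate of a and b shows that any such point is this gate, so
    two of them cannot stay e apart. *)
Lemma same_gates_transverse (a b : nat -> X) (c e : R) : vis a -> vis b -> 0 < e ->
  same_gates (pt a) (pt b) ->
  \forall n \near U, forall l g P s t, geodesic l g -> g 0 = a n -> g l = b n ->
    PP P -> 0 <= s <= l -> 0 <= t <= l -> within_dist c P (g s) ->
    within_dist c P (g t) -> mdist (g s) (g t) <= e * rr n.
Proof.
move=> va vb e0 ab; apply: contrapT => /(ultra_not UU) H.
have [f fP] : exists f : nat -> R * (R -> X) * set X * R * R, \forall n \near U,
    let: (l, g, P, s, t) := f n in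
    [/\ geodesic l g, g 0 = a n & g l = b n] /\ [/\ PP P, 0 <= s <= l, 0 <= t <= l,
    within_dist c P (g s) & within_dist c P (g t)] /\ e * rr n < mdist (g s) (g t).
  apply: (@ultra_choice _ UU _ (fun n => (0, fun=> p n, set0, 0, 0))
    (fun n (f : R * (R -> X) * set X * R * R) => let: (l, g, P, s, t) := f in
    [/\ geodesic l g, g 0 = a n & g l = b n] /\ [/\ PP P, 0 <= s <= l, 0 <= t <= l,
    within_dist c P (g s) & within_dist c P (g t)] /\ e * rr n < mdist (g s) (g t))).
  apply: filterS H => n H; apply: contrapT => nE; apply: H => l g P s t *.
  rewrite leNgt; apply/negP => lt; apply: nE.
  by exists (l, g, P, s, t).
pose g n := (f n).1.1.1.2; pose P n := (f n).1.1.2; pose s n := (f n).1.2.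
pose t n := (f n).2; pose l n := (f n).1.1.1.1.
have {}fP : \forall n \near U, [/\ geodesic (l n) (g n), g n 0 = a n & g n (l n) = b n] /\
    [/\ PP (P n), 0 <= s n <= l n, 0 <= t n <= l n,
    within_dist c (P n) (g n (s n)) & within_dist c (P n) (g n (t n))] /\
    e * rr n < mdist (g n (s n)) (g n (t n)).
  by apply: filterS fP => n; rewrite /l /g /P /s /t; case: (f n) => [[[[]]]].
have PPP : \forall n \near U, PP (P n) by apply: filterS fP => n [_ [[]]].
have aux u : (\forall n \near U, [/\ geodesic (l n) (g n), g n 0 = a n, g n (l n) = b n &
    0 <= u n <= l n]) -> let z n := g n (u n) in vis z /\
    mdist (pt a) (pt z) + mdist (pt z) (pt b) <= mdist (pt a) (pt b).
  move=> Hu z; have zE : \forall n \near U, mdist (a n) (z n) + mdist (z n) (b n) <= mdist (a n) (b n) + 0.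
    apply: filterS Hu => n [gn <- <- ul].
    by rewrite !(geodesic_mdist gn); clear - UU scale_oo geoX ap1 va ul; lra.
  have vz : vis z.
    apply: (visible_near UU va (c := mdist (pt a) (pt b) + 1)).
    have h : mdist (pt a) (pt b) < mdist (pt a) (pt b) + 1 by lra.
    apply: filterS2 zE (cone_lt va vb h) => n h1 h2.
    by have := mdist_ge0 (z n) (b n); lra.
  by split=> //; apply: (cone_le_add UU scale_oo va vz vz vb va vb zE).
have [|vx ax] := aux s.
  by apply: filterS fP => n [[? ? ?] [[? ? ? ? ?] _]].
have [|vy ay] := aux t.
  by apply: filterS fP => n [[? ? ?] [[? ? ? ? ?] _]].
set x := fun n => g n (s n) in vx ax *; set y := fun n => g n (t n) in vy ay *.
have Px : lim P (pt x).
  by apply: (ultralimit_bounded (c := c) UU scale_oo vx); apply: filterS fP => n [_ [[]]].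
have Py : lim P (pt y).
  by apply: (ultralimit_bounded (c := c) UU scale_oo vy); apply: filterS fP => n [_ [[]]].
have P0 : lim P !=set0 by exists (pt x).
have [f1 ga] := (ultralimit_gated PPP P0).1 (pt a).
have gb := ab _ PPP _ ga.
have gateE z : lim P (pt z) ->
    mdist (pt a) (pt z) + mdist (pt z) (pt b) <= mdist (pt a) (pt b) -> f1 = pt z.
  move=> Pz azb; apply: mdist0; have := ga.2 _ Pz; have := gb.2 _ Pz.
  have := metric_triangle (pt a) f1 (pt b).
  by rewrite (metric_sym f1 (pt b)) (metric_sym (pt b) (pt z)); clear - UU scale_oo geoX ap1 va azb; lra.
have : e <= mdist (pt x) (pt y).
  by apply: cone_ge => //; apply: filterS fP => n [_ [_ /ltW]].
by rewrite -(gateE _ Px ax) -(gateE _ Py ay) mdistxx; lra.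
Qed.

Context {lam sigma : R}.
Hypothesis atf : forall D K : R, 1 <= D -> sigma <= K ->
  forall T, almost_transverse PP K D T -> thin_triangle (lam * D) T.

Lemma same_gates_thin (a b c : nat -> X) (e : R) (l1 l2 l3 : nat -> R) (g1 g2 g3 : nat -> R -> X) :
  vis a -> vis b -> vis c -> 0 < e -> same_gates (pt a) (pt b) ->
  same_gates (pt b) (pt c) -> same_gates (pt c) (pt a) ->
  (forall n, [/\ geodesic (l1 n) (g1 n), g1 n 0 = a n & g1 n (l1 n) = b n]) ->
  (forall n, [/\ geodesic (l2 n) (g2 n), g2 n 0 = b n & g2 n (l2 n) = c n]) ->
  (forall n, [/\ geodesic (l3 n) (g3 n), g3 n 0 = c n & g3 n (l3 n) = a n]) ->
  \forall n \near U, forall s, 0 <= s <= l3 n ->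
    (exists2 t, 0 <= t <= l1 n & mdist (g3 n s) (g1 n t) <= e * rr n) \/
    (exists2 t, 0 <= t <= l2 n & mdist (g3 n s) (g2 n t) <= e * rr n).
Proof.
move=> va vb vc e0 ab bc ca H1 H2 H3.
have lam0 : 0 < `|lam| + 1 by have := normr_ge0 lam; lra.
(* Half of e pays for lam * D with D = d * rr n, the other half for the 1 lost between
   [neighborhood] and [within_dist]. The factor [|lam| + 1] is positive whatever the sign of lam. *)
pose d := e / (2 * (`|lam| + 1)).
have d0 : 0 < d by rewrite divr_gt0// mulr_gt0//; lra.
have e20 : 0 < e / 2 by lra.
apply: filterS2 (filterI (scale_small UU scale_oo 1 d0) (scale_small UU scale_oo 1 e20))
  (filterI (same_gates_transverse (sigma + 1) va vb d0 ab)
  (filterI (same_gates_transverse (sigma + 1) vb vc d0 bc)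
  (same_gates_transverse (sigma + 1) vc va d0 ca))) => n [dn en] [t1 [t2 t3]].
have [G1 g10 g11] := H1 n; have [G2 g20 g21] := H2 n; have [G3 g30 g31] := H3 n.
have [T [[L1 S1] [L2 S2] [L3 S3]]] := triangle_of_geodesics G1 G2 G3
  (etrans g11 (esym g20)) (etrans g21 (esym g30)) (etrans g31 (esym g10)).
have tT : almost_transverse PP sigma (d * rr n) T.
  have ss : sigma < sigma + 1 by lra.
  move=> P i PPP; apply/diam_le => x y [Nx [s /= sl sx]] [Ny [t /= tl ty]].
  rewrite !in_itv/= in sl tl; rewrite -sx -ty in Nx Ny *.
  move: sl tl Nx Ny => sl tl /(neighborhood_within_dist ss) Nx /(neighborhood_within_dist ss) Ny.
  have [iE|iE|iE] := I3_cases ord0 i; rewrite iE ?(L1, S1, L2, S2, L3, S3) in sl tl Nx Ny *.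
  - exact: (t1 _ _ _ _ _ G1 g10 g11 PPP sl tl Nx Ny).
  - exact: (t2 _ _ _ _ _ G2 g20 g21 PPP sl tl Nx Ny).
  - exact: (t3 _ _ _ _ _ G3 g30 g31 PPP sl tl Nx Ny).
move=> s sl; have D1 : 1 <= d * rr n by [].
have thinT := atf D1 (lexx sigma) tT.
have g3s : side T (ordS (ordS ord0)) (g3 n s).
  by exists s; rewrite ?S3//= in_itv/= L3.
have := thinT _ _ g3s.
move=> /(neighborhood_within_dist (c' := lam * (d * rr n) + 1)) [|q [j /= ji [t tl tq]] sq].
  by lra.
have de : lam * (d * rr n) + 1 <= e * rr n.
  have h : lam * (d * rr n) <= (`|lam| + 1) * (d * rr n).
    rewrite ler_pM2r ?mulr_gt0//; have := ler_norm lam; clear - UU scale_oo geoX ap1 atf va; lra.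
  have hd : (`|lam| + 1) * (d * rr n) = e / 2 * rr n.
    by rewrite /d; field; lra.
  by lra.
rewrite /= in_itv/= in tl; rewrite -tq in sq.
have [jE|jE|jE] := I3_cases (ordS (ordS ord0)) j.
- by rewrite jE eqxx in ji.
- by left; exists t; rewrite jE ordS3 ?L1 ?S1 // in tl sq *; clear - UU scale_oo geoX ap1 atf va sq de; lra.
- by right; exists t; rewrite jE ordS3 ?L2 ?S2 // in tl sq *; clear - UU scale_oo geoX ap1 atf va sq de; lra.
Qed.

(** The geodesics of X from a to z and from z to b form thin triangles with g, since the three
    points have the same gates. The point of g at distance d(a, z) from a is close to one of these
    two sides, and the near equality d(a, z) + d(z, b) = d(a, b) then puts it close to z. *)
Lemma same_gates_point (a b z : nat -> X) (l : nat -> R) (g : nat -> R -> X) :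
  vis a -> vis b -> vis z -> same_gates (pt a) (pt b) -> same_gates (pt a) (pt z) ->
  same_gates (pt z) (pt b) ->
  mdist (pt a) (pt z) + mdist (pt z) (pt b) <= mdist (pt a) (pt b) ->
  (forall n, [/\ geodesic (l n) (g n), g n 0 = a n & g n (l n) = b n]) ->
  let w n := g n (Num.min (mdist (a n) (z n)) (l n)) in vis w /\ pt z = pt w.
Proof.
move=> va vb vz ab az zb azb gP w.
have [l1 [h1 h1P]] := geodesic_choice geoX a z.
have [l2 [h2 h2P]] := geodesic_choice geoX z b.
have revP n : [/\ geodesic (l n) (fun s => g n (l n - s)), g n (l n - 0) = b n &
    g n (l n - l n) = a n].
  have [gg g0 gl] := gP n; split; [exact: geodesic_rev|by rewrite subr0|].
  by rewrite subrr.
apply: cone_eq => // e e0; have d0 : 0 < e / 3 by lra.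
have thin := same_gates_thin va vz vb d0 az zb (same_gates_sym ab) h1P h2P revP.
set Daz := mdist (pt a) (pt z) in azb; set Dzb := mdist (pt z) (pt b) in azb.
set Dab := mdist (pt a) (pt b) in azb.
have Dzb0 : 0 <= Dzb by exact: mdist_ge0.
have e1 : Daz < Daz + e / 9 by lra. have e2 : Dzb < Dzb + e / 9 by lra.
have e3 : Dab - e / 9 < Dab by lra.
apply: filterS2 thin (filterI (cone_lt va vz e1) (filterI (cone_lt vz vb e2)
  (cone_gt va vb e3))) => n thin [d1 [d2 d3]].
have rn : 0 < rr n by []; have ern : 0 < e * rr n by rewrite mulr_gt0.
have h4 : Daz * rr n + Dzb * rr n <= Dab * rr n by rewrite -mulrDl ler_pM2r.
have h5 : 0 <= Dzb * rr n by rewrite mulr_ge0// ltW.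
have [gg g0 gl] := gP n; have [gh1 h10 h1l] := h1P n; have [gh2 h20 h2l] := h2P n.
have lE := geodesic_length gg; rewrite g0 gl in lE.
have l1E := geodesic_length gh1; rewrite h10 h1l in l1E.
have l2E := geodesic_length gh2; rewrite h20 h2l in l2E.
have l0 := geodesic_ge0 gg; have a0 := mdist_ge0 (a n) (z n).
pose t := Num.min (mdist (a n) (z n)) (l n).
have h6 : mdist (a n) (z n) - 2 / 9 * (e * rr n) <= l n by lra.
have [t0 tln taz tge] : [/\ 0 <= t, t <= l n, t <= mdist (a n) (z n) &
    mdist (a n) (z n) - 2 / 9 * (e * rr n) <= t].
  by apply: min_bounds => //; rewrite mulr_ge0// ltW.
have bt : mdist (z n) (b n) - l n + t <= 1 / 3 * (e * rr n) by lra.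
clear h4 h5 d1 d2 d3 h6; rewrite /w -/t metric_sym.
have aw : mdist (a n) (g n t) = t by rewrite -g0 (geodesic_mdist gg) ?subr0.
have wb : mdist (g n t) (b n) = l n - t by rewrite -gl (geodesic_mdist gg).
have := thin (l n - t) _; rewrite (_ : l n - (l n - t) = t); last by ring.
case; first by rewrite subr_ge0 tln gerBl t0.
- move=> [v vl wv]; have /andP[v0 vl1] := vl.
  have av : mdist (a n) (h1 n v) = v by rewrite -h10 (geodesic_mdist gh1) ?subr0.
  have vz' : mdist (h1 n v) (z n) = l1 n - v by rewrite -h1l (geodesic_mdist gh1).
  have := metric_triangle (g n t) (h1 n v) (z n).
  have := metric_triangle (a n) (h1 n v) (g n t).
  by rewrite (metric_sym (h1 n v) (g n t)) av vz' aw; clear - UU scale_oo geoX ap1 atf va wv l1E tge bt ern taz; lra.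
- move=> [v vl wv]; have /andP[v0 vl2] := vl.
  have av : mdist (z n) (h2 n v) = v by rewrite -h20 (geodesic_mdist gh2) ?subr0.
  have vz' : mdist (h2 n v) (b n) = l2 n - v by rewrite -h2l (geodesic_mdist gh2).
  have := metric_triangle (g n t) (h2 n v) (z n).
  have := metric_triangle (g n t) (h2 n v) (b n).
  by rewrite (metric_sym (h2 n v) (z n)) av vz' wb; clear - UU scale_oo geoX ap1 atf va wv l2E tge bt ern taz; lra.
Qed.

Lemma cone_T2 (T : geodesic_triangle cone) : simple_triangle T ->
  exists2 P : nat -> set X, (\forall n \near U, PP (P n)) & \bigcup_j side T j `<=` lim P.
Proof.
move=> sT; apply: contrapT => nP; have gg i := side_geodesic T i.
pose L i := side_length T i; pose S i := side_path T i.
have L0 i : 0 <= L i by exact: geodesic_ge0 (gg i).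
(* Two points of a side in one limit of P would put the whole triangle there, against the
   assumption. *)
have same i s t : 0 <= s <= L i -> 0 <= t <= L i -> same_gates (S i s) (S i t).
  move=> sl tl; apply: (same_gates_geodesic (gg i)) => // P u v PPP u0 uv vl Pu Pv.
  apply: nP; exists P => //.
  have P0 : lim P !=set0 by exists (side_path T i u).
  exact: (simple_triangle_in_gated (ultralimit_gated PPP P0) sT u0 uv vl Pu Pv).
have /choice[x xP] i : exists x, vis x /\ S i 0 = pt x.
  by have [x vx xE] := cone_pt_surj (S i 0); exists x.
have SL i : S i (L i) = pt (x (ordS i)).
  by rewrite -(xP (ordS i)).2; exact: side_adjacent.
have vx i := (xP i).1; have S0 i := (xP i).2.
have /choice[lh hP] i : exists lh : (nat -> R) * (nat -> R -> X), forall n,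
    [/\ geodesic (lh.1 n) (lh.2 n), lh.2 n 0 = x i n & lh.2 n (lh.1 n) = x (ordS i) n].
  by have [l [h H]] := geodesic_choice geoX (x i) (x (ordS i)); exists (l, h).
pose l i := (lh i).1; pose h i := (lh i).2.
have {}hP i n : [/\ geodesic (l i n) (h i n), h i n 0 = x i n & h i n (l i n) = x (ordS i) n].
  exact: hP.
have DL i : mdist (pt (x i)) (pt (x (ordS i))) = L i.
  by rewrite -S0 -SL; exact: geodesic_length (gg i).
have approx i s : 0 <= s <= L i -> exists z, [/\ vis z, S i s = pt z &
    let w n := h i n (Num.min (mdist (x i n) (z n)) (l i n)) in vis w /\ pt z = pt w].
  move=> sl; have [z vz zE] := cone_pt_surj (S i s); exists z; split=> //.
  have sL : 0 <= (0 : R) <= L i by rewrite lexx L0.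
  have sL' : 0 <= L i <= L i by rewrite lexx L0.
  have sg s1 s2 u1 u2 : S i s1 = pt u1 -> S i s2 = pt u2 -> 0 <= s1 <= L i ->
      0 <= s2 <= L i -> same_gates (pt u1) (pt u2).
    by move=> <- <- ? ?; exact: same.
  apply: (@same_gates_point (x i) (x (ordS i)) z (l i) (h i) (vx _) (vx _) vz).
  - exact: sg (S0 i) (SL i) sL sL'.
  - exact: sg (S0 i) zE sL sl.
  - exact: sg zE (SL i) sl sL'.
  - by rewrite DL -zE -S0 -SL !(geodesic_mdist (gg i)); rewrite /L in sl *; clear - UU scale_oo geoX ap1 atf vx sl; lra.
  - exact: hP.
(* Conversely, limits of points on the geodesics of X lie on the side: such a limit is compared with
   the point of the side at the same distance from the vertex, itself a limit of points on these
   geodesics by [approx]. *)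
have on_side j (tau : nat -> R) : (\forall n \near U, 0 <= tau n <= l j n) ->
    vis (fun n => h j n (tau n)) /\
    exists2 s, 0 <= s <= L j & pt (fun n => h j n (tau n)) = S j s.
  move=> Ht; pose u n := h j n (tau n).
  have uE : \forall n \near U, mdist (x j n) (u n) = tau n /\
      mdist (x j n) (u n) + mdist (u n) (x (ordS j) n) <= mdist (x j n) (x (ordS j) n) + 0.
    apply: filterS Ht => n tl; have [gh <- <-] := hP j n.
    by rewrite !(geodesic_mdist gh); clear - UU scale_oo geoX ap1 atf vx tl; lra.
  have vu : vis u.
    apply: (visible_near UU (vx j) (c := L j + 1)).
    have e1 : mdist (pt (x j)) (pt (x (ordS j))) < L j + 1 by rewrite DL; lra.
    apply: filterS2 uE (cone_lt (vx j) (vx _) e1) => n [_ h1] h2.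
    by have := mdist_ge0 (u n) (x (ordS j) n); lra.
  split=> //; pose s := mdist (pt (x j)) (pt u).
  have sL : 0 <= s <= L j.
    rewrite mdist_ge0 /= -DL.
    have uE' : \forall n \near U, mdist (x j n) (u n) + mdist (u n) (x (ordS j) n)
        <= mdist (x j n) (x (ordS j) n) + 0 by apply: filterS uE => n [].
    have := cone_le_add UU scale_oo (vx j) vu vu (vx _) (vx j) (vx _) uE'.
    by have := mdist_ge0 (pt u) (pt (x (ordS j))); rewrite /s; lra.
  exists s => //; have [z [vz zE [vw zw]]] := approx j s sL.
  rewrite zE zw; apply/esym; apply: (cone_eq _ _ _).2 => // e e0.
  have sE : mdist (pt (x j)) (pt z) = s.
    by rewrite -zE -S0 (geodesic_mdist (gg j)); rewrite /L in sL *; lra.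
  have e1 : s < s + e / 2 by lra. have e2 : s - e / 2 < s by lra.
  have e3 : mdist (pt (x j)) (pt z) < s + e / 2 by lra.
  have e4 : s - e / 2 < mdist (pt (x j)) (pt z) by lra.
  apply: filterS2 (filterI Ht uE) (filterI (filterI (cone_lt (vx j) vu e1)
    (cone_gt (vx j) vu e2)) (filterI (cone_lt (vx j) vz e3) (cone_gt (vx j) vz e4))).
  move=> n [tl [uEn _]] [[h1 h2] [h3 h4]]; have [gh _ _] := hP j n.
  have := mdist_ge0 (x j n) (z n) => h5.
  rewrite (geodesic_gap gh) //; last first.
    by case: (leP (mdist (x j n) (z n)) (l j n)); clear - UU scale_oo geoX ap1 atf vx h5 tl; lra.
  rewrite ler_norml; case: (leP (mdist (x j n) (z n)) (l j n)).
    by clear - UU scale_oo geoX ap1 atf vx uEn h1 h2 h3 h4; lra.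
  by clear - UU scale_oo geoX ap1 atf vx uEn tl h1 h2 h3 h4; lra.
have core i s e : 0 <= s <= L i -> 0 < e ->
    (exists2 t, 0 <= t <= L (ordS i) & mdist (S i s) (S (ordS i) t) <= e) \/
    (exists2 t, 0 <= t <= L (ordS (ordS i)) & mdist (S i s) (S (ordS (ordS i)) t) <= e).
  move=> sl e0; have [z [vz zE [vw zw]]] := approx i s sl.
  have sg k : same_gates (pt (x k)) (pt (x (ordS k))).
    by rewrite -S0 -SL; apply: same; rewrite lexx L0.
  have sg3 := sg (ordS (ordS i)); rewrite ordS3 in sg3.
  have hP3 := hP (ordS (ordS i)); rewrite ordS3 in hP3.
  have thin := same_gates_thin (vx _) (vx _) (vx _) e0 (sg (ordS i)) sg3
    (sg i) (hP (ordS i)) hP3 (hP i).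
  pose w n := h i n (Num.min (mdist (x i n) (z n)) (l i n)).
  have fin j : (\forall n \near U, exists2 t, 0 <= t <= l j n & mdist (w n) (h j n t) <= e * rr n) ->
      exists2 t, 0 <= t <= L j & mdist (S i s) (S j t) <= e.
    move=> H; have [tau tauP] : exists tau, \forall n \near U,
        0 <= tau n <= l j n /\ mdist (w n) (h j n (tau n)) <= e * rr n.
      apply: (@ultra_choice _ UU _ (fun=> 0) (fun n t => 0 <= t <= l j n /\
        mdist (w n) (h j n t) <= e * rr n)).
      by apply: filterS H => n [t]; exists t.
    have [|vu [t tl tE]] := on_side j tau; first by apply: filterS tauP => n [].
    exists t => //; rewrite -tE zE zw; apply: cone_le => //.
    by apply: filterS tauP => n [].
  have : \forall n \near U,
    (exists2 t, 0 <= t <= l (ordS i) n & mdist (w n) (h (ordS i) n t) <= e * rr n) \/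
    (exists2 t, 0 <= t <= l (ordS (ordS i)) n & mdist (w n) (h (ordS (ordS i)) n t) <= e * rr n).
    apply: filterS thin => n; apply; have [/geodesic_ge0 + _ _] := hP i n.
    have := mdist_ge0 (x i n) (z n).
    by case: (leP (mdist (x i n) (z n)) (l i n)); clear - UU scale_oo geoX ap1 atf vx; lra.
  by move=> /(ultra_or UU)[/fin|/fin]; [left|right].
have [i Li] : exists i, 0 < L i.
  apply: contrapT => nL; have := sT.1; rewrite /perimeter big1 ?ltxx// => i _.
  apply/eqP; rewrite eq_le L0 andbT leNgt; apply/negP => Li.
  by apply: nL; exists i.
(* By simplicity the midpoint of a nondegenerate side is off the other two sides. These are closed,
   so it has a positive distance from them, against [core]. *)
have sl : 0 <= L i / 2 <= L i by lra.
have far j : (forall t, 0 <= t <= L j -> S i (L i / 2) <> S j t) ->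
    exists2 e, 0 < e & forall t, 0 <= t <= L j -> e <= mdist (S i (L i / 2)) (S j t).
  move=> ne; apply: contrapT => nE.
  have [e e0|t tl tE] := geodesic_adherent (gg j) (lexx 0) (L0 j) (lexx _) (x := S i (L i / 2)).
    apply: contrapT => nT; apply: nE; exists e => // t tl.
    by rewrite leNgt; apply/negP => lt; apply: nT; exists t.
  exact: ne tE.
have [e1 e10 E1] : exists2 e, 0 < e & forall t, 0 <= t <= L (ordS i) ->
    e <= mdist (S i (L i / 2)) (S (ordS i) t).
  apply: far => t tl /(simple_triangle_meet sT sl tl) []; rewrite -/(L _); lra.
have [e2 e20 E2] : exists2 e, 0 < e & forall t, 0 <= t <= L (ordS (ordS i)) ->
    e <= mdist (S i (L i / 2)) (S (ordS (ordS i)) t).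
  apply: far => t tl /esym eq.
  have := @simple_triangle_meet _ _ T (ordS (ordS i)) t (L i / 2) sT tl.
  by rewrite ordS3 => /(_ sl eq) []; rewrite -/(L i); lra.
have [e3 e30 [e31 e32]] : exists2 e3 : R, 0 < e3 & e3 < e1 /\ e3 < e2.
  have [e12|e12] := leP e1 e2; first by exists (e1 / 2);
    [|split]; clear - UU scale_oo geoX ap1 atf vx e10 e20 e12; lra.
  by exists (e2 / 2); [|split]; clear - UU scale_oo geoX ap1 atf vx e10 e20 e12; lra.
have [[t tl]|[t tl]] := core i _ _ sl e30.
- by have := E1 _ tl; clear - UU scale_oo geoX ap1 atf vx e31; lra.
- by have := E2 _ tl; clear - UU scale_oo geoX ap1 atf vx e32; lra.
Qed.

End ProjectionsInCone.

(** * Indices of pieces, and the implication from projections to cones *)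

Section Pieces.
Context {R : realType} {X : metricType R} {PP : set (set X)}.
Context {U : set_system nat} (UU : UltraFilter U).
Implicit Types (P Q : nat -> set X).

Lemma piece_seq_of P : (\forall n \near U, PP (P n)) ->
  exists P' : piece_seq PP, \forall n \near U, sets_of P' n = P n.
Proof.
move=> PPP; have [m PPm] := filter_ex PPP.
exists (fun n => if pselect (PP (P n)) is left h then SigSub (mem_set h)
  else SigSub (mem_set PPm)).
by apply: filterS PPP => n; rewrite /sets_of; case: pselect.
Qed.

Lemma sets_of_mem (P : piece_seq PP) n : PP (sets_of P n).
Proof. exact: set_mem (valP (P n)). Qed.

Lemma ultralimit_ae p r P Q : (\forall n \near U, P n = Q n) ->
  ultralimit UU p r P = ultralimit UU p r Q.
Proof.
by move=> PQ; apply/seteqP; split=> a [x xa xP]; exists x => //;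
  apply: filterS2 PQ xP => n ->.
Qed.

(** Lets the arguments work with sequences of sets almost all in PP instead of classes. One index
    serves all cones, and its representative is kept in order to tell different indices apart. *)
Lemma cone_piece_index P : (\forall n \near U, PP (P n)) ->
  exists q : piece_index PP UU, (forall p r, cone_piece UU p r q = ultralimit UU p r P) /\
    exists2 P', q = index_pi UU P' & \forall n \near U, sets_of P' n = P n.
Proof.
move=> /piece_seq_of[P' P'E]; exists (index_pi UU P'); split; last by exists P'.
by move=> p r; rewrite cone_pieceE; exact: ultralimit_ae.
Qed.

Lemma cone_piece_repr p r (q : piece_index PP UU) :
  cone_piece UU p r q = ultralimit UU p r (sets_of (repr q)).
Proof. by []. Qed.

Lemma index_neq (q q' : piece_index PP UU) : q <> q' ->
  \forall n \near U, sets_of (repr q) n <> sets_of (repr q') n.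
Proof.
move=> qq'; have : ~ \forall n \near U, repr q n = repr q' n.
  move=> /index_piP; rewrite /index_pi !reprK; exact: qq'.
move=> /(ultra_not UU); apply: filterS => n ne E; apply: ne.
exact: val_inj.
Qed.

End Pieces.

Lemma scale_ultra {R : realType} {U : set_system nat} (UU : UltraFilter U)
    (r : nat -> {posnum R}) : nonprincipal U ->
  (r n)%:num @[n --> \oo] --> +oo -> forall M : R, \forall n \near U, M <= (r n)%:num.
Proof.
move=> nU /cvgryPge roo M.
exact: (ultra_oo UU nU (F := fun n => M <= (r n)%:num) (roo M)).
Qed.

Lemma tree_graded_of_projections (R : realType) (X : metricType R) (PP : set (set X))
    (U : set_system nat) (UU : UltraFilter U) (prj : set X -> X -> X) :
  nonprincipal U -> geodesic_space X -> asymptotically_transverse_free PP ->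
  almost_projection_system PP prj -> asymptotically_tree_graded PP UU.
Proof.
move=> nU geoX [lam [sigma atf]] [prjP [C C0 ap]] p r /(scale_ultra UU nU) scale_oo.
have ap1 P : PP P -> forall x q, P q -> mdist x (prj P x) + mdist (prj P x) q <= mdist x q + C.
  by move=> /ap[H _ _] x q /(H x); lra.
have ap2 P : PP P -> forall x y,
    (forall q, P q -> mdist x y <= mdist x q) -> mdist (prj P x) (prj P y) <= C.
  move=> /ap[_ H _] x y xy; apply: ((diam_le _ _).1 (H x)).
    by exists x => //=; rewrite mdistxx; exact: edist_inf_ge0.
  by exists y => //=; apply/edist_inf_ge.
have ap3 P Q : PP P -> PP Q -> Q <> P ->
    forall x y, Q x -> Q y -> mdist (prj P x) (prj P y) <= C.
  move=> /ap[_ _ H] PQ QP x y Qx Qy; apply: ((diam_le _ _).1 (H _ PQ QP)).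
    by exists x.
  by exists y.
have PPr (q : piece_index PP UU) : \forall n \near U, PP (sets_of (repr q) n).
  by apply: nearW => n; exact: sets_of_mem.
have geoC := cone_geodesic_space (UU := UU) (p := p) (r := r) geoX.
split.
- exact: cone_complete.
- exact: geoC.
- by move=> q _; rewrite cone_piece_repr; exact: ultralimit_closed.
- move=> q q0 a b Qa Qb; rewrite cone_piece_repr in q0 Qa Qb *.
  have gP := ultralimit_gated scale_oo prjP ap1 ap2 (PPr q) q0.
  have [l [g [gg ga gb _]]] := geoC a b Logic.I Logic.I.
  exists l, g; split=> // _ [t /= tl <-]; rewrite in_itv/= in tl.
  apply: (gated_convex gP.1 gg (a := 0) (b := l)) => //; rewrite ?ga ?gb//; lra.
- move=> q q' _ _ /index_neq qq'; rewrite !cone_piece_repr.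
  exact: (ultralimit_T1 scale_oo prjP ap1 ap3 (PPr _) (PPr _) qq').
- move=> T sT.
  have [P PPP TP] := cone_T2 scale_oo geoX prjP ap1 ap2 atf sT.
  have [q [qE _]] := cone_piece_index UU PPP.
  exists q; last by rewrite qE.
  rewrite /= qE; exists (side_path T ord0 0); apply: TP; exists ord0 => //.
  by exists 0; rewrite //= in_itv/= lexx (geodesic_ge0 (side_geodesic T ord0)).
Qed.

(** * Projections of an asymptotically tree-graded space *)

Lemma posnum_seq (R : realType) (f : nat -> R) : (forall n, n.+1%:R <= f n) ->
  exists r : nat -> {posnum R}, (forall n, (r n)%:num = f n) /\
    (r n)%:num @[n --> \oo] --> +oo.
Proof.
move=> fn; have f0 n : 0 < f n by apply: lt_le_trans (fn n); rewrite ltr0n.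
exists (fun n => PosNum (f0 n)); split=> //=.
apply/cvgryPge => A; exists (Num.truncn A) => // n /= An.
apply: (le_trans (ltW (truncnS_gt A))); apply: le_trans (fn n).
by rewrite ler_nat ltnS.
Qed.

Section TreeGradedCones.
Context {R : realType} {X : metricType R} {PP : set (set X)}.
Context {U : set_system nat} (UU : UltraFilter U).
Hypothesis nU : nonprincipal U.
Hypothesis atg : asymptotically_tree_graded PP UU.

Section OneCone.
Context {p : nat -> X} {r : nat -> {posnum R}}.
Hypothesis r_oo : (r n)%:num @[n --> \oo] --> +oo.
Notation cone := (asymptotic_cone UU p r).
Notation rr n := (r n)%:num.
Notation vis := (visible (U := U) (p := p) (r := r)).
Notation pt := (cone_pt UU (p := p) (r := r)).
Notation lim P := (ultralimit UU p r P).

Lemma atg_gated (P : nat -> set X) : (\forall n \near U, PP (P n)) ->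
  lim P !=set0 -> gated (lim P).
Proof.
move=> PPP P0; have [q [qE _]] := cone_piece_index UU PPP.
by rewrite -qE; apply: (tree_graded_gated (atg p r_oo)); rewrite /= qE.
Qed.

Lemma atg_T1 (P Q : nat -> set X) : (\forall n \near U, PP (P n)) ->
  (\forall n \near U, PP (Q n)) -> (\forall n \near U, P n <> Q n) ->
  is_subset1 (lim P `&` lim Q).
Proof.
move=> PPP PPQ PQ a b ha hb.
have [q [qE [P' q' P'E]]] := cone_piece_index UU PPP.
have [s [sE [Q' s' Q'E]]] := cone_piece_index UU PPQ.
have qs : q <> s.
  rewrite q' s' => /index_piP PQ'.
  have [n [h1 [h2 [h3 h4]]]] := filter_ex (filterI PQ (filterI PQ' (filterI P'E Q'E))).
  by apply: h1; rewrite -h3 -h4 /sets_of h2.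
apply: (tree_graded_T1 (atg p r_oo) _ _ qs).
- by rewrite /= qE; exists a; exact: ha.1.
- by rewrite /= sE; exists a; exact: ha.2.
- by rewrite qE sE.
- by rewrite qE sE.
Qed.

Lemma atg_geodesic : geodesic_subset [set: cone].
Proof. exact: (tree_graded_geodesic (atg p r_oo)). Qed.

Lemma atg_separation (l t1 t0 t2 : R) (g : R -> cone) : geodesic l g ->
  0 <= t1 -> t1 < t0 -> t0 < t2 -> t2 <= l ->
  (forall (P : nat -> set X) s t, (\forall n \near U, PP (P n)) ->
    t1 <= s -> s < t -> t <= t2 -> lim P (g s) -> lim P (g t) -> False) ->
  exists L : set cone,
  [/\ forall t, 0 <= t < t0 -> L (g t), forall t, t0 < t <= l -> ~ L (g t) &
      forall n h, geodesic n h -> (forall t, 0 <= t <= n -> h t <> g t0) ->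
        L (h 0) <-> L (h n)].
Proof.
move=> gg h1 h10 h02 h2 H.
apply: (tree_graded_separation (atg p r_oo) gg h1 h10 h02 h2).
move=> q s t _; rewrite cone_piece_repr; apply: H.
by apply: nearW => n; exact: sets_of_mem.
Qed.

End OneCone.

(* In the cone, the limit of a counterexample of nearly minimal length has its
   middle third in the limit of P, so that this third is again a counterexample. *)
Lemma quasi_transversal : exists2 M : R, 0 <= M & forall P, PP P ->
  forall l g, geodesic l g -> within_dist (l / 3) P (g 0) ->
  within_dist (l / 3) P (g l) -> exists2 t, 0 <= t <= l & within_dist M P (g t).
Proof.
apply: contrapT => nM.
pose bad n l P (g : R -> X) := [/\ PP P, geodesic l g, within_dist (l / 3) P (g 0),
  within_dist (l / 3) P (g l) & forall t, 0 <= t <= l -> ~ within_dist n.+1%:R P (g t)].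
pose S n := [set l | exists P g, bad n l P g].
have Sn n : S n !=set0.
  apply: contrapT => nS; apply: nM; exists n.+1%:R => // P PPP l g gg g0 gl.
  apply: contrapT => nt; apply: nS; exists l, P, g; split=> // t tl wt.
  by apply: nt; exists t.
have Sgt n l : S n l -> n.+1%:R < l / 3.
  move=> [P [g [_ /geodesic_ge0 l0 g0 _ av]]]; rewrite ltNge; apply/negP => ln.
  apply: (av 0); first by rewrite lexx.
  by have [q Pq d] := g0; exists q => //; lra.
have Sgt1 n l : S n l -> n.+1%:R <= l.
  by move=> /Sgt; have := ler0n R n.+1; lra.
have /choice[f fP] n : exists f : R * set X * (R -> X),
    bad n f.1.1 f.1.2 f.2 /\ forall l, S n l -> f.1.1 / 2 < l.
  have S0 l : S n l -> 0 <= l by move=> /Sgt1; have := ler0n R n.+1; lra.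
  (* The alternative [l <= 1] cannot occur, as these geodesics are longer than 3 (n + 1). *)
  have [l Sl [l1|lmin]] := near_halving (Sn n) S0.
    by have := Sgt _ _ Sl; have := ler0n R n; rewrite -natr1; lra.
  by have [P [g gb]] := Sl; exists (l, P, g).
pose l n := (f n).1.1; pose P n := (f n).1.2; pose g n := (f n).2.
have {}fP n : bad n (l n) (P n) (g n) /\ forall l', S n l' -> l n / 2 < l'.
  exact: fP.
have [r [rl r_oo]] := @posnum_seq R l (fun n => Sgt1 _ _ (ex_intro _ _ (ex_intro _ _ (fP n).1))).
pose p n := g n 0; pose y n := g n (l n).
have scale_oo := scale_ultra UU nU r_oo.
have PPP : \forall n \near U, PP (P n) by apply: nearW => n; have [[]] := fP n.
have gg : \forall n \near U, geodesic (l n) (g n).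
  by apply: nearW => n; have [[]] := fP n.
have dxy n : mdist (p n) (y n) = l n.
  by have [[_ gn _ _ _] _] := fP n; exact: geodesic_length.
have vx : visible (U := U) (p := p) (r := r) p by exact: visible_base.
have vy : visible (U := U) (p := p) (r := r) y.
  apply: (visible_near UU vx (c := 1)); apply: nearW => n.
  by rewrite dxy rl mul1r.
have Dxy : mdist (cone_pt UU (p := p) (r := r) p) (cone_pt UU y) = 1.
  apply/eqP; rewrite eq_le; apply/andP; split.
    by apply: cone_le => //; apply: nearW => n; rewrite dxy rl mul1r.
  by apply: cone_ge => //; apply: nearW => n; rewrite dxy rl mul1r.
have [G [gG G0 G1 GP]] := limit_geodesic UU gg vx vy.
rewrite Dxy in gG G1 GP.
have close (z : nat -> X) : visible (U := U) (p := p) (r := r) z ->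
    (forall n, within_dist (l n / 3) (P n) (z n)) -> exists2 e,
    ultralimit UU p r P e & mdist (cone_pt UU z) e <= 1 / 3.
  move=> vz zP; have /choice[q qP] n : exists q, P n q /\ mdist (z n) q <= l n / 3.
    by have [q Pq zq] := zP n; exists q.
  have zq : \forall n \near U, mdist (z n) (q n) <= 1 / 3 * (r n)%:num.
    by apply: nearW => n; rewrite rl; have := (qP n).2; lra.
  have vq := visible_near UU vz zq.
  exists (cone_pt UU q); last exact: cone_le.
  by apply: ultralimit_pt => //; apply: nearW => n; exact: (qP n).1.
have [|a Pa da] := close p vx; first by move=> n; have [[]] := fP n.
have [|b Pb db] := close y vy; first by move=> n; have [[]] := fP n.
have gP := atg_gated r_oo PPP (ex_intro _ _ Pa).
have [e ge] := gP.1 (cone_pt UU p); have [e' ge'] := gP.1 (cone_pt UU y).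
have de : mdist (cone_pt UU p) e <= 1 / 3.
  by have := ge.2 _ Pa; have := mdist_ge0 e a; clear - atg da; lra.
have de' : mdist (cone_pt UU y) e' <= 1 / 3.
  by have := ge'.2 _ Pb; have := mdist_ge0 e' b; clear - atg db; lra.
have ee' : e <> e'.
  move=> ee; have := metric_triangle (cone_pt UU p) e (cone_pt UU y).
  by rewrite Dxy (metric_sym e (cone_pt UU y)) {2}ee; clear - atg de de'; lra.
have [s [t [s0 st t1 Gs Gt]]] := gated_geodesic gP gG G0 G1 ge ge' ee'.
have s3 : s <= 1 / 3.
  by move: de; rewrite -G0 -Gs (geodesic_mdist gG); clear - atg s0 st t1; lra.
have t3 : 2 / 3 <= t.
  by move: de'; rewrite -G1 -Gt metric_sym (geodesic_mdist gG); clear - atg s0 st t1; lra.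
(* Over its middle third G runs in the limit of P, so there [g n] is within any small multiple of
   [l n] of P. The choice [l n / 9] is a third of the new length [l n / 3], and this length is below
   the near minimum [l n / 2]. *)
have mid u : 1 / 3 <= u <= 2 / 3 -> \forall n \near U,
    within_dist (l n / 9) (P n) (g n (u * l n)).
  move=> u3; have u01 : 0 <= u <= 1 by clear - atg u3; lra.
  have [vu Gu] := GP u u01.
  have Pu : ultralimit UU p r P (G u).
    apply: (gated_convex gP.1 gG (a := s) (b := t)) => //;
      try by clear - atg s0 st t1 s3 t3 u3; lra.
    - by rewrite Gs; exact: ge.1.
    - by rewrite Gt; exact: ge'.1.
  rewrite Gu in Pu; have e0 : 0 < 1 / 9 :> R by clear - atg; lra.
  apply: filterS (ultralimit_near vu Pu e0) => n [q Pq]; rewrite rl => dq.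
  exists q => //; move: dq; rewrite min_l; first by clear - atg; lra.
  rewrite ger_pMl; first by clear - atg u3; lra.
  by have := Sgt1 _ _ (ex_intro _ _ (ex_intro _ _ (fP n).1)); have := ltr0Sn R n; clear - atg; lra.
have h1 : 1 / 3 <= (1 / 3 : R) <= 2 / 3 by clear - atg; lra.
have h2 : 1 / 3 <= (2 / 3 : R) <= 2 / 3 by clear - atg; lra.
have [n [a1 a2]] := filter_ex (filterI (mid _ h1) (mid _ h2)).
have [[PPn gn _ _ av] lmin] := fP n.
have l0 := geodesic_ge0 gn.
have : S n (l n / 3).
  exists (P n), (fun v => g n (1 / 3 * l n + v)); split=> //.
  - have := geodesic_part gn (a := 1 / 3 * l n) (b := 2 / 3 * l n).
    by rewrite (_ : 2 / 3 * l n - 1 / 3 * l n = l n / 3); [apply; clear - atg l0; lra|field].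
  - by rewrite addr0 (_ : l n / 3 / 3 = l n / 9); [|field].
  - by rewrite (_ : 1 / 3 * l n + l n / 3 = 2 / 3 * l n);
      [rewrite (_ : l n / 3 / 3 = l n / 9); [|field]|field].
  - by move=> v vl; apply: av; clear - atg l0 vl; lra.
have := Sgt1 _ _ (ex_intro _ _ (ex_intro _ _ (fP n).1)); have := ltr0Sn R n.
by move=> h3 h4 /lmin; clear - atg h3 h4; lra.
Qed.

End TreeGradedCones.

Definition transversal_bound (R : realType) (X : metricType R) (PP : set (set X))
    (M : R) : Prop :=
  forall P, PP P -> forall l g, geodesic l g -> within_dist (l / 3) P (g 0) ->
  within_dist (l / 3) P (g l) -> exists2 t, 0 <= t <= l & within_dist M P (g t).

(** * Geodesics avoiding a piece, seen in a cone *)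

Section LimitsOfGeodesics.
Context {R : realType} {X : metricType R} {PP : set (set X)}.
Context {U : set_system nat} (UU : UltraFilter U).
Hypothesis nU : nonprincipal U.
Hypothesis atg : asymptotically_tree_graded PP UU.
Context {M : R}.
Hypothesis tM : transversal_bound PP M.
Context {p : nat -> X} {r : nat -> {posnum R}}.
Hypothesis r_oo : (r n)%:num @[n --> \oo] --> +oo.
Notation cone := (asymptotic_cone UU p r).
Notation rr n := (r n)%:num.
Notation vis := (visible (U := U) (p := p) (r := r)).
Notation pt := (cone_pt UU (p := p) (r := r)).
Notation lim P := (ultralimit UU p r P).

Context {l : nat -> R} {g : nat -> R -> X} {Q : nat -> set X}.
Hypothesis gg : \forall n \near U, geodesic (l n) (g n).
Hypothesis v0 : vis (fun n => g n 0).
Hypothesis v1 : vis (fun n => g n (l n)).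
Hypothesis PPQ : \forall n \near U, PP (Q n).

(** By convexity G lies in the limit of Q between t1 and t2. Hence the ends of the middle third of
    this stretch of [g n] are within (t2 - t1) / 9 times the scale of Q, a third of its length, and
    [tM] applies. Taking the middle third also makes the inequalities strict. *)
Lemma limit_meets (G : R -> cone) (L t1 t2 : R) :
  (forall t, 0 <= t <= L ->
      vis (fun n => g n (Num.min (t * rr n) (l n))) /\
      G t = pt (fun n => g n (Num.min (t * rr n) (l n)))) ->
  geodesic L G -> L = mdist (pt (fun n => g n 0)) (pt (fun n => g n (l n))) ->
  0 <= t1 -> t1 < t2 -> t2 <= L -> lim Q (G t1) -> lim Q (G t2) ->
  \forall n \near U, exists t, [/\ t1 * rr n < t, t < t2 * rr n, t < l n &
    within_dist M (Q n) (g n t)].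
Proof.
move=> GP gG LE t10 t12 t2L Q1 Q2.
have gQ := atg_gated atg r_oo PPQ (ex_intro _ _ Q1).
pose s1 := (2 * t1 + t2) / 3; pose s2 := (t1 + 2 * t2) / 3.
have e0 : 0 < (t2 - t1) / 9 by lra.
have close s : s1 <= s <= s2 -> \forall n \near U, s * rr n < l n /\
    within_dist ((t2 - t1) / 9 * rr n) (Q n) (g n (s * rr n)).
  move=> ss; have st : t1 <= s <= t2 by move: ss; rewrite /s1 /s2; lra.
  have Qs : lim Q (G s) by apply: (gated_convex gQ.1 gG (a := t1) (b := t2)) => //; lra.
  have sL : 0 <= s <= L by lra.
  have [vs Gs] := GP _ sL; rewrite Gs in Qs.
  have sD : s < mdist (pt (fun n => g n 0)) (pt (fun n => g n (l n))).
    by rewrite -LE; move: ss; rewrite /s1 /s2; lra.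
  apply: filterS2 (filterI gg (cone_gt v0 v1 sD)) (ultralimit_near vs Qs e0).
  move=> n [gn]; rewrite (geodesic_length gn) => sl.
  by rewrite min_l; [|exact: ltW].
have h1 : s1 <= s1 <= s2 by rewrite /s1 /s2; lra.
have h2 : s1 <= s2 <= s2 by rewrite /s1 /s2; lra.
apply: filterS2 (filterI gg PPQ) (filterI (close _ h1) (close _ h2)).
move=> n [gn Qn] [[l1 c1] [l2 c2]].
have rn : 0 < rr n by [].
have s12 : s2 * rr n - s1 * rr n = (t2 - t1) / 3 * rr n by rewrite /s1 /s2; field.
have r0 : 0 < (t2 - t1) / 3 * rr n by rewrite mulr_gt0//; lra.
have s1r : 0 <= s1 * rr n by rewrite mulr_ge0// ?ltW// /s1; lra.
have ts1 : t1 * rr n < s1 * rr n by rewrite ltr_pM2r// /s1; lra.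
have ts2 : s2 * rr n < t2 * rr n by rewrite ltr_pM2r// /s2; lra.
have s1s2 : s1 * rr n <= s2 * rr n by lra.
have gn' := geodesic_part gn s1r s1s2 (ltW l2).
have dE : (s2 * rr n - s1 * rr n) / 3 = (t2 - t1) / 9 * rr n by rewrite s12; field.
have [|| t tl wt] := tM Qn gn'.
- by rewrite addr0 dE.
- by rewrite (addrC (s1 * _)) subrK dE.
by exists (s1 * rr n + t); split=> //; lra.
Qed.

(** Different gates would give the limit geodesic a whole interval in the limit of Q, and
    [limit_meets] a point of [g n] near Q far from both ends. The margin k allows the ends
    themselves to be near Q. *)
Lemma avoid_gates (k : R) e e' :
  (\forall n \near U, forall t, k < t -> t < l n - k -> ~ within_dist M (Q n) (g n t)) ->
  gate (lim Q) (pt (fun n => g n 0)) e ->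
  gate (lim Q) (pt (fun n => g n (l n))) e' -> e = e'.
Proof.
move=> av ge ge'; apply: contrapT => ee'.
have Q0 : lim Q !=set0 by exists e; exact: ge.1.
have scale_oo := scale_ultra UU nU r_oo.
have gQ := atg_gated atg r_oo PPQ Q0.
have [G [gG G0 G1 GP]] := limit_geodesic UU gg v0 v1.
have [s [t [s0 st tL Gs Gt]]] := gated_geodesic gQ gG G0 G1 ge ge' ee'.
set L := mdist _ _ in gG G1 GP tL.
(* The gaps from 0 to a and from b to t are positive multiples of the scale and absorb k at both
   ends. *)
pose a := (2 * s + t) / 3; pose b := (s + 2 * t) / 3.
have Qab u : s <= u -> u <= t -> lim Q (G u).
  move=> su ut; apply: (gated_convex gQ.1 gG (a := s) (b := t)) => //; rewrite ?Gs ?Gt.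
    exact: ge.1.
  exact: ge'.1.
have Qa : lim Q (G a) by apply: Qab; rewrite /a; lra.
have Qb : lim Q (G b) by apply: Qab; rewrite /b; lra.
have a0 : 0 < a by rewrite /a; lra.
have ab : a < b by rewrite /a /b; lra.
have bt : 0 < t - b by rewrite /b; lra.
have bL : (b + t) / 2 < L by lra.
have bL' : b <= L by lra.
have e0 : 0 < (t - b) / 2 by lra.
have [n [[gn H] [an [[k1 k2] lb]]]] := filter_ex (filterI (filterI gg
  (limit_meets GP gG erefl (ltW a0) ab bL' Qa Qb))
  (filterI av (filterI (filterI (scale_small UU scale_oo k a0) (scale_small UU scale_oo k e0))
  (cone_gt v0 v1 bL)))).
rewrite (geodesic_length gn) in lb.
have [u [au ub ul wu]] := H.
apply: (an u _ _ wu); first exact: le_lt_trans au.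
by move: lb; lra.
Qed.

End LimitsOfGeodesics.

(** * Points close to each other have close projections: the two cones *)

Section Divergence.
Context {R : realType} {X : metricType R} {PP : set (set X)}.
Context {U : set_system nat} (UU : UltraFilter U).
Hypothesis nU : nonprincipal U.
Hypothesis atg : asymptotically_tree_graded PP UU.
Context {M : R}.
Hypothesis M0 : 0 <= M.
Hypothesis tM : transversal_bound PP M.

Section Nearest.
Context {p : nat -> X} {r : nat -> {posnum R}}.
Hypothesis r_oo : (r n)%:num @[n --> \oo] --> +oo.
Notation vis := (visible (U := U) (p := p) (r := r)).
Notation pt := (cone_pt UU (p := p) (r := r)).

Lemma nearest_gate (P : nat -> set X) (x q : nat -> X) (k : R) :
  (\forall n \near U, PP (P n)) -> vis x -> vis q ->
  (\forall n \near U, P n (q n)) ->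
  (\forall n \near U, forall a, P n a -> mdist (x n) (q n) <= mdist (x n) a + k) ->
  gate (ultralimit UU p r P) (pt x) (pt q).
Proof.
move=> PPP vx vq Pq near.
have Lq : ultralimit UU p r P (pt q) by exact: ultralimit_pt.
apply: gate_nearest => //; first exact: (atg_gated atg r_oo PPP (ex_intro _ _ Lq)).1.
move=> _ /ultralimitP[a [va -> Pa]].
have := cone_le_add (c := k) UU (scale_ultra UU nU r_oo) vx vq vx vx vx va.
rewrite mdistxx addr0; apply.
by apply: filterS2 near Pa => n H /H; rewrite mdistxx addr0.
Qed.

End Nearest.

(** If the gates q and q' of [e1] and [e2] in the limit of P differed in the cone, both would lie on
    a geodesic of the limit of Q, against (T1). So q = q'. The gate of this point in the limit of Q
    is [e1] because of [al], and [e2] because of b and [de]; hence [e1] = [e2]. But the scale is the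
    largest of four lengths, and these two coincidences make all four small. *)
Lemma divergence_small_scale (P Q : nat -> set X) (u lb l : nat -> R)
    (al b de : nat -> R -> X) :
  (forall n, n.+1%:R <= mdist (al n 0) (b n 0)) ->
  (\forall n \near U, [/\ PP (P n), PP (Q n), P n <> Q n, P n (al n 0) & P n (b n 0)]) ->
  (\forall n \near U, [/\ geodesic (u n) (al n),
    forall a, P n a -> u n <= mdist (al n (u n)) a + 1,
    within_dist M (Q n) (al n (u n)) &
    forall t, 0 <= t -> t < u n - 1 -> ~ within_dist M (Q n) (al n t)]) ->
  (\forall n \near U, [/\ geodesic (lb n) (b n), b n (lb n) = de n 0 &
    forall t, 0 <= t -> t < lb n - 1 -> ~ within_dist M (Q n) (b n t)]) ->
  (\forall n \near U, [/\ geodesic (l n) (de n), within_dist M (Q n) (de n (l n)) &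
    forall t, 0 <= t -> t < l n - 1 -> ~ within_dist M (Q n) (de n t)]) ->
  (\forall n \near U, [/\
    forall a, P n a -> mdist (de n 0) (b n 0) <= mdist (de n 0) a + 1,
    forall t, 0 <= t <= l n -> M + 1 < t -> ~ within_dist M (P n) (de n t),
    forall a, P n a -> mdist (de n 0) (b n 0) <= 2 * mdist (de n (l n)) a + (M + 1) &
    u n / 2 <= mdist (al n (u n)) (de n (l n))]) -> False.
Proof.
move=> sn H1 H2 H3 H4 H5.
pose s n := mdist (al n 0) (b n 0).
pose f n := Num.max (Num.max (s n) (u n)) (Num.max (lb n) (l n)).
have fle n : [/\ s n <= f n, u n <= f n, lb n <= f n & l n <= f n].
  by rewrite /f !le_max !lexx !orbT.
have fn n : n.+1%:R <= f n by have [h _ _ _] := fle n; exact: le_trans (sn n) h.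
have [r [rf r_oo]] := posnum_seq fn.
have scale_oo := scale_ultra UU nU r_oo.
pose q n := al n 0; pose q' n := b n 0; pose e1 n := al n (u n).
pose y n := de n 0; pose e2 n := de n (l n).
have vq : visible (U := U) (p := q) (r := r) q by exact: visible_base.
have vq' : visible (U := U) (p := q) (r := r) q'.
  apply: (visible_near UU vq (c := 1)); apply: nearW => n.
  by rewrite rf mul1r; case: (fle n).
have ve1 : visible (U := U) (p := q) (r := r) e1.
  apply: (visible_near UU vq (c := 1)); apply: filterS H2 => n [gn _ _ _].
  by rewrite rf mul1r (geodesic_length gn); case: (fle n).
have vbl : visible (U := U) (p := q) (r := r) (fun n => b n (lb n)).
  apply: (visible_near UU vq' (c := 1)); apply: filterS H3 => n [gn _ _].
  by rewrite rf mul1r (geodesic_length gn); case: (fle n).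
have [|vy yE] := @cone_eq_ae _ _ _ UU q r (fun n => b n (lb n)) y vbl.
  by apply: filterS H3 => n [].
have ve2 : visible (U := U) (p := q) (r := r) e2.
  apply: (visible_near UU vy (c := 1)); apply: filterS H4 => n [gn _ _].
  by rewrite rf mul1r (geodesic_length gn); case: (fle n).
have PPP : \forall n \near U, PP (P n) by apply: filterS H1 => n [].
have PPQ : \forall n \near U, PP (Q n) by apply: filterS H1 => n [].
have PQ : \forall n \near U, P n <> Q n by apply: filterS H1 => n [].
have Pq : \forall n \near U, P n (q n) by apply: filterS H1 => n [].
have Pq' : \forall n \near U, P n (q' n) by apply: filterS H1 => n [].
have g_al : \forall n \near U, geodesic (u n) (al n) by apply: filterS H2 => n [].
have g_b : \forall n \near U, geodesic (lb n) (b n) by apply: filterS H3 => n [].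
have g_de : \forall n \near U, geodesic (l n) (de n) by apply: filterS H4 => n [].
set pt := cone_pt UU (p := q) (r := r).
pose LP := ultralimit UU q r P; pose LQ := ultralimit UU q r Q.
have LPq : LP (pt q) by exact: ultralimit_pt.
have LQ1 : LQ (pt e1) by apply: (ultralimit_bounded (c := M) UU scale_oo ve1); apply: filterS H2 => n [].
have LQ2 : LQ (pt e2) by apply: (ultralimit_bounded (c := M) UU scale_oo ve2); apply: filterS H4 => n [].
have gP : gated LP by exact: (atg_gated atg r_oo PPP (ex_intro _ _ LPq)).
have gQ : gated LQ by exact: (atg_gated atg r_oo PPQ (ex_intro _ _ LQ1)).
have gate1 : gate LP (pt e1) (pt q).
  apply: (nearest_gate r_oo (k := 1)) => //; apply: filterS H2 => n [gn H _ _] a /H ul.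
  by have := geodesic_length gn; rewrite metric_sym => uE; rewrite /e1 /q uE.
have gatey : gate LP (pt y) (pt q').
  by apply: (nearest_gate r_oo (k := 1)) => //; apply: filterS H5 => n [].
have gate2 : gate LP (pt e2) (pt q').
  have [f2 gf2] := gP.1 (pt e2).
  suff -> : pt q' = f2 by [].
  apply: (avoid_gates nU atg tM r_oo g_de vy ve2 PPP (k := M + 1) _ gatey gf2).
  apply: filterS H5 => n [_ H _ _] t Mt tl; apply: H => //.
  by apply/andP; split; [have := M0; lra|have := M0; lra].
have qq' : pt q = pt q'.
  apply: contrapT => ne.
  have [k [h [gh h0 hk _]]] := atg_geodesic atg r_oo (Logic.I : setT (pt e1)) (Logic.I : setT (pt e2)).
  have [v [w [v0 vw wk hv hw]]] := gated_geodesic gP gh h0 hk gate1 gate2 ne.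
  have Qh t : 0 <= t <= k -> LQ (h t).
    move=> /andP[t0 tk]; apply: (gated_convex gQ.1 gh (a := 0) (b := k)) => //.
      by rewrite h0.
    by rewrite hk.
  apply: ne; apply: (atg_T1 atg r_oo PPP PPQ PQ).
    by split=> //; rewrite -hv; apply: Qh; lra.
  by split; [exact: ultralimit_pt|rewrite -hw; apply: Qh; lra].
have [f1 gf1] := gQ.1 (pt q).
have f1E1 : f1 = pt e1.
  apply: (avoid_gates nU atg tM r_oo g_al vq ve1 PPQ (k := 1) _ gf1 (gate_id LQ1)).
  by apply: filterS H2 => n [_ _ _ H] t t1 tu; apply: H => //; lra.
have [f2 gf2] := gQ.1 (pt y).
have f2E2 : f2 = pt e2.
  apply: (avoid_gates nU atg tM r_oo g_de vy ve2 PPQ (k := 1) _ gf2 (gate_id LQ2)).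
  by apply: filterS H4 => n [_ _ H] t t1 tu; apply: H => //; lra.
have f12 : f1 = f2.
  have gf2' : gate LQ (pt (fun n => b n (lb n))) f2 by rewrite /pt yE.
  rewrite qq' in gf1.
  apply: (avoid_gates nU atg tM r_oo g_b vq' vbl PPQ (k := 1) _ gf1 gf2').
  by apply: filterS H3 => n [_ _ H] t t1 tu; apply: H => //; lra.
(* In units of the scale: s < 1/20, then u < 2/20 as u / 2 <= d(e1, e2), then lb < 7/20 by the bound
   through 2 d(e2, q), then l < 11/20. *)
have d0 : 0 < 1 / 20 :> R by lra.
have dq : mdist (pt q) (pt q') < 1 / 20 by rewrite qq' mdistxx.
have de12 : mdist (pt e1) (pt e2) < 1 / 20 by rewrite -f1E1 -f2E2 f12 mdistxx.
have [n [[h1 h2] [h3 [h4 [h5 [h6 [h7 h8]]]]]]] := filter_ex (filterI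
  (filterI (cone_lt vq vq' dq) (cone_lt ve1 ve2 de12)) (filterI H5 (filterI g_al
  (filterI H3 (filterI g_de (filterI Pq (scale_small UU scale_oo (M + 1) d0))))))).
have [_ _ H U2] := h3; have {}H := H _ h7.
have := geodesic_length h4; rewrite -/(q n) -/(e1 n) => uE.
have [/geodesic_length lbE bE _] := h5; rewrite bE -/(q' n) -/(y n) metric_sym in lbE.
have := geodesic_length h6; rewrite -/(y n) -/(e2 n) => lE.
have t1 := metric_triangle (e2 n) (e1 n) (q n).
rewrite (metric_sym (e1 n) (q n)) (metric_sym (e2 n) (e1 n)) uE in t1.
have t2 := metric_triangle (y n) (q' n) (e2 n).
have t3 := metric_triangle (q' n) (q n) (e2 n).
rewrite (metric_sym (q' n) (q n)) (metric_sym (q n) (e2 n)) in t3.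
rewrite -/(y n) -/(q' n) -/(e2 n) in H; rewrite -/(e1 n) -/(e2 n) in U2.
have rn : 0 < (r n)%:num by [].
have : f n < (r n)%:num.
  rewrite /f !gt_max -/(s n); apply/andP; split; apply/andP; split.
  - by rewrite /s -/(q n) -/(q' n); lra.
  - by lra.
  - by lra.
  - by lra.
by rewrite rf ltxx.
Qed.

End Divergence.

(* The scale of the cone is the larger of [L] and the distance of [q] and [q'].
   In the limit of P the points [x] and [w] have the gates [q] and [q'], and they
   are closer to each other than to P; hence [q] and [q'] agree in the cone and
   the scale is [L]. If the limit of [al] met every piece at most once near
   [al (L / 4)], this point would separate [q] from [x], although these are joined
   by [b], [de] and a geodesic of the cone avoiding it. *)
Lemma divergence_large_scale (R : realType) (X : metricType R) (PP : set (set X))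
    (U : set_system nat) (UU : UltraFilter U) (M : R)
    (P : nat -> set X) (L lb l : nat -> R)
    (al b de : nat -> R -> X) :
  nonprincipal U -> asymptotically_tree_graded PP UU -> 0 <= M -> transversal_bound PP M ->
  (forall n, n.+1%:R <= mdist (al n 0) (b n 0)) ->
  (forall n, [/\ PP (P n), P n (al n 0) & P n (b n 0)]) ->
  (forall n, [/\ geodesic (L n) (al n), geodesic (lb n) (b n), geodesic (l n) (de n) &
    b n (lb n) = de n 0]) ->
  (forall n a, P n a -> L n <= mdist (al n (L n)) a + 1) ->
  (forall n a, P n a -> mdist (de n 0) (b n 0) <= mdist (de n 0) a + 1) ->
  (forall n t, 0 <= t <= l n -> M + 1 < t -> ~ within_dist M (P n) (de n t)) ->
  (forall n a, P n a -> mdist (de n 0) (b n 0) <= 2 * mdist (de n (l n)) a + (M + 1)) ->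
  (forall n, mdist (al n (L n)) (de n (l n)) <= L n / 2) ->
  (forall n, 1 < L n -> forall t, 0 <= t <= L n / 2 ->
    (forall v, 0 <= v <= l n -> t / 2 < mdist (al n t) (de n v)) /\
    (forall v, 0 <= v <= lb n -> t / 2 < mdist (al n t) (b n v))) ->
  exists Q : nat -> set X, [/\ \forall n \near U, PP (Q n), \forall n \near U, P n <> Q n,
    \forall n \near U, 1 < L n,
    \forall n \near U, exists u, 0 <= u <= L n / 2 /\ within_dist M (Q n) (al n u) &
    \forall n \near U, (exists2 v, 0 <= v <= lb n & within_dist M (Q n) (b n v)) \/
                       (exists2 v, 0 <= v <= l n & within_dist M (Q n) (de n v))].
Proof.
move=> nU atg M0 tM sn H1 H2 xnear ynear dav dnear xw far.
pose s n := mdist (al n 0) (b n 0).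
pose f n := Num.max (s n) (L n).
have fle n : s n <= f n /\ L n <= f n by rewrite /f !le_max !lexx !orbT.
have fn n : n.+1%:R <= f n by exact: le_trans (sn n) (fle n).1.
have [r [rf r_oo]] := posnum_seq fn.
have scale_oo := scale_ultra UU nU r_oo.
pose q n := al n 0; pose q' n := b n 0; pose x n := al n (L n).
pose y n := de n 0; pose w n := de n (l n).
have PPP : \forall n \near U, PP (P n) by apply: nearW => n; have [] := H1 n.
have Pq : \forall n \near U, P n (q n) by apply: nearW => n; have [] := H1 n.
have Pq' : \forall n \near U, P n (q' n) by apply: nearW => n; have [] := H1 n.
have g_al : \forall n \near U, geodesic (L n) (al n) by apply: nearW => n; have [] := H2 n.
have g_b : \forall n \near U, geodesic (lb n) (b n) by apply: nearW => n; have [] := H2 n.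
have g_de : \forall n \near U, geodesic (l n) (de n) by apply: nearW => n; have [] := H2 n.
have vq : visible (U := U) (p := q) (r := r) q by exact: visible_base.
have vq' : visible (U := U) (p := q) (r := r) q'.
  apply: (visible_near UU vq (c := 1)); apply: nearW => n.
  by rewrite rf mul1r; exact: (fle n).1.
have vx : visible (U := U) (p := q) (r := r) x.
  apply: (visible_near UU vq (c := 1)); apply: nearW => n.
  have [gn _ _ _] := H2 n.
  by rewrite rf mul1r (geodesic_length gn); exact: (fle n).2.
have vw : visible (U := U) (p := q) (r := r) w.
  apply: (visible_near UU vx (c := 1)); apply: nearW => n.
  have [/geodesic_ge0 L0 _ _ _] := H2 n.
  by rewrite rf mul1r; have := xw n; have := (fle n).2; rewrite /x /w; clear - L0; lra.
have vy : visible (U := U) (p := q) (r := r) y.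
  apply: (visible_near UU vq' (c := 4)).
  apply: filterS (scale_oo (M + 1)) => n; rewrite rf => Mn.
  have [PPn Pn _] := H1 n; have := dnear n _ Pn.
  have [gn _ _ _] := H2 n; have := geodesic_length gn.
  have := metric_triangle (de n (l n)) (al n (L n)) (al n 0).
  rewrite (metric_sym (al n (L n)) (al n 0)) (metric_sym (de n (l n)) (al n (L n))).
  rewrite (metric_sym (q' n) (y n)) /q' /y; have := xw n; have := (fle n).2; have := geodesic_ge0 gn.
  by clear - Mn; lra.
have vbl : visible (U := U) (p := q) (r := r) (fun n => b n (lb n)).
  have -> : (fun n => b n (lb n)) = y by apply/funext => n; have [] := H2 n.
  exact: vy.
set pt := cone_pt UU (p := q) (r := r).
have blE : pt (fun n => b n (lb n)) = pt y.
  by congr pt; apply/funext => n; have [] := H2 n.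
pose LP := ultralimit UU q r P.
have LPq : LP (pt q) by exact: ultralimit_pt.
have gP : gated LP by exact: (atg_gated atg r_oo PPP (ex_intro _ _ LPq)).
have gatex : gate LP (pt x) (pt q).
  apply: (nearest_gate nU atg r_oo (k := 1)) => //; apply: nearW => n a /xnear ul.
  have [gn _ _ _] := H2 n.
  by have := geodesic_length gn; rewrite metric_sym => uE; rewrite /x /q uE.
have gatey : gate LP (pt y) (pt q').
  by apply: (nearest_gate nU atg r_oo (k := 1)) => //; apply: nearW => n; exact: ynear.
have gatew : gate LP (pt w) (pt q').
  have [f2 gf2] := gP.1 (pt w).
  suff -> : pt q' = f2 by [].
  apply: (avoid_gates nU atg tM r_oo g_de vy vw PPP (k := M + 1) _ gatey gf2).
  apply: nearW => n t Mt tl; apply: dav => //.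
  by apply/andP; split; clear - M0 Mt tl; lra.
have [k [h [gh h0 hk _]]] := atg_geodesic atg r_oo (Logic.I : setT (pt x)) (Logic.I : setT (pt w)).
have kE : k = mdist (pt x) (pt w) by rewrite -h0 -hk (geodesic_length gh).
have k2 : 2 * k <= mdist (pt x) (pt q).
  have := cone_le_add (c := 0) UU scale_oo vx vw vx vw vx vq.
  rewrite -/pt -kE mulr_natl mulr2n; apply; apply: nearW => n.
  have [gn _ _ _] := H2 n; have := geodesic_length gn; have := xw n.
  by rewrite (metric_sym (al n 0)) /x /w /q; clear; lra.
have k0 := geodesic_ge0 gh.
(* Otherwise a geodesic from x to w would pass through q, although its length is at most half of
   d(x, q). *)
have qq' : pt q = pt q'.
  apply: contrapT => ne.
  have [v [v' [v0 vv vk hv hv']]] := gated_geodesic gP gh h0 hk gatex gatew ne.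
  have : mdist (pt x) (pt q) = v
    by rewrite -h0 -hv (geodesic_mdist gh) ?subr0//; exact: le_trans (ltW vv) vk.
  by move: k2 => /[swap] ->; clear - v0 vv vk k0 => k2; lra.
(* As q and q' coincide in the cone, [s n] is below the scale, so the maximum is [L n]. *)
have rL : \forall n \near U, (r n)%:num = L n.
  have d : mdist (pt q) (pt q') < 1 by rewrite qq' mdistxx.
  apply: filterS (cone_lt vq vq' d) => n; rewrite mul1r rf /f /q /q' -/(s n).
  by case: (leP (s n) (L n)) => //; rewrite ltxx.
have dqx : mdist (pt q) (pt x) = 1.
  apply/eqP; rewrite eq_le; apply/andP; split.
    apply: cone_le => //; apply: filterS2 rL g_al => n -> /geodesic_length.
    by rewrite /q /x => ->; rewrite mul1r.
  apply: cone_ge => //; apply: filterS2 rL g_al => n -> /geodesic_length.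
  by rewrite /q /x => ->; rewrite mul1r.
have k12 : k <= 1 / 2 by move: k2; rewrite metric_sym dqx; clear; lra.
have [A [gA A0 A1 AP]] := limit_geodesic UU g_al vq vx.
have [B [gB B0 B1 BP]] := limit_geodesic UU g_b vq' vbl.
have [E [gE E0 E1 EP]] := limit_geodesic UU g_de vy vw.
rewrite -/pt dqx in gA A1 AP.
have {}A0 : A 0 = pt q by [].
have {}A1 : A 1 = pt x by [].
have {}B0 : B 0 = pt q' by [].
have {}E0 : E 0 = pt y by [].
have {}B1 : B (mdist (pt q') (pt (fun n => b n (lb n)))) = pt (fun n => b n (lb n)) by [].
have {}E1 : E (mdist (pt y) (pt w)) = pt w by [].
have L1 : \forall n \near U, 1 < L n.
  by apply: filterS2 rL (scale_oo 2) => n ->; apply: lt_le_trans; rewrite ltr1n.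
(* [A (1 / 4)] is at distance 3/4 from x, out of reach of h, which starts at x and has length at
   most 1/2. *)
have hfar t : 0 <= t <= k -> A (1 / 4) <> h t.
  move=> tk AE; have := metric_triangle (pt q) (h t) (pt x).
  rewrite dqx -h0 (metric_sym (h t) (h 0)) (geodesic_mdist gh); [|clear - tk; lra..].
  by rewrite -AE -A0 (geodesic_mdist gA); clear - tk k12; lra.
have q1 : 0 <= (1 / 4 : R) <= 1 by clear; lra.
have [vA AE] := AP _ q1.
have min4 n : (r n)%:num = L n -> 1 < L n ->
    Num.min (1 / 4 * (r n)%:num) (L n) = L n / 4.
  by move=> rn Ln; rewrite min_l rn; clear - Ln; lra.
have bfar t : 0 <= t <= mdist (pt q') (pt (fun n => b n (lb n))) -> A (1 / 4) <> B t.
  move=> tk; have [vB ->] := BP _ tk; rewrite AE => /esym AB.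
  suff : 1 / 8 <= mdist (pt (fun n => al n (Num.min (1 / 4 * (r n)%:num) (L n))))
      (pt (fun n => b n (Num.min (t * (r n)%:num) (lb n)))).
    by rewrite -AB mdistxx; clear; lra.
  apply: cone_ge => //; apply: filterS2 rL L1 => n rn Ln; rewrite (min4 n)//.
  have L4 : 0 <= L n / 4 <= L n / 2 by clear - Ln; lra.
  have [_ gb _ _] := H2 n; have lb0 := geodesic_ge0 gb.
  have tr : 0 <= t * (r n)%:num by rewrite mulr_ge0//; case/andP: tk.
  have := (far n Ln _ L4).2 (Num.min (t * (r n)%:num) (lb n)).
  rewrite rn; rewrite rn in tr.
  have -> : 0 <= Num.min (t * L n) (lb n) <= lb n.
    by case: (leP (t * L n) (lb n)); clear - tr lb0; lra.
  by move=> /(_ isT); clear - Ln; lra.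
have dfar t : 0 <= t <= mdist (pt y) (pt w) -> A (1 / 4) <> E t.
  move=> tk; have [vE ->] := EP _ tk; rewrite AE => /esym AB.
  suff : 1 / 8 <= mdist (pt (fun n => al n (Num.min (1 / 4 * (r n)%:num) (L n))))
      (pt (fun n => de n (Num.min (t * (r n)%:num) (l n)))).
    by rewrite -AB mdistxx; clear; lra.
  apply: cone_ge => //; apply: filterS2 rL L1 => n rn Ln; rewrite (min4 n)//.
  have L4 : 0 <= L n / 4 <= L n / 2 by clear - Ln; lra.
  have [_ _ gd _] := H2 n; have l0 := geodesic_ge0 gd.
  have tr : 0 <= t * (r n)%:num by rewrite mulr_ge0//; case/andP: tk.
  have := (far n Ln _ L4).1 (Num.min (t * (r n)%:num) (l n)).
  rewrite rn; rewrite rn in tr.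
  have -> : 0 <= Num.min (t * L n) (l n) <= l n.
    by case: (leP (t * L n) (l n)); clear - tr l0; lra.
  by move=> /(_ isT); clear - Ln; lra.
have [Q [a [c [PPQ a0 ac c2 [Qa Qc]]]]] : exists (Q : nat -> set X) a c,
    [/\ \forall n \near U, PP (Q n), 1 / 8 <= a, a < c, c <= 3 / 8 &
     ultralimit UU q r Q (A a) /\ ultralimit UU q r Q (A c)].
  apply: contrapT => nQ.
  have i1 : 0 <= 1 / 8 :> R by clear; lra.
  have i2 : 1 / 8 < 1 / 4 :> R by clear; lra.
  have i3 : 1 / 4 < 3 / 8 :> R by clear; lra.
  have i4 : 3 / 8 <= 1 :> R by clear; lra.
  have [Q a c PPQ a1 ac c3 Qa Qc|S [S1 S2 S3]] := atg_separation atg r_oo gA i1 i2 i3 i4.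
    by apply: nQ; exists Q, a, c.
  have Sq : S (pt q) by rewrite -A0; apply: S1; clear; lra.
  have Sx : ~ S (pt x) by rewrite -A1; apply: S2; clear; lra.
  apply: Sx; rewrite -h0; apply/(S3 _ _ gh).
    by move=> t tk; apply/nesym/hfar.
  rewrite hk -E1; apply/(S3 _ _ gE).
    by move=> t tk; apply/nesym/dfar.
  rewrite E0 -blE -B1; apply/(S3 _ _ gB).
    by move=> t tk; apply/nesym/bfar.
  by rewrite B0 -qq'.
pose LQ := ultralimit UU q r Q.
have gQ : gated LQ by exact: (atg_gated atg r_oo PPQ (ex_intro _ _ Qa)).
exists Q; split=> //.
(* The gate of x in the limit of P is q, at distance 1, so this limit cannot contain [A a], which is
   nearer to x. *)
- apply: contrapT => /(ultra_not UU) PQ.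
  have PQE : LP = LQ.
    by apply: ultralimit_ae; apply: filterS PQ => n /contrapT.
  have := gatex.2 _; rewrite PQE => /(_ _ Qa).
  rewrite (metric_sym (pt x)) dqx -A1 (metric_sym (A 1)) (geodesic_mdist gA); [|clear - a0 ac c2; lra..].
  by have := mdist_ge0 (pt q) (A a); clear - a0; lra.
- have a00 : 0 <= a by clear - a0; lra.
  have c1 : c <= 1 by clear - c2; lra.
  apply: filterS2 rL (limit_meets atg tM r_oo g_al vq vx PPQ AP gA (esym dqx) a00 ac c1 Qa Qc).
  move=> n rLn; have : 0 < (r n)%:num by [].
  rewrite rLn => Ln0 [u [au uc uL wu]]; exists u; split=> //.
  have h1 : 0 <= a * L n by rewrite mulr_ge0// ltW.
  have h2 : c * L n <= 3 / 8 * L n by rewrite ler_pM2r.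
  by clear - au uc h1 h2 Ln0; lra.
(* If b and [de] both avoided Q, then q, y and w would have one gate e in the limit of Q. Since
   [A a] and [A c] are in this limit, x has a different gate, so h passes through e and d(x, e) <=
   1/2. But d(q, e) <= a < 3/8 makes d(x, e) larger than 5/8. *)
- apply: contrapT => /(ultra_not UU) nQ.
  have [e ge] := gQ.1 (pt q); have [f1 gf1] := gQ.1 (pt y).
  have [f2 gf2] := gQ.1 (pt w); have [e' ge'] := gQ.1 (pt x).
  have e1 : e = f1.
    have gf1' : gate LQ (pt (fun n => b n (lb n))) f1 by rewrite blE.
    rewrite qq' in ge.
    apply: (avoid_gates nU atg tM r_oo g_b vq' vbl PPQ (k := 0) _ ge gf1').
    apply: filterS nQ => n H t t0; rewrite subr0 => tl wt; apply: H; left.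
    by exists t => //; rewrite !ltW.
  have e12 : f1 = f2.
    apply: (avoid_gates nU atg tM r_oo g_de vy vw PPQ (k := 0) _ gf1 gf2).
    apply: filterS nQ => n H t t0; rewrite subr0 => tl wt; apply: H; right.
    by exists t => //; rewrite !ltW.
  rewrite -{}e12 -{}e1 in gf2.
  have dqe := ge.2 _ Qa; have dxe := ge'.2 _ Qc.
  have a01 : 0 <= a <= 1 /\ 0 <= c <= 1 by clear - a0 ac c2; lra.
  rewrite -A0 (geodesic_mdist gA) in dqe; [|clear - a01; lra..].
  rewrite -A1 (metric_sym (A 1)) (metric_sym (A 1)) (geodesic_mdist gA) in dxe; [|clear - a01; lra..].
  have ne : e' <> e.
    move=> ee; have := metric_triangle (A 0) e (A 1).
    have := mdist_ge0 e (A a); have := mdist_ge0 e' (A c).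
    rewrite (geodesic_mdist gA) ?lexx ?ler01// ee in dxe *.
    by clear - dqe dxe ac; lra.
  have [v [v' [v0 vv vk hv hv']]] := gated_geodesic gQ gh h0 hk ge' gf2 ne.
  have : mdist (A 1) e = v' by rewrite A1 -h0 -hv' (geodesic_mdist gh) ?subr0//; clear - v0 vv; lra.
  have := metric_triangle (A 0) e (A 1).
  have := mdist_ge0 e (A a).
  rewrite (metric_sym e (A 1)) (geodesic_mdist gA) ?lexx ?ler01// => h1 h2 h3.
  by clear - h1 h2 h3 dqe vk k12 a0 ac c2; lra.
Qed.

Lemma geodesic_prefix (R : realType) (X : metricType R) (l t : R) (g : R -> X) :
  geodesic l g -> 0 <= t <= l -> geodesic t g.
Proof.
move=> [l0 H] tl; split=> [|s u]; first lra.
by rewrite !in_itv/= => st ut; apply: H; rewrite in_itv/=; lra.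
Qed.

Section BoundedDivergence.
Context {R : realType} {X : metricType R} {PP : set (set X)}.
Context {U : set_system nat} (UU : UltraFilter U).
Hypothesis nU : nonprincipal U.
Hypothesis geoX : geodesic_space X.
Hypothesis atg : asymptotically_tree_graded PP UU.
Context {M : R}.
Hypothesis M0 : 0 <= M.
Hypothesis tM : transversal_bound PP M.

(* [al] leads from P to a point near the end of [de], and q' is a projection *)
(* to P of the start of [de].                                                *)
Definition divergent (P : set X) (q' : X) (L l : R) (al de : R -> X) : Prop :=
  [/\ [/\ PP P, P (al 0), P q', geodesic L al & geodesic l de],
      forall a, P a -> L <= mdist (al L) a + 1,
      forall a, P a -> mdist (de 0) q' <= mdist (de 0) a + 1,
      mdist (al L) (de l) <= L / 2 &
      forall t, 0 <= t <= l -> (M + 1 < t -> ~ within_dist M P (de t)) /\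
        forall a, P a -> mdist (de 0) q' <= 2 * mdist (de t) a + (M + 1)].

(** Cutting both paths yields a shorter configuration with the same two projections, which near
    minimality of the length will forbid. *)
Lemma divergent_prefix P q' L l al de t v : divergent P q' L l al de ->
  0 <= t <= L -> 0 <= v <= l -> mdist (al t) (de v) <= t / 2 ->
  divergent P q' t v al de.
Proof.
move=> [[PPP P0 Pq' ga gd] H1 H2 H3 H4] tL vl tv.
have ga' := geodesic_prefix ga tL; have gd' := geodesic_prefix gd vl.
split=> //.
  move=> a Pa; have := H1 a Pa; have := metric_triangle (al L) (al t) a.
  by rewrite (metric_sym (al L) (al t)) (geodesic_mdist ga); lra.
by move=> w wv; apply: H4; lra.
Qed.

Lemma projection_prefix (P : set X) q' (b : R -> X) lb v : geodesic lb b ->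
  b 0 = q' -> (forall a, P a -> mdist (b lb) q' <= mdist (b lb) a + 1) ->
  0 <= v <= lb -> forall a, P a -> mdist (b v) q' <= mdist (b v) a + 1.
Proof.
move=> gb b0 H vl a Pa; have := H a Pa; have := metric_triangle (b lb) (b v) a.
have e1 : mdist (b lb) (b 0) = lb by rewrite metric_sym (geodesic_length gb).
have e2 : mdist (b v) (b 0) = v by rewrite metric_sym (geodesic_mdist gb); lra.
have e3 : mdist (b lb) (b v) = lb - v by rewrite metric_sym (geodesic_mdist gb); lra.
by rewrite -b0 e1 e2 e3; lra.
Qed.

(** Lets a point of the geodesic from q' to the start of [de] take over the role of [de], as a
    constant path. *)
Lemma divergent_point P q' L l al de t x : divergent P q' L l al de ->
  0 <= t <= L -> mdist (al t) x <= t / 2 ->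
  (forall a, P a -> mdist x q' <= mdist x a + 1) ->
  divergent P q' t 0 al (fun=> x).
Proof.
move=> [[PPP P0 Pq' ga gd] H1 H2 H3 H4] tL tx H.
have ga' := geodesic_prefix ga tL; have m0 := M0.
split=> //; first by split=> //; exact: geodesic_cst.
  move=> a Pa; have := H1 a Pa; have := metric_triangle (al L) (al t) a.
  by rewrite (metric_sym (al L) (al t)) (geodesic_mdist ga); lra.
move=> w w0; split=> [mw|a /H]; first by lra.
by have := mdist_ge0 x a; lra.
Qed.

Lemma first_entrance (Q : set X) (g : R -> X) (l : R) :
  (exists2 v, 0 <= v <= l & within_dist M Q (g v)) ->
  exists2 v, 0 <= v <= l & within_dist M Q (g v) /\
    forall t, 0 <= t -> t < v - 1 -> ~ within_dist M Q (g t).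
Proof.
move=> [v0 v0l wv0].
have [||v [vl wv] vmin] := @near_min R [set v | 0 <= v <= l /\ within_dist M Q (g v)] 0.
- by exists v0.
- by move=> t [/andP[]].
exists v => //; split=> // t t0 tv wt.
have : v - 1 < t by apply: vmin; split=> //; lra.
by lra.
Qed.

Lemma bounded_divergence : exists2 C : R, 0 <= C & forall P q' L l al de,
  divergent P q' L l al de -> mdist (al 0) q' <= C.
Proof.
apply: contrapT => nC.
pose S n := [set L | exists P q' l al de,
  divergent P q' L l al de /\ n.+1%:R < mdist (al 0) q'].
have S0 n : S n !=set0.
  apply: contrapT => nS; apply: nC; exists n.+1%:R => // P q' L l al de div.
  rewrite leNgt; apply/negP => lt; apply: nS.
  by exists L, P, q', l, al, de.
have Spos n L : S n L -> 0 <= L.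
  by move=> [P [q' [l [al [de [[[_ _ _ /geodesic_ge0 L0 _] _ _ _ _] _]]]]]].
have /choice[f fP] n : exists f : R * set X * X * R * (R -> X) * (R -> X),
    let: (L, P, q', l, al, de) := f in
    [/\ divergent P q' L l al de, n.+1%:R < mdist (al 0) q' &
     L <= 1 \/ forall L', S n L' -> L / 2 < L'].
  have [L [P [q' [l [al [de [div lt]]]]]] H] := near_halving (S0 n) (Spos n).
  by exists (L, P, q', l, al, de).
pose L n := (f n).1.1.1.1.1; pose P n := (f n).1.1.1.1.2; pose q' n := (f n).1.1.1.2.
pose l n := (f n).1.1.2; pose al n := (f n).1.2; pose de n := (f n).2.
have {}fP n : [/\ divergent (P n) (q' n) (L n) (l n) (al n) (de n),
    n.+1%:R < mdist (al n 0) (q' n) & L n <= 1 \/ forall L', S n L' -> L n / 2 < L'].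
  by have := fP n; rewrite /L /P /q' /l /al /de; case: (f n) => [[[[[]]]]].
have div n : divergent (P n) (q' n) (L n) (l n) (al n) (de n) by have [] := fP n.
have [lb [b bP]] := geodesic_choice geoX q' (fun n => de n 0).
have bnear n a : P n a -> mdist (b n (lb n)) (q' n) <= mdist (b n (lb n)) a + 1.
  by have [_ _ ->] := bP n; have [_ _ H _ _] := div n; exact: H.
(* If [al t] with t <= L / 2 came within t / 2 of [de] or of b, cutting there would give a
   configuration of length t, too short for the near minimum. *)
have far n : 1 < L n -> forall t, 0 <= t <= L n / 2 ->
    (forall v, 0 <= v <= l n -> t / 2 < mdist (al n t) (de n v)) /\
    (forall v, 0 <= v <= lb n -> t / 2 < mdist (al n t) (b n v)).
  move=> L1 t tL; have [_ lt] := fP n; case=> [|Lmin]; first by lra.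
  have tL' : 0 <= t <= L n by lra.
  have nS : ~ S n t by move=> /Lmin; lra.
  split=> v vl; rewrite ltNge; apply/negP => tv; apply: nS.
    exists (P n), (q' n), v, (al n), (de n); split=> //.
    exact: divergent_prefix (div n) tL' vl tv.
  exists (P n), (q' n), 0, (al n), (fun=> b n v); split=> //.
  apply: divergent_point (div n) tL' tv _ => a Pa.
  have [gb b0 bl] := bP n; apply: (projection_prefix gb b0 _ vl Pa) => a' Pa'.
  exact: bnear.
have [||||||||Q [PPQ PQ L1 HA HB]] := divergence_large_scale nU atg M0 tM
  (P := P) (L := L) (lb := lb) (l := l) (al := al) (b := b) (de := de) _ _ _ _ _ _ _ _ far.
- by move=> n; have [_ /ltW lt _] := fP n; have [_ -> _] := bP n.
- by move=> n; have [[? ? ? _ _] _ _ _ _] := div n; have [_ -> _] := bP n.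
- by move=> n; have [[_ _ _ ? ?] _ _ _ _] := div n; have [? _ ?] := bP n.
- by move=> n; have [] := div n.
- by move=> n a Pa; have [_ -> <-] := bP n; exact: bnear.
- by move=> n t tl; have [_ _ _ _ H] := div n; exact: (H t tl).1.
- move=> n a Pa; have [[_ _ _ _ gd] _ _ _ H] := div n; have [_ -> _] := bP n.
  by apply: (H _ _).2 => //; rewrite lexx (geodesic_ge0 gd).
- by move=> n; have [] := div n.
pose good n (d : R * R * R * (R -> X)) := let: (u, k, m, c) := d in
  [/\ [/\ 0 <= u <= L n / 2, within_dist M (Q n) (al n u) &
       forall t, 0 <= t -> t < u - 1 -> ~ within_dist M (Q n) (al n t)],
      [/\ 0 <= k <= lb n, b n k = c 0 &
       forall t, 0 <= t -> t < k - 1 -> ~ within_dist M (Q n) (b n t)],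
      [/\ geodesic m c, within_dist M (Q n) (c m) &
       forall t, 0 <= t -> t < m - 1 -> ~ within_dist M (Q n) (c t)] &
      [/\ forall t, 0 <= t <= m -> M + 1 < t -> ~ within_dist M (P n) (c t),
          forall a, P n a -> mdist (c 0) (b n 0) <= 2 * mdist (c m) a + (M + 1) &
          u / 2 <= mdist (al n u) (c m)]].
have [d dP] : exists d, \forall n \near U, good n (d n).
  apply: (@ultra_choice _ UU _ (fun=> (0, 0, 0, fun=> b 0%N 0)) good).
  apply: filterS2 L1 (filterI HA HB) => n L1 [[u0 [u0L wu0]] HBn].
  have [u uL [wu umin]] := first_entrance (ex_intro2 _ _ u0 u0L wu0).
  have [far1 far2] := far n L1 _ uL.
  have [gb b0 bl] := bP n; have lb0 := geodesic_ge0 gb; have m0 := M0.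
  (* If b already comes near Q, it is cut there and [de] is replaced by a constant path; otherwise b
     is kept whole and [de] is cut at its entrance. *)
  have [/first_entrance[v vl [wv vmin]]|nb] :=
      pselect (exists2 v, 0 <= v <= lb n & within_dist M (Q n) (b n v)).
    exists (u, v, 0, fun=> b n v); split=> //.
    - split=> // [|t]; first exact: geodesic_cst.
      by lra.
    - split; [by move=> t t0; lra| |by apply/ltW/far2].
      move=> a Pa; rewrite b0.
      have := projection_prefix gb b0 (bnear n) vl Pa.
      by have := mdist_ge0 (b n v) a; lra.
  have [//|/first_entrance[v vl [wv vmin]]] := HBn.
  have [[_ _ _ _ gd] _ _ _ H] := div n.
  exists (u, lb n, v, de n); split=> //.
  - split=> //; first by rewrite lexx lb0.
    by move=> t t0 tl wt; apply: nb; exists t => //; lra.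
  - by split=> //; exact: geodesic_prefix gd vl.
  - split; [|by move=> a Pa; rewrite b0; exact: (H _ vl).2|by apply/ltW/far1].
    by move=> t tv; apply: (H _ _).1; lra.
pose u n := (d n).1.1.1; pose k n := (d n).1.1.2; pose m n := (d n).1.2; pose c n := (d n).2.
have {}dP : \forall n \near U, good n (u n, k n, m n, c n).
  by apply: filterS dP => n; rewrite /u /k /m /c; case: (d n) => [[[]]].
apply: (divergence_small_scale nU atg M0 tM (P := P) (Q := Q) (u := u) (lb := k)
  (l := m) (al := al) (b := b) (de := c)).
- by move=> n; have [_ /ltW lt _] := fP n; have [_ -> _] := bP n.
- apply: filterS2 PPQ PQ => n ? ?.
  by have [[? ? ? _ _] _ _ _ _] := div n; have [_ -> _] := bP n.
- apply: filterS dP => n [[uL wu umin] _ _ _].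
  have [[_ _ _ ga _] H _ _ _] := div n; have L0 := geodesic_ge0 ga.
  have uL' : 0 <= u n <= L n by lra.
  split=> //; first exact: geodesic_prefix ga uL'.
  move=> a Pa; have := H a Pa; have := metric_triangle (al n (L n)) (al n (u n)) a.
  by rewrite (metric_sym (al n (L n)) (al n (u n))) (geodesic_mdist ga); lra.
- apply: filterS dP => n [_ [kl ? ?] _ _]; have [gb _ _] := bP n.
  by split=> //; exact: geodesic_prefix gb kl.
- by apply: filterS dP => n [].
- apply: filterS dP => n [_ [kl bk _] _ [? ? ?]]; split=> //.
  have [gb b0 _] := bP n; rewrite -bk b0.
  exact: projection_prefix gb b0 (bnear n) kl.
Qed.

End BoundedDivergence.

(** * Nearly nearest points form an almost-projection system *)

Section Projections.
Context {R : realType} {X : metricType R} {PP : set (set X)}.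
Context {U : set_system nat} (UU : UltraFilter U).
Hypothesis nU : nonprincipal U.
Hypothesis geoX : geodesic_space X.
Hypothesis PPne : forall P, PP P -> P !=set0.
Hypothesis atg : asymptotically_tree_graded PP UU.
Context {M : R}.
Hypothesis M1 : 1 <= M.
Hypothesis tM : transversal_bound PP M.

Lemma nearest_projection : exists prj : set X -> X -> X, forall P x, PP P ->
  P (prj P x) /\ forall a, P a -> mdist x (prj P x) <= mdist x a + 1.
Proof.
have /choice[prj H] (Px : set X * X) : exists y, PP Px.1 ->
    Px.1 y /\ forall a, Px.1 a -> mdist Px.2 y <= mdist Px.2 a + 1.
  case: Px => P x /=; have [PPP|nP] := pselect (PP P); last by exists x.
  have [a0 Pa0] := PPne PPP.
  have [||_ [y Py <-] ymin] := @near_min R [set mdist x a | a in P] 0.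
  - by exists (mdist x a0), a0.
  - by move=> _ [a _ <-]; exact: mdist_ge0.
  exists y => _; split=> // a Pa.
  have : mdist x y - 1 < mdist x a by apply: ymin; exists a.
  by lra.
by exists (fun P x => prj (P, x)) => P x; exact: (H (P, x)).
Qed.

Lemma quasi_convex Q l g t : PP Q -> geodesic l g -> Q (g 0) -> Q (g l) ->
  0 <= t <= l -> within_dist (4 * M + 5) Q (g t).
Proof.
move=> PPQ gg Q0 Ql tl; have m1 := M1.
have wmem x : Q x -> within_dist M Q x by move=> Qx; exists x; rewrite // mdistxx; lra.
have [||a [al wa] amax] := @near_max R [set v | 0 <= v <= t /\ within_dist M Q (g v)] t.
- by exists 0; split; [lra|exact: wmem].
- by move=> v [/andP[]].
have [||b [bl wb] bmin] := @near_min R [set v | t <= v <= l /\ within_dist M Q (g v)] t.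
- by exists l; split; [lra|exact: wmem].
- by move=> v [/andP[]].
have [qa Qqa da] := wa; have [qb Qqb db] := wb.
(* The ends of [a + 1, b - 1] are within M + 1 of Q. Once b - a >= 3 M + 5 this is at most a third
   of the length, so [tM] gives a visit near Q between a + 1 and b - 1, against the choice of a and
   b. The bound 4 M + 5 adds the distance M of [g a] from Q. *)
have ab : b - a < 3 * M + 5.
  rewrite ltNge; apply/negP => abM.
  have a1 : 0 <= a + 1 by lra.
  have ab1 : a + 1 <= b - 1 by lra.
  have bl1 : b - 1 <= l by lra.
  have gab := geodesic_part gg a1 ab1 bl1.
  have [|| v vl wv] := tM PPQ gab.
  - exists qa => //; have := metric_triangle (g (a + 1 + 0)) (g a) qa.
    by rewrite (metric_sym _ (g a)) (geodesic_mdist gg); lra.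
  - exists qb => //; have := metric_triangle (g (a + 1 + (b - 1 - (a + 1)))) (g b) qb.
    by rewrite (geodesic_mdist gg); lra.
  have [vt|tv] := leP (a + 1 + v) t.
    have : a + 1 + v < a + 1 by apply: amax; split=> //; lra.
    by lra.
  have : b - 1 < a + 1 + v by apply: bmin; split=> //; lra.
  by lra.
exists qa => //; have := metric_triangle (g t) (g a) qa.
by rewrite (metric_sym (g t) (g a)) (geodesic_mdist gg); lra.
Qed.

Context {prj : set X -> X -> X}.
Hypothesis prjP : forall P x, PP P ->
  P (prj P x) /\ forall a, P a -> mdist x (prj P x) <= mdist x a + 1.
Context {C : R}.
Hypothesis bdd : forall P q' L l al de,
  @divergent R X PP M P q' L l al de -> mdist (al 0) q' <= C.

(** A configuration in which [al] ends exactly at the end of [de], so that [al 0] and q' are the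
    projections of the two ends of [de]. *)
Lemma projection_along P l de : PP P -> geodesic l de ->
  (forall t, 0 <= t <= l -> M + 1 < t -> ~ within_dist M P (de t)) ->
  (forall t a, 0 <= t <= l -> P a ->
     mdist (de 0) (prj P (de 0)) <= 2 * mdist (de t) a + (M + 1)) ->
  mdist (prj P (de l)) (prj P (de 0)) <= C.
Proof.
move=> PPP gd av cl.
have [L [al [ga a0 aL _]]] := geoX (Logic.I : setT (prj P (de l))) (Logic.I : setT (de l)).
have [Px xmin] := prjP (de l) PPP; have [Py ymin] := prjP (de 0) PPP.
rewrite -a0; apply: (bdd (L := L) (l := l) (de := de) (P := P)).
split=> //.
- by rewrite a0.
- move=> a Pa; rewrite -{1}(geodesic_length ga) a0 aL metric_sym; exact: xmin.
- by rewrite aL mdistxx; have := geodesic_ge0 ga; lra.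
- by move=> t tl; split=> [|a Pa]; [exact: av|exact: cl].
Qed.

Lemma projection_within P x : PP P -> within_dist M P x -> mdist x (prj P x) <= M + 1.
Proof.
by move=> PPP [a Pa xa]; have := (prjP x PPP).2 _ Pa; lra.
Qed.

(** After its last visit (up to 1) to the M-neighbourhood of P the geodesic satisfies
    [projection_along], which compares the projection of its end with that of the point of last
    visit; the latter is within M + 1 of its projection. *)
Lemma projection_last_exit P l g : PP P -> geodesic l g ->
  (exists2 t, 0 <= t <= l & within_dist M P (g t)) ->
  exists2 u, 0 <= u <= l & mdist (g u) (prj P (g l)) <= C + M + 1 /\
    within_dist M P (g u).
Proof.
move=> PPP gg [t0 t0l wt0].
have [||u [ul wu] umax] := @near_max R [set v | 0 <= v <= l /\ within_dist M P (g v)] l.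
- by exists t0.
- by move=> v [/andP[]].
have gu : geodesic (l - u) (fun s => g (u + s)) by apply: (geodesic_part gg); lra.
have m1 := M1; have pu := projection_within PPP wu.
have := projection_along PPP gu.
rewrite (addrC u (l - u)) subrK addr0 => H.
exists u => //; split=> //.
have : mdist (prj P (g l)) (prj P (g u)) <= C.
  apply: H => [t tl Mt wt|t a tl Pa].
    have : u + t < u + 1 by apply: umax; split=> //; lra.
    by lra.
  by have := mdist_ge0 (g (u + t)) a; lra.
have := metric_triangle (g u) (prj P (g u)) (prj P (g l)).
by rewrite (metric_sym (prj P (g u))); lra.
Qed.

(** A geodesic from a to x passes within C + M + 1 of the projection of x; the detour through the
    projection costs this twice. *)
Lemma projection_AP1 P x a : PP P -> P a ->
  mdist x (prj P x) + mdist (prj P x) a <= mdist x a + 2 * (C + M + 1).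
Proof.
move=> PPP Pa; have m1 := M1.
have [l [g [gg ga gx _]]] := geoX (Logic.I : setT a) (Logic.I : setT x).
have l0 := geodesic_ge0 gg.
have [|u ul [du _]] := projection_last_exit PPP gg.
  by exists 0; [lra|exists a => //; rewrite ga mdistxx; lra].
rewrite gx in du; set y := prj P x in du *.
have := metric_triangle x (g u) y; have := metric_triangle y (g u) a.
have e1 : mdist x (g u) = l - u by rewrite -gx metric_sym (geodesic_mdist gg); lra.
have e2 : mdist (g u) a = u by rewrite -ga metric_sym (geodesic_mdist gg); lra.
have e3 : mdist x a = l by rewrite -gx -ga metric_sym (geodesic_length gg).
by rewrite (metric_sym y (g u)) e1 e2 e3; lra.
Qed.

(** On a geodesic from y to x the point at parameter t is at least t away from P. Hence it leaves
    the M-neighbourhood of P after M, and the distance of y to P is at most twice that of any of its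
    points: both conditions of [projection_along]. *)
Lemma projection_AP2 P x y : PP P -> (forall a, P a -> mdist x y <= mdist x a) ->
  mdist (prj P x) (prj P y) <= C.
Proof.
move=> PPP xy; have m1 := M1.
have [l [g [gg gy gx _]]] := geoX (Logic.I : setT y) (Logic.I : setT x).
have far t a : 0 <= t <= l -> P a -> t <= mdist (g t) a.
  move=> tl /xy; rewrite -gx -gy (metric_sym (g l) (g 0)) (geodesic_length gg).
  have := metric_triangle (g l) (g t) a.
  by rewrite (metric_sym (g l) (g t)) (geodesic_mdist gg); lra.
rewrite -gx -gy; apply: projection_along => // [t tl Mt [a Pa ta]|t a tl Pa].
  by have := far _ _ tl Pa; lra.
have := (prjP (g 0) PPP).2 _ Pa; have := far _ _ tl Pa.
have := metric_triangle (g 0) (g t) a; rewrite (geodesic_mdist gg); [|lra..].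
by lra.
Qed.

(** Started at a point nearly closest to P, the two legs towards the ends satisfy the half-distance
    condition of [projection_along]; each costs C. *)
Lemma projection_missing P l g : PP P -> geodesic l g ->
  (forall t, 0 <= t <= l -> ~ within_dist M P (g t)) ->
  mdist (prj P (g 0)) (prj P (g l)) <= 2 * C.
Proof.
move=> PPP gg miss; have m1 := M1; have l0 := geodesic_ge0 gg.
pose phi t := mdist (g t) (prj P (g t)).
have [||_ [t0 t0l <-] tmin] := @near_min R [set phi t | t in [set t | 0 <= t <= l]] 0.
- by exists (phi 0), 0 => //=; lra.
- by move=> _ [t _ <-]; exact: mdist_ge0.
have {}tmin t a : 0 <= t <= l -> P a -> phi t0 <= mdist (g t) a + 2.
  move=> tl Pa; have := (prjP (g t) PPP).2 _ Pa.
  have : phi t0 - 1 < phi t by apply: tmin; exists t.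
  by rewrite /phi; lra.
have far t a : 0 <= t <= l -> P a -> M < mdist (g t) a.
  by move=> tl Pa; rewrite ltNge; apply/negP => ta; apply: (miss t tl); exists a.
rewrite /= in t0l.
have leg s : 0 <= s <= l -> mdist (prj P (g s)) (prj P (g t0)) <= C.
  move=> sl; have [h [gh h0 hE hP]] := geodesic_sub gg t0l sl.
  rewrite -h0 -hE; apply: projection_along => // [t tl _|t a tl Pa].
    by have [v [vl _ ->]] := hP t tl; exact: miss.
  have [v [vl _ ->]] := hP t tl; rewrite h0.
  by have := tmin _ _ vl Pa; have := far _ _ vl Pa; rewrite /phi; lra.
have i0 : 0 <= (0 : R) <= l by lra.
have i1 : 0 <= l <= l by lra.
have := leg _ i0; have := leg _ i1.
have := metric_triangle (prj P (g 0)) (prj P (g t0)) (prj P (g l)).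
by rewrite (metric_sym (prj P (g t0))); lra.
Qed.

(** Otherwise take the distance of two projections q and q' as the scale. A geodesic between points
    of Q stays near Q and, as it cannot miss P, passes near q and q'. In the cone these are two
    points at distance 1 in both limits, against (T1). *)
Lemma projection_AP3 : exists2 D : R, 0 <= D & forall P Q, PP P -> PP Q -> Q <> P ->
  forall x y, Q x -> Q y -> mdist (prj P x) (prj P y) <= D.
Proof.
apply: contrapT => nD; have m1 := M1.
have /choice[f fP] n : exists f : set X * set X * X * X, let: (P, Q, x, y) := f in
    [/\ [/\ PP P, PP Q & Q <> P], Q x, Q y & n.+1%:R <= mdist (prj P x) (prj P y)].
  apply: contrapT => nf; apply: nD; exists n.+1%:R => // P Q PPP PPQ QP x y Qx Qy.
  rewrite leNgt; apply/negP => lt; apply: nf; exists (P, Q, x, y).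
  by split=> //; exact: ltW.
pose P n := (f n).1.1.1; pose Q n := (f n).1.1.2; pose x n := (f n).1.2; pose y n := (f n).2.
have {}fP n : [/\ [/\ PP (P n), PP (Q n) & Q n <> P n], Q n (x n), Q n (y n) &
    n.+1%:R <= mdist (prj (P n) (x n)) (prj (P n) (y n))].
  by have := fP n; rewrite /P /Q /x /y; case: (f n) => [[[]]].
pose q n := prj (P n) (x n); pose q' n := prj (P n) (y n).
have qge n : n.+1%:R <= mdist (q n) (q' n) by have [] := fP n.
have [r [rf r_oo]] := posnum_seq qge.
have scale_oo := scale_ultra UU nU r_oo.
have [l [g gP]] := geodesic_choice geoX x y.
have PPP : \forall n \near U, PP (P n) by apply: nearW => n; have [[]] := fP n.
have PPQ : \forall n \near U, PP (Q n) by apply: nearW => n; have [[]] := fP n.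
have PQ : \forall n \near U, P n <> Q n.
  by apply: nearW => n; have [[_ _ /nesym]] := fP n.
have vq : visible (U := U) (p := q) (r := r) q by exact: visible_base.
have vq' : visible (U := U) (p := q) (r := r) q'.
  by apply: (visible_near UU vq (c := 1)); apply: nearW => n; rewrite rf mul1r.
(* C + M + 1 from the projection to the geodesic, then 4 M + 5 from the geodesic to Q. *)
pose K := C + M + 1 + (4 * M + 5).
have near_Q : \forall n \near U, within_dist K (Q n) (q n) /\ within_dist K (Q n) (q' n).
  apply: filterS (scale_oo (2 * C + 1)) => n; rewrite rf => Cn.
  have [[PPn PQn _] Qx Qy _] := fP n; have [gg gx gy] := gP n.
  have l0 := geodesic_ge0 gg.
  have Q0 : Q n (g n 0) by rewrite gx.
  have Ql : Q n (g n (l n)) by rewrite gy.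
  have meet : exists2 t, 0 <= t <= l n & within_dist M (P n) (g n t).
    apply: contrapT => nm.
    have := projection_missing PPn gg; rewrite gx gy -/(q n) -/(q' n) => H.
    have : mdist (q n) (q' n) <= 2 * C.
      by apply: H => t tl wt; apply: nm; exists t.
    by lra.
  have step u z : 0 <= u <= l n -> mdist (g n u) z <= C + M + 1 -> within_dist K (Q n) z.
    move=> ul uz; have [c Qc uc] := quasi_convex PQn gg Q0 Ql ul.
    exists c => //; have := metric_triangle z (g n u) c.
    by rewrite (metric_sym z (g n u)) /K; lra.
  split; last first.
    have [u ul [du _]] := projection_last_exit PPn gg meet.
    by rewrite gy in du; exact: step ul du.
  have [|u ul [du _]] := projection_last_exit PPn (geodesic_rev gg).
    have [t tl wt] := meet; exists (l n - t); first lra.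
    by rewrite (_ : l n - (l n - t) = t)//; ring.
  rewrite subrr gx in du.
  by apply: (step (l n - u)) => //; lra.
have LQ : ultralimit UU q r Q (cone_pt UU q).
  by apply: (ultralimit_bounded (c := K) UU scale_oo vq); apply: filterS near_Q => n [].
have LQ' : ultralimit UU q r Q (cone_pt UU q').
  by apply: (ultralimit_bounded (c := K) UU scale_oo vq'); apply: filterS near_Q => n [].
have LP : ultralimit UU q r P (cone_pt UU q).
  by apply: ultralimit_pt => //; apply: filterS PPP => n /(prjP (x n))[].
have LP' : ultralimit UU q r P (cone_pt UU q').
  by apply: ultralimit_pt => //; apply: filterS PPP => n /(prjP (y n))[].
have qq' := atg_T1 atg r_oo PPP PPQ PQ (conj LP LQ) (conj LP' LQ').
have : 1 <= mdist (cone_pt UU (p := q) (r := r) q) (cone_pt UU q').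
  by apply: cone_ge => //; apply: nearW => n; rewrite rf mul1r.
by rewrite qq' mdistxx; lra.
Qed.

End Projections.

Lemma projections_of_tree_graded (R : realType) (X : metricType R) (PP : set (set X))
    (U : set_system nat) (UU : UltraFilter U) :
  nonprincipal U -> geodesic_space X -> (forall P, PP P -> P !=set0) ->
  asymptotically_tree_graded PP UU ->
  exists prj : set X -> X -> X, almost_projection_system PP prj.
Proof.
move=> nU geoX PPne atg.
have [M' M'0 tM'] := quasi_transversal nU atg.
pose M := M' + 1.
have M1 : 1 <= M by rewrite /M; lra.
have M0 : 0 <= M by lra.
have tM : transversal_bound PP M.
  move=> P PPP l g gg h1 h2; have [t tl [q Pq d]] := tM' P PPP l g gg h1 h2.
  by exists t => //; exists q => //; rewrite /M; lra.
have [C C0 bdd] := bounded_divergence nU geoX atg M0 tM.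
have [prj prjP] := nearest_projection PPne.
have [D D0 ap3] := projection_AP3 nU geoX atg M1 tM prjP bdd.
exists prj; split=> [P PPP x|]; first exact: (prjP P x PPP).1.
exists (2 * (C + M + 1) + D); first lra.
move=> P PPP; split=> [x a Pa|x|Q PPQ QP].
- by have := projection_AP1 geoX M1 prjP bdd x PPP Pa; lra.
- apply/diam_le => _ _ [y /= xy <-] [z /= xz <-].
  have {}xy : mdist (prj P x) (prj P y) <= C.
    by apply: (projection_AP2 geoX M1 prjP bdd PPP); apply/edist_inf_ge.
  have {}xz : mdist (prj P x) (prj P z) <= C.
    by apply: (projection_AP2 geoX M1 prjP bdd PPP); apply/edist_inf_ge.
  have := metric_triangle (prj P y) (prj P x) (prj P z).
  by rewrite (metric_sym (prj P y) (prj P x)); lra.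
- apply/diam_le => _ _ [y Qy <-] [z Qz <-].
  by have := ap3 _ _ PPP PPQ QP _ _ Qy Qz; lra.
Qed.

(** * Thinness of transverse triangles *)

Section Chains.
Context {R : realType} {X : metricType R}.
Implicit Types (m x y z : X) (d c : R).

(** In the cone of scale d based at m, the upper bounds make x and y visible, and the lower bound d
    / 2 keeps the limit of the geodesic h off the base point. *)
Definition link d m c x y := [/\ mdist m x <= c * d, mdist m y <= c * d &
  exists k h, [/\ geodesic k h, h 0 = x, h k = y &
    forall s, 0 <= s <= k -> d / 2 <= mdist m (h s)]].

Fixpoint linked d m c k x z :=
  if k is k'.+1 then exists2 y, link d m c x y & linked d m c k' y z else x = z.

Lemma link_along d m c l g u v : geodesic l g -> 0 <= u <= l -> 0 <= v <= l ->
  (forall t, 0 <= t <= l -> Num.min u v <= t <= Num.max u v -> d / 2 <= mdist m (g t)) ->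
  mdist m (g u) <= c * d -> mdist m (g v) <= c * d -> link d m c (g u) (g v).
Proof.
move=> gg ul vl H mu mv; split=> //.
have [h [gh h0 hE hP]] := geodesic_sub gg ul vl.
exists `|v - u|, h; split=> // s sl.
by have [w [wl wb ->]] := hP s sl; exact: H.
Qed.

Lemma link_refl d m c x : d / 2 <= mdist m x -> mdist m x <= c * d -> link d m c x x.
Proof.
move=> h1 h2; split=> //; exists 0, (fun=> x); split=> //; exact: geodesic_cst.
Qed.

Hypothesis geoX : geodesic_space X.

Lemma link_jump d m c x y : 0 <= d -> 5 * d <= mdist m x -> mdist x y <= 2 * d ->
  mdist m x <= (c - 2) * d -> link d m c x y.
Proof.
move=> d0 mx xy mc; have := metric_triangle m x y => mxy.
split; [lra|lra|].
have [k [h [gh h0 hk _]]] := geoX (Logic.I : setT x) (Logic.I : setT y).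
exists k, h; split=> // s sl.
have kE : mdist x y = k by rewrite -h0 -hk (geodesic_length gh).
have := metric_triangle m (h s) x.
by rewrite -{2}h0 (metric_sym (h s) (h 0)) (geodesic_mdist gh); lra.
Qed.

Lemma link_sym d m c x y : link d m c x y -> link d m c y x.
Proof.
move=> [mx my [k [h [gh h0 hk H]]]]; split=> //; exists k, (fun s => h (k - s)).
split; [exact: geodesic_rev|by rewrite subr0|by rewrite subrr|].
by move=> s sk; apply: H; lra.
Qed.

Lemma exit_point (W : X -> Prop) l g t0 d : geodesic l g -> 0 < d -> t0 <= l ->
  d <= t0 -> W (g 0) ->
  (forall t, 0 <= t <= l -> exists2 z, W z & mdist (g t) z <= 2 * d) ->
  exists a, [/\ 0 <= a, t0 - 10 * d <= a, a <= t0 - d / 2 &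
    exists2 z, W z & link d (g t0) 200 (g a) z /\ mdist (g a) z <= 2 * d].
Proof.
move=> gg d0 tl dt W0 N; set m := g t0.
have md a : 0 <= a -> a <= t0 -> mdist m (g a) = t0 - a.
  by move=> a0 at0; rewrite metric_sym (geodesic_mdist gg).
have [ha|ha] := leP (t0 - 10 * d) 0.
  have e : mdist m (g 0) = t0 by rewrite md; lra.
  exists 0; split=> //; first lra.
  exists (g 0) => //; rewrite mdistxx; split; last lra.
  by apply: link_refl; rewrite e; lra.
have e : mdist m (g (t0 - 10 * d)) = 10 * d by rewrite md; lra.
exists (t0 - 10 * d); split; [lra|lra|lra|].
have [|z Wz gz] := N (t0 - 10 * d); first lra.
by exists z => //; split=> //; apply: link_jump; rewrite ?e; lra.
Qed.

(** From a point within 12 d of m, walking 100 d towards the start of the side leads to a distance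
    between 88 d and 112 d from m, where jumps are safe, unless the vertex is reached first. *)
Lemma walk l g t m d : geodesic l g -> 0 < d ->
  (forall t, 0 <= t <= l -> d <= mdist m (g t)) -> 0 <= t <= l ->
  mdist m (g t) <= 12 * d -> exists v, [/\ 0 <= v <= t, link d m 200 (g t) (g v),
    mdist m (g v) <= 112 * d & v = 0 \/ (v = t - 100 * d /\ 88 * d <= mdist m (g v))].
Proof.
move=> gg d0 far tl mt.
have [v vt vP] : exists2 v, 0 <= v <= t & t - v <= 100 * d /\ (v = 0 \/ v = t - 100 * d).
  have [ht|ht] := leP (t - 100 * d) 0.
    by exists 0; [lra|split; [lra|left]].
  by exists (t - 100 * d); [lra|split; [lra|right]].
have e : mdist (g v) (g t) = t - v by rewrite (geodesic_mdist gg); lra.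
have t1 := metric_triangle m (g t) (g v).
have t2 := metric_triangle (g v) m (g t).
rewrite (metric_sym (g t) (g v)) e in t1; rewrite (metric_sym (g v) m) e in t2.
have vl : 0 <= v <= l by lra.
case: vP => tv vP; have mv : mdist m (g v) <= 112 * d by lra.
exists v; split=> //; last by case: vP => vE; [left|right; split=> //; lra].
apply: (link_along gg) => // [w wl _||]; [|lra..].
by have := far w wl; lra.
Qed.

End Chains.

(** On either side of [g1 t0] one leaves [g1] for another side. If both exits reach the same side,
    it joins them. Otherwise walk on from the first exit until the vertex or a jump leads to the
    side of the second exit, or to [g1] beyond [g1 t0]. The constants: 114 = 112 + 2 after a jump,
    200 as a uniform bound, and 7 links in the longest case. *)
Lemma fat_triangle_chain (R : realType) (X : metricType R) (geoX : geodesic_space X)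
    (l1 : R) (g1 : R -> X) (l2 : R) (g2 : R -> X) (l3 : R) (g3 : R -> X) (t0 d : R) :
  geodesic l1 g1 -> geodesic l2 g2 -> geodesic l3 g3 ->
  g1 l1 = g2 0 -> g2 l2 = g3 0 -> g3 l3 = g1 0 -> 0 < d -> 0 <= t0 <= l1 ->
  (forall t, 0 <= t <= l2 -> d <= mdist (g1 t0) (g2 t)) ->
  (forall t, 0 <= t <= l3 -> d <= mdist (g1 t0) (g3 t)) ->
  (forall t, 0 <= t <= l1 -> (exists2 t', 0 <= t' <= l2 & mdist (g1 t) (g2 t') <= 2 * d) \/
                             (exists2 t', 0 <= t' <= l3 & mdist (g1 t) (g3 t') <= 2 * d)) ->
  (forall t, 0 <= t <= l2 -> (exists2 t', 0 <= t' <= l3 & mdist (g2 t) (g3 t') <= 2 * d) \/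
                             (exists2 t', 0 <= t' <= l1 & mdist (g2 t) (g1 t') <= 2 * d)) ->
  (forall t, 0 <= t <= l3 -> (exists2 t', 0 <= t' <= l1 & mdist (g3 t) (g1 t') <= 2 * d) \/
                             (exists2 t', 0 <= t' <= l2 & mdist (g3 t) (g2 t') <= 2 * d)) ->
  [/\ d <= t0, t0 + d <= l1 & exists2 k, (k < 8)%N &
    linked d (g1 t0) 200 k (g1 (t0 - d / 2)) (g1 (t0 + d / 2))].
Proof.
move=> G1 G2 G3 E1 E2 E3 d0 t0l far2 far3 N1 N2 N3.
have q10 : 10 <= 200 :> R by lra.
have q112 : 112 <= 200 :> R by lra.
have q114 : 114 <= 200 :> R by lra.
have l10 := geodesic_ge0 G1; have l20 := geodesic_ge0 G2; have l30 := geodesic_ge0 G3.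
have /andP[t00 t0l1] := t0l.
have dt0 : d <= t0.
  have := far3 l3; rewrite E3 metric_sym (geodesic_mdist G1)//.
  by rewrite subr0; apply; rewrite lexx l30.
have dl1 : d <= l1 - t0.
  have := far2 0; rewrite -E1 (geodesic_mdist G1)//.
  by apply; rewrite lexx l20.
pose W z := (exists2 t, 0 <= t <= l2 & z = g2 t) \/ (exists2 t, 0 <= t <= l3 & z = g3 t).
have NW t : 0 <= t <= l1 -> exists2 z, W z & mdist (g1 t) z <= 2 * d.
  move=> /N1[[t' t'l dt]|[t' t'l dt]].
    by exists (g2 t') => //; left; exists t'.
  by exists (g3 t') => //; right; exists t'.
have W0 : W (g1 0) by right; exists l3; rewrite ?E3// lexx l30.
have W1 : W (g1 (l1 - 0)) by left; exists 0; rewrite ?subr0// lexx l20.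
have [a [a0 a10 at0 [a' Wa' [laa' daa']]]] := exit_point geoX G1 d0 t0l1 dt0 W0 NW.
have NW' t : 0 <= t <= l1 -> exists2 z, W z & mdist (g1 (l1 - t)) z <= 2 * d.
  by move=> tl; apply: NW; clear - tl; lra.
have t0l1' : l1 - t0 <= l1 by rewrite gerBl.
have [b [b0 b10 bt0 [b' Wb' [lbb' dbb']]]] :=
  exit_point geoX (geodesic_rev G1) d0 t0l1' dl1 W1 NW'.
rewrite (_ : l1 - (l1 - t0) = t0) in lbb'; last by ring.
have {b0 b10 bt0} [c [cl c0 c10 Wc]] : exists c, [/\ c <= l1, t0 + d / 2 <= c,
    c <= t0 + 10 * d & link d (g1 t0) 200 (g1 c) b' /\ mdist (g1 c) b' <= 2 * d].
  by exists (l1 - b); split=> //; clear - b0 b10 bt0; lra.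
case: Wc => {}lbb' {}dbb' {b}.
set m := g1 t0 in far2 far3 laa' lbb' *.
have m1 t : 0 <= t <= l1 -> mdist m (g1 t) = `|t0 - t|.
  by move=> tl; rewrite (geodesic_gap G1).
have ma t : t0 - 10 * d <= t -> t <= t0 + 10 * d -> 0 <= t <= l1 ->
    mdist m (g1 t) <= 10 * d.
  by move=> h1 h2 tl; rewrite m1// ler_norml; clear - h1 h2; lra.
have along1 u v : 0 <= u <= l1 -> 0 <= v <= l1 ->
    (u <= t0 - d / 2 /\ v <= t0 - d / 2) \/ (t0 + d / 2 <= u /\ t0 + d / 2 <= v) ->
    mdist m (g1 u) <= 200 * d -> mdist m (g1 v) <= 200 * d ->
    link d m 200 (g1 u) (g1 v).
  move=> ul vl side mu mv; apply: (link_along G1) => // t tl tb.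
  rewrite m1// ler_normr; apply/orP; case: side => -[su sv]; [left|right].
    by clear - tb su sv; case: (leP u v) tb; lra.
  by clear - tb su sv; case: (leP u v) tb; lra.
have al : 0 <= a <= l1 by clear - a0 at0 t0l1 d0; lra.
have cl1 : 0 <= c <= l1 by clear - cl c0 t00 d0; lra.
have le200 x k : x <= k * d -> k <= 200 -> x <= 200 * d.
  by move=> h k200; apply: (le_trans h); rewrite ler_pM2r.
have ma' : mdist m (g1 a) <= 10 * d by apply: ma => //; clear - at0 d0; lra.
have mc : mdist m (g1 c) <= 10 * d by apply: ma => //; clear - c0 d0; lra.
have first_link : link d m 200 (g1 (t0 - d / 2)) (g1 a).
  have tl : 0 <= t0 - d / 2 <= l1 by clear - dt0 d0 t0l1; lra.
  have h : mdist m (g1 (t0 - d / 2)) <= 10 * d.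
    by apply: ma => //; clear - d0; lra.
  by apply: along1 => //; [left; split|exact: le200 h q10|exact: le200 ma' q10].
have last_link : link d m 200 (g1 c) (g1 (t0 + d / 2)).
  have tl : 0 <= t0 + d / 2 <= l1 by clear - dl1 d0 t00; lra.
  have h : mdist m (g1 (t0 + d / 2)) <= 10 * d.
    by apply: ma => //; clear - d0; lra.
  by apply: along1 => //; [right; split|exact: le200 mc q10|exact: le200 h q10].
have ma2 : mdist m a' <= 12 * d.
  by have := metric_triangle m (g1 a) a'; clear - ma' daa'; lra.
have mb2 : mdist m b' <= 12 * d.
  by have := metric_triangle m (g1 c) b'; clear - mc dbb'; lra.
have {}lbb' := link_sym lbb'.
have along l g u v : geodesic l g -> (forall t, 0 <= t <= l -> d <= mdist m (g t)) ->
    0 <= u <= l -> 0 <= v <= l -> mdist m (g u) <= 114 * d -> mdist m (g v) <= 114 * d ->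
    link d m 200 (g u) (g v).
  move=> gg far ul vl mu mv; apply: (link_along gg) => //; [|exact: le200 mu q114|exact: le200 mv q114].
  by move=> t tl _; have := far t tl; clear - d0; lra.
have le114 x k : x <= k * d -> k <= 114 -> x <= 114 * d.
  by move=> h k114; apply: (le_trans h); rewrite ler_pM2r.
have jump x y : mdist m x <= 112 * d -> 88 * d <= mdist m x -> mdist x y <= 2 * d ->
    link d m 200 x y /\ 86 * d <= mdist m y <= 114 * d.
  move=> h1 h2 h3; split.
    by apply: link_jump => //; clear - h1 h2 d0; lra.
  have := metric_triangle m x y; have := metric_triangle m y x.
  by rewrite (metric_sym y x); clear - h1 h2 h3 d0; lra.
have right_side t : 0 <= t <= l1 -> 86 * d <= mdist m (g1 t) <= 114 * d ->
    link d m 200 (g1 t) (g1 c) \/ t <= t0 - 86 * d.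
  move=> tl /andP[h1 h2]; have [ht|ht] := leP (t0 + d / 2) t.
    by left; apply: along1 => //; [right|exact: le200 h2 q114|exact: le200 mc q10].
  right; move: h1; rewrite m1// ler_normr => /orP[]; clear - ht d0; lra.
have p112 : 112 <= 114 :> R by rewrite ler_nat.
have p12 : 12 <= 114 :> R by rewrite ler_nat.
split=> //; first by clear - dl1; lra.
case: Wa' => -[u ul a'E]; case: Wb' => -[v vl b'E]; subst a' b'.
- exists 5%N => //; exists (g1 a) => //; exists (g2 u) => //; exists (g2 v).
    by apply: (along _ _ _ _ G2) => //; (exact: le114 ma2 p12 || exact: le114 mb2 p12).
  by exists (g1 c) => //; exists (g1 (t0 + d / 2)).
- have [w [wu lw mw wP]] := walk G2 d0 far2 ul ma2.
  case: wP => [w0|[wE mw']].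
    exists 5%N => //; exists (g1 a) => //; exists (g2 u) => //; exists (g2 w) => //.
    exists (g1 c); last by exists (g1 (t0 + d / 2)).
    rewrite w0 -E1 in mw *; apply: along1; rewrite ?l10 ?lexx//.
    + by right; split=> //; clear - dl1 d0; lra.
    + by apply: le200 mw q112.
    + by apply: le200 mc q10.
  have wl : 0 <= w <= l2 by clear - wu ul; lra.
  have [[t tl wt]|[t tl wt]] := N2 _ wl; have [lwt mt] := jump _ _ mw mw' wt.
    exists 7%N => //; exists (g1 a) => //; exists (g2 u) => //; exists (g2 w) => //.
    exists (g3 t) => //; exists (g3 v).
      by apply: (along _ _ _ _ G3) => //; [case/andP: mt|exact: le114 mb2 p12].
    by exists (g1 c) => //; exists (g1 (t0 + d / 2)).
  have [tc|tt0] := right_side t tl mt.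
    exists 6%N => //; exists (g1 a) => //; exists (g2 u) => //; exists (g2 w) => //.
    by exists (g1 t) => //; exists (g1 c) => //; exists (g1 (t0 + d / 2)).
  (* The walk came 100 d closer to the vertex [g1 l1], so a landing point on [g1] must be past t0 in
     the direction of this vertex. *)
  exfalso.
  have e1 : mdist (g2 0) (g2 w) = w by rewrite (geodesic_mdist G2) ?subr0//; clear - wl; lra.
  have e2 : mdist (g2 0) (g2 u) = u by rewrite (geodesic_mdist G2) ?subr0//; clear - ul; lra.
  have e3 : mdist (g1 t) (g1 l1) = l1 - t by rewrite (geodesic_mdist G1)//; clear - tl; lra.
  have e4 : mdist (g1 a) (g1 l1) = l1 - a by rewrite (geodesic_mdist G1)//; clear - al; lra.
  have h1 := metric_triangle (g2 0) (g1 a) (g2 u).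
  have h2 := metric_triangle (g2 0) (g2 w) (g1 t).
  rewrite -E1 (metric_sym (g1 l1) (g1 a)) e4 E1 e2 in h1.
  rewrite -{1}E1 (metric_sym (g1 l1) (g1 t)) e3 e1 in h2.
  by clear - h1 h2 wt daa' wE tt0 a10 d0; lra.
- have [w [wu lw mw wP]] := walk G3 d0 far3 ul ma2.
  case: wP => [w0|[wE mw']].
    exists 6%N => //; exists (g1 a) => //; exists (g3 u) => //; exists (g3 w) => //.
    exists (g2 v); last by exists (g1 c) => //; exists (g1 (t0 + d / 2)).
    rewrite w0 -E2 in mw *; apply: (along _ _ _ _ G2); rewrite ?l20 ?lexx//.
    + by apply: le114 mw p112.
    + by apply: le114 mb2 p12.
  have wl : 0 <= w <= l3 by clear - wu ul; lra.
  have [[t tl wt]|[t tl wt]] := N3 _ wl; have [lwt mt] := jump _ _ mw mw' wt; last first.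
    exists 7%N => //; exists (g1 a) => //; exists (g3 u) => //; exists (g3 w) => //.
    exists (g2 t) => //; exists (g2 v).
      by apply: (along _ _ _ _ G2) => //; [case/andP: mt|exact: le114 mb2 p12].
    by exists (g1 c) => //; exists (g1 (t0 + d / 2)).
  have [tc|tt0] := right_side t tl mt.
    exists 6%N => //; exists (g1 a) => //; exists (g3 u) => //; exists (g3 w) => //.
    by exists (g1 t) => //; exists (g1 c) => //; exists (g1 (t0 + d / 2)).
  (* Here the walk went 100 d away from the vertex [g1 0], so a landing point on [g1] must again be
     past t0. *)
  exfalso.
  have e1 : mdist (g3 w) (g3 l3) = l3 - w by rewrite (geodesic_mdist G3)//; clear - wl; lra.
  have e2 : mdist (g3 u) (g3 l3) = l3 - u by rewrite (geodesic_mdist G3)//; clear - ul; lra.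
  have e3 : mdist (g1 0) (g1 t) = t by rewrite (geodesic_mdist G1) ?subr0//; clear - tl; lra.
  have e4 : mdist (g1 0) (g1 a) = a by rewrite (geodesic_mdist G1) ?subr0//; clear - al; lra.
  have h1 := metric_triangle (g1 0) (g3 u) (g1 a).
  have h2 := metric_triangle (g1 0) (g1 t) (g3 w).
  rewrite e4 -E3 (metric_sym (g3 l3)) e2 (metric_sym (g3 u) (g1 a)) in h1.
  rewrite e3 -E3 (metric_sym (g3 l3)) e1 (metric_sym (g1 t) (g3 w)) in h2.
  by clear - h1 h2 wt daa' wE tt0 a10 d0; lra.
- exists 5%N => //; exists (g1 a) => //; exists (g3 u) => //; exists (g3 v).
    by apply: (along _ _ _ _ G3) => //; (exact: le114 ma2 p12 || exact: le114 mb2 p12).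
  by exists (g1 c) => //; exists (g1 (t0 + d / 2)).
Qed.

(** The point is chosen so that d exceeds half of the supremum of all such distances; a point of any
    side at distance 2 d from the other sides would beat the supremum. *)
Lemma fat_triangle (R : realType) (X : metricType R) (T : geodesic_triangle X) (c : R) :
  0 < c -> ~ thin_triangle c T -> exists i t0 d,
  [/\ c <= d, 0 <= t0 <= side_length T i,
    forall j t, j != i -> 0 <= t <= side_length T j ->
      d <= mdist (side_path T i t0) (side_path T j t) &
    forall j t, 0 <= t <= side_length T j -> exists k s,
      [/\ k != j, 0 <= s <= side_length T k &
          mdist (side_path T j t) (side_path T k s) <= 2 * d]].
Proof.
move=> c0 nthin.
pose W := [set d | exists i t0, 0 <= t0 <= side_length T i /\
  forall j t, j != i -> 0 <= t <= side_length T j ->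
      d <= mdist (side_path T i t0) (side_path T j t)].
have Wc : W c.
  apply: contrapT => nW; apply: nthin => i _ [t0 /= t0l <-]; rewrite in_itv/= in t0l.
  apply: contrapT => nN; apply: nW; exists i, t0; split=> // j t ji tl.
  rewrite leNgt; apply/negP => lt; apply: nN; apply: within_dist_neighborhood.
  exists (side_path T j t); last exact: ltW.
  by exists j => //; exists t; rewrite //= in_itv.
have len i : 0 <= side_length T i by exact: geodesic_ge0 (side_geodesic T i).
have Wub d : W d -> d <= perimeter T.
  move=> [i [t0 [t0l H]]]; have := H (ordS i) 0 (ordS_neq i).1.
  rewrite lexx len -side_adjacent (geodesic_mdist (side_geodesic T i)); [|lra..].
  move=> /(_ isT) dl; apply: (le_trans dl).
  have h1 := len ord0; have h2 := len (ordS ord0); have h3 := len (ordS (ordS ord0)).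
  rewrite perimeterE; have [iE|iE|iE] := I3_cases ord0 i; subst i; lra.
have supW : has_sup W by split; [exists c|exists (perimeter T)].
have s0 : c <= sup W by exact: sup_upper_bound.
have s2 : 0 < sup W / 2 by lra.
have [d1 Wd1 d1s] := sup_adherent s2 supW.
have [d [Wd cd dmax]] : exists d, [/\ W d, c <= d & sup W < 2 * d].
  have [cd|dc] := leP c d1; first by exists d1; split=> //; lra.
  by exists c; split=> //; lra.
have [i [t0 [t0l H]]] := Wd; exists i, t0, d; split=> // j t tl.
apply: contrapT => nk.
have : W (2 * d).
  exists j, t; split=> // k s kj sl; rewrite leNgt; apply/negP => lt.
  by apply: nk; exists k, s; split=> //; exact: ltW.
by move=> /(sup_upper_bound supW); lra.
Qed.

(** Pigeonhole for the ultrafilter: the number of links takes finitely many values, hence is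
    constant almost everywhere, and an induction on it makes sense in the cone. *)
Lemma ultra_bounded {U : set_system nat} (UU : UltraFilter U) (N : nat)
    (Q : nat -> nat -> Prop) :
  (\forall n \near U, exists2 k, (k < N)%N & Q k n) -> exists k, \forall n \near U, Q k n.
Proof.
elim: N => [|N IH] H; first by have [n [k]] := filter_ex H.
have : \forall n \near U, (exists2 k, (k < N)%N & Q k n) \/ Q N n.
  apply: filterS H => n [k]; rewrite ltnS leq_eqVlt => /orP[/eqP->|kN] Qk.
    by right.
  by left; exists k.
by move=> /(ultra_or UU)[/IH//|QN]; exists N.
Qed.

(** * The cone at a fat point of a transverse side *)

Section TransverseFree.
Context {R : realType} {X : metricType R} {PP : set (set X)}.
Context {U : set_system nat} (UU : UltraFilter U).
Hypothesis nU : nonprincipal U.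
Hypothesis geoX : geodesic_space X.
Hypothesis atg : asymptotically_tree_graded PP UU.
Context {M : R}.
Hypothesis M0 : 0 <= M.
Hypothesis tM : transversal_bound PP M.

(* [S] is the side of [g (t0 - d / 2)] in the cone of scale [d] based at [g t0]. *)
Lemma transverse_sides (l : nat -> R) (g : nat -> R -> X) (t0 d : nat -> R) :
  (forall n, [/\ geodesic (l n) (g n), n.+1%:R <= d n, d n <= t0 n & t0 n + d n <= l n]) ->
  (forall e, 0 < e -> \forall n \near U, forall P s t, PP P -> 0 <= s <= l n ->
     0 <= t <= l n -> within_dist M P (g n s) -> within_dist M P (g n t) ->
     mdist (g n s) (g n t) <= e * d n) ->
  exists S : (nat -> X) -> Prop,
   [/\ S (fun n => g n (t0 n - d n / 2)), ~ S (fun n => g n (t0 n + d n / 2)),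
     forall c x y, (\forall n \near U, link (d n) (g n (t0 n)) c (x n) (y n)) -> S x -> S y &
     forall x y, (\forall n \near U, x n = y n) -> S x -> S y].
Proof.
move=> H1 H2.
have dn n : n.+1%:R <= d n by have [] := H1 n.
have d0 n : 0 < d n by apply: lt_le_trans (dn n); rewrite ltr0n.
have [r [rd r_oo]] := posnum_seq dn.
pose m n := g n (t0 n).
(* A stretch of length [d n] with [m n] in the middle; in the cone it has length 1 and its point at
   1/2 is the base point. *)
pose h n s := g n (t0 n - d n / 2 + s).
have gh n : geodesic (d n) (h n).
  have [gn _ h1 h2] := H1 n; have hd := d0 n.
  have := geodesic_part gn (a := t0 n - d n / 2) (b := t0 n + d n / 2).
  rewrite (_ : t0 n + d n / 2 - (t0 n - d n / 2) = d n); last by field.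
  by apply; lra.
have gha : \forall n \near U, geodesic (d n) (h n) by apply: nearW.
have mE n : h n (d n / 2) = m n by rewrite /h /m subrK.
have h0E n : h n 0 = g n (t0 n - d n / 2) by rewrite /h addr0.
have h1E n : h n (d n) = g n (t0 n + d n / 2).
  by rewrite /h; congr (g n _); field.
have vm : visible (U := U) (p := m) (r := r) m by exact: visible_base.
have v0 : visible (U := U) (p := m) (r := r) (fun n => h n 0).
  apply: (visible_near UU vm (c := 1)); apply: nearW => n; have hd := d0 n.
  by rewrite -mE metric_sym (geodesic_mdist (gh n)) ?rd; lra.
have v1 : visible (U := U) (p := m) (r := r) (fun n => h n (d n)).
  apply: (visible_near UU vm (c := 1)); apply: nearW => n; have hd := d0 n.
  by rewrite -mE (geodesic_mdist (gh n)) ?rd; lra.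
pose pt := cone_pt UU (p := m) (r := r).
have D1 : mdist (pt (fun n => h n 0)) (pt (fun n => h n (d n))) = 1.
  apply/eqP; rewrite eq_le; apply/andP; split.
    by apply: cone_le => //; apply: nearW => n; rewrite rd mul1r (geodesic_length (gh n)).
  by apply: cone_ge => //; apply: nearW => n; rewrite rd mul1r (geodesic_length (gh n)).
have [A [gA A0 A1 AP]] := limit_geodesic UU gha v0 v1.
rewrite -!/pt D1 in gA A0 A1 AP.
have i0 : 0 <= 1 / 4 :> R by lra.
have i1 : 1 / 4 < 1 / 2 :> R by lra.
have i2 : 1 / 2 < 3 / 4 :> R by lra.
have i3 : 3 / 4 <= 1 :> R by lra.
have i4 : 0 <= (1 / 2 : R) <= 1 by lra.
have Am : A (1 / 2) = pt m.
  have [_ ->] := AP _ i4; congr pt; apply/funext => n; rewrite -mE; congr (h n _).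
  by have hd := d0 n; rewrite rd min_l; lra.
have [P s t PPP s1 st t3 Ps Pt|S [S1 S2 S3]] := atg_separation atg r_oo gA i0 i1 i2 i3.
  have gP := atg_gated atg r_oo PPP (ex_intro _ _ Ps).
  (* A limit of pieces met at s and t yields points of the side near the same piece before u and
     after v. They are at least (t - s) / 3 times the scale apart, while transversality allows only
     (t - s) / 6. *)
  pose u := (2 * s + t) / 3; pose v := (s + 2 * t) / 3.
  have Pconv w : s <= w -> w <= t -> ultralimit UU m r P (A w).
    by move=> sw wt; apply: (gated_convex gP.1 gA (a := s) (b := t)) => //; lra.
  have su : s < u by rewrite /u; lra.
  have uv : v - u = (t - s) / 3 by rewrite /u /v; field.
  have vt : v < t by rewrite /v; lra.
  have Pu : ultralimit UU m r P (A u) by apply: Pconv; rewrite /u; clear - geoX atg tM st; lra.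
  have Pv : ultralimit UU m r P (A v) by apply: Pconv; rewrite /v; clear - geoX atg tM st; lra.
  have s0 : 0 <= s by lra.
  have v00 : 0 <= v by rewrite /v; lra.
  have u1 : u <= 1 by rewrite /u; lra.
  have t1 : t <= 1 by lra.
  have e0 : 0 < (t - s) / 6 by lra.
  have [n [[[x [sx xu xd wx]] [y [vy yt yd wy]]] [PPn Fn]]] := filter_ex (filterI
    (filterI (limit_meets atg tM r_oo gha v0 v1 PPP AP gA (esym D1) s0 su u1 Ps Pu)
      (limit_meets atg tM r_oo gha v0 v1 PPP AP gA (esym D1) v00 vt t1 Pv Pt))
    (filterI PPP (H2 _ e0))).
  rewrite rd in sx xu vy yt.
  have hd := d0 n; have [_ _ h1 h2] := H1 n.
  have sd : 0 <= s * d n by rewrite mulr_ge0// ltW.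
  have vd : 0 <= v * d n by rewrite mulr_ge0// ltW.
  have uvd : v * d n - u * d n = (t - s) / 3 * d n by rewrite -mulrBl uv.
  have tsd : 0 < (t - s) / 3 * d n by rewrite mulr_gt0//; clear - geoX atg tM st; lra.
  have xl : 0 <= t0 n - d n / 2 + x <= l n by clear - geoX atg tM sx sd xd h1 h2 hd; lra.
  have yl : 0 <= t0 n - d n / 2 + y <= l n by clear - geoX atg tM vy vd yd h1 h2 hd; lra.
  have := Fn _ _ _ PPn xl yl wx wy.
  rewrite -/(h n x) -/(h n y) (geodesic_mdist (gh n));
    [|clear - geoX atg tM sx sd xu uvd tsd vy yd; lra..].
  have : (t - s) / 6 * d n = (t - s) / 3 * d n / 2 by field.
  by clear - geoX atg tM xu uvd tsd vy; lra.
exists (fun x => visible (U := U) (p := m) (r := r) x /\ S (pt x)); split.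
- have -> : (fun n => g n (t0 n - d n / 2)) = (fun n => h n 0) by apply/funext => n.
  by split=> //; rewrite -A0; apply: S1; lra.
- have -> : (fun n => g n (t0 n + d n / 2)) = (fun n => h n (d n)) by apply/funext => n.
  by move=> [_]; rewrite -A1; apply: S2; lra.
- move=> c x y xy [vx Sx].
  have vy : visible (U := U) (p := m) (r := r) y.
    by apply: (visible_near UU vm (c := c)); apply: filterS xy => n [_]; rewrite rd.
  have [f fP] : exists f : nat -> R * (R -> X), \forall n \near U,
      [/\ geodesic (f n).1 (f n).2, (f n).2 0 = x n, (f n).2 (f n).1 = y n &
      forall s, 0 <= s <= (f n).1 -> d n / 2 <= mdist (m n) ((f n).2 s)].
    apply: (@ultra_choice _ UU _ (fun n => (0, fun=> x n)) (fun n (f : R * (R -> X)) =>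
      [/\ geodesic f.1 f.2, f.2 0 = x n, f.2 f.1 = y n &
      forall s, 0 <= s <= f.1 -> d n / 2 <= mdist (m n) (f.2 s)])).
    by apply: filterS xy => n [_ _ [k [w H]]]; exists (k, w).
  pose k n := (f n).1; pose w n := (f n).2.
  have gw : \forall n \near U, geodesic (k n) (w n) by apply: filterS fP => n [].
  have [|vw0 w0E] := @cone_eq_ae _ _ _ UU m r x (fun n => w n 0) vx.
    by apply: filterS fP => n [].
  have [|vw1 w1E] := @cone_eq_ae _ _ _ UU m r y (fun n => w n (k n)) vy.
    by apply: filterS fP => n [].
  have [B [gB B0 B1 BP]] := limit_geodesic UU gw vw0 vw1.
  split=> //; rewrite /pt w1E -B1; apply/(S3 _ _ gB); last by rewrite B0 -w0E.
  move=> s sl; have [vs ->] := BP s sl; rewrite Am => BE.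
  have : 1 / 2 <= mdist (pt m) (pt (fun n => w n (Num.min (s * (r n)%:num) (k n)))).
    apply: cone_ge => //; apply: filterS fP => n [gn _ _ H].
    have := H (Num.min (s * (r n)%:num) (k n)); rewrite rd => {}H.
    have sr : 0 <= s * d n by rewrite mulr_ge0// ?(ltW (d0 n))//; case/andP: sl.
    have k0 := geodesic_ge0 gn; rewrite -/(k n) in k0.
    have kk : 0 <= Num.min (s * d n) (k n) <= k n.
      by rewrite le_min sr k0 ge_min lexx orbT.
    by have := H kk; rewrite -/(w n); lra.
  by rewrite [X in mdist _ X](_ : _ = pt m) ?mdistxx //; lra.
- move=> x y xy [vx Sx].
  by have [vy xyE] := @cone_eq_ae _ _ _ UU m r x y vx xy; split=> //; rewrite /pt -xyE.
Qed.

Lemma linked_side (S : (nat -> X) -> Prop) (d : nat -> R) (m : nat -> X) (c : R) k x y :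
  (forall x y, (\forall n \near U, link (d n) (m n) c (x n) (y n)) -> S x -> S y) ->
  (forall x y, (\forall n \near U, x n = y n) -> S x -> S y) ->
  (\forall n \near U, linked (d n) (m n) c k (x n) (y n)) -> S x -> S y.
Proof.
move=> S1 S2; elim: k x => [|k IH] x H Sx; first exact: S2 H Sx.
have [z zP] : exists z, \forall n \near U,
    link (d n) (m n) c (x n) (z n) /\ linked (d n) (m n) c k (z n) (y n).
  apply: (@ultra_choice _ UU _ x (fun n z =>
    link (d n) (m n) c (x n) z /\ linked (d n) (m n) c k z (y n))).
  by apply: filterS H => n [z]; exists z.
apply: (IH z); first by apply: filterS zP => n [].
by apply: S1 Sx; apply: filterS zP => n [].
Qed.

Lemma transverse_free_of_tree_graded : asymptotically_transverse_free PP.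
Proof.
apply: contrapT => nf.
have /choice[f fP] n : exists f : R * geodesic_triangle X * 'I_3 * R * R,
    let: (D, T, i, t0, d) := f in
    [/\ 1 <= D, almost_transverse PP M D T, n.+1%:R * D <= d &
     [/\ 0 <= t0 <= side_length T i,
       forall j t, j != i -> 0 <= t <= side_length T j ->
        d <= mdist (side_path T i t0) (side_path T j t) &
       forall j t, 0 <= t <= side_length T j -> exists k s,
        [/\ k != j, 0 <= s <= side_length T k &
          mdist (side_path T j t) (side_path T k s) <= 2 * d]]].
  (* With lambda = n + 1 and sigma = M the failure gives d >= (n + 1) D, so the transversality
     constant D is negligible in the cone of scale d. *)
  apply: contrapT => nn; apply: nf; exists n.+1%:R, M => D K D1 MK T aT.
  apply: contrapT => nthin; apply: nn.
  have D0 : 0 < n.+1%:R * D by rewrite mulr_gt0 ?ltr0n//; lra.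
  have [i [t0 [d [cd t0l H1 H2]]]] := fat_triangle D0 nthin.
  exists (D, T, i, t0, d); split=> // P j PPP; apply/diam_le => x y [Nx xj] [Ny yj].
  apply: ((diam_le _ _).1 (aT P j PPP)); split=> //; apply: le_trans; first exact: Nx.
    by rewrite lee_fin.
  by exact: Ny.
  by rewrite lee_fin.
pose D n := (f n).1.1.1.1; pose T n := (f n).1.1.1.2; pose i n := (f n).1.1.2.
pose t0 n := (f n).1.2; pose d n := (f n).2.
pose l n j := side_length (T n) j; pose g n j := side_path (T n) j.
have {}fP n : [/\ 1 <= D n, almost_transverse PP M (D n) (T n), n.+1%:R * D n <= d n &
   [/\ 0 <= t0 n <= l n (i n),
     forall j t, j != i n -> 0 <= t <= l n j -> d n <= mdist (g n (i n) (t0 n)) (g n j t) &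
     forall j t, 0 <= t <= l n j -> exists k s,
      [/\ k != j, 0 <= s <= l n k & mdist (g n j t) (g n k s) <= 2 * d n]]].
  by have := fP n; rewrite /l /g /D /T /i /t0 /d; case: (f n) => [[[[]]]].
have dn n : n.+1%:R <= d n.
  have [D1 _ h _] := fP n; apply: le_trans h; rewrite ler_peMr// ler0n.
have chain n : [/\ d n <= t0 n, t0 n + d n <= l n (i n) & exists2 k, (k < 8)%N &
    linked (d n) (g n (i n) (t0 n)) 200 k (g n (i n) (t0 n - d n / 2))
      (g n (i n) (t0 n + d n / 2))].
  have [D1 _ _ [t0l far N]] := fP n.
  have gg j := side_geodesic (T n) j; have adj j := side_adjacent (T n) j.
  have d0 : 0 < d n by apply: lt_le_trans (dn n); rewrite ltr0n.
  have [n1 n2] := ordS_neq (i n).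
  have nbr j t : 0 <= t <= l n j ->
      (exists2 s, 0 <= s <= l n (ordS j) & mdist (g n j t) (g n (ordS j) s) <= 2 * d n) \/
      (exists2 s, 0 <= s <= l n (ordS (ordS j)) &
        mdist (g n j t) (g n (ordS (ordS j)) s) <= 2 * d n).
    move=> /N[k [s [kj sl ds]]]; have [kE|kE|kE] := I3_cases j k; subst k.
    - by rewrite eqxx in kj.
    - by left; exists s.
    - by right; exists s.
  have N2 := nbr (ordS (i n)); have N3 := nbr (ordS (ordS (i n))).
  rewrite !ordS3 in N2 N3.
  have adj3 := adj (ordS (ordS (i n))); rewrite ordS3 in adj3.
  by apply: (fat_triangle_chain geoX (gg (i n)) (gg (ordS (i n)))
    (gg (ordS (ordS (i n)))) (adj _) (adj _) adj3 d0 t0l _ _ (nbr (i n)) N2 N3) => t tl;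
    apply: far.
have [||S [S1 S2 S3 S4]] := transverse_sides (l := fun n => l n (i n))
  (g := fun n => g n (i n)) (t0 := t0) (d := d).
- by move=> n; have [h1 h2 _] := chain n; split=> //; exact: side_geodesic.
- move=> e e0; have [r [rn r_oo]] := @posnum_seq R (fun n => n.+1%:R) (fun n => lexx _).
  apply: filterS (scale_small UU (scale_ultra UU nU r_oo) 1 e0) => n; rewrite rn => en.
  move=> P s t PPP sl tl ws wt; have [D1 aT Dd _] := fP n.
  have wn x : within_dist M P x -> neighborhood M P x.
    exact: within_dist_neighborhood.
  apply: (@le_trans _ _ (D n)).
    apply: ((diam_le _ _).1 (aT P (i n) PPP)).
      by split; [exact: wn|exists s; rewrite //= in_itv].
    by split; [exact: wn|exists t; rewrite //= in_itv].
  have D0 : 0 <= D n by lra.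
  apply: (@le_trans _ _ (e * (n.+1%:R * D n))); last by rewrite ler_pM2l.
  by rewrite mulrA ler_peMl.
have [k kP] : exists k, \forall n \near U, linked (d n) (g n (i n) (t0 n)) 200 k
    (g n (i n) (t0 n - d n / 2)) (g n (i n) (t0 n + d n / 2)).
  apply: (ultra_bounded UU (N := 8)); apply: nearW => n.
  by have [_ _ [k k8 H]] := chain n; exists k.
by apply: S2; apply: (linked_side (S3 200) S4 kP).
Qed.

End TransverseFree.

Theorem theorem2p14 (R : realType) (X : metricType R) (PP : set (set X))
    (U : set_system nat) (UU : UltraFilter U) :
  nonprincipal U ->
  geodesic_space X ->
  (forall P, PP P -> P !=set0) ->
  asymptotically_tree_graded PP UU <->
  (asymptotically_transverse_free PP /\
   exists pi : set X -> X -> X, almost_projection_system PP pi).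
Proof.
move=> nU geoX PPne; split=> [atg|[atf [prj ap]]]; last first.
  exact: tree_graded_of_projections ap.
split; last exact: projections_of_tree_graded atg.
have [M M0 tM] := quasi_transversal nU atg.
exact: transverse_free_of_tree_graded tM.
Qed.
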